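(* Let $K$ be a non-degenerate Calderón–Zygmund kernel on $\mathbb{R}^d$, and $b\in L^1_{\mathrm{loc}}(\mathbb{R}^d)$. Let $$1<q<p<\infty,\qquad r=\frac{pq}{p-q}\in(1,\infty),$$ and let $\kappa>0$ be a constant. Suppose that, for some $\Theta\geq0$, $$\sum_{i=1}^N|\langle[b,T]f_i,g_i\rangle|\leq\Theta\,\Big\|\sum_{i=1}^N\|f_i\|_\infty1_{Q_i}\Big\|_{L^p}\Big\|\sum_{i=1}^N\|g_i\|_\infty1_{\tilde Q_i}\Big\|_{L^{q'}}$$ whenever $N\geq1$ and, for each $i=1,\ldots,N$, $f_i\in L^\infty(Q_i)$ and $g_i\in L^\infty(\tilde Q_i)$ for cubes $Q_i,\tilde Q_i$ such that $\operatorname{dist}(Q_i,\tilde Q_i)\geq\kappa\operatorname{diam}(Q_i)=\kappa\operatorname{diam}(\tilde Q_i)$. Then $b=a+c$ for some $a\in L^r(\mathbb{R}^d)$ and some constant $c\in\mathbb{C}$, where $\|a\|_{L^r}\leq C\Theta$ with a constant $C$ depending only on $d,p,q,K,\kappa$ (not on $b$ or $\Theta$).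
   Context: All functions are complex-valued; cubes have sides parallel to the coordinate axes. $q'=q/(q-1)$. For a set $Q$, $L^\infty(Q)=\{f\in L^\infty(\mathbb{R}^d):f=1_Qf\}$. The symbol $$\langle[b,T]f,g\rangle:=\iint(b(x)-b(y))K(x,y)f(y)g(x)\,dy\,dx$$ is an abbreviation for this (absolutely convergent) integral, for bounded $f,g$ with bounded supports separated by a positive distance; no operator $T$ need be defined, and no $L^p$ boundedness of $T$ is assumed. An $\omega$-Calderón–Zygmund kernel is a measurable $K(x,y)$, $x\neq y$, with $|K(x,y)|\leq c_K|x-y|^{-d}$ and $$|K(x,y)-K(x',y)|+|K(y,x)-K(y,x')|\leq\frac1{|x-y|^d}\omega\Big(\frac{|x-x'|}{|x-y|}\Big)\quad\text{whenever }|x-x'|<\tfrac12|x-y|,$$ with $\omega:[0,1)\to[0,\infty)$ increasing. $K$ is a non-degenerate Calderón–Zygmund kernel if at least one of the following holds: (i) $K$ is an $\omega$-Calderón–Zygmund kernel with $\omega(t)\to0$ as $t\to0$, and for some $c_0>0$, for every $y\in\mathbb{R}^d$ and $r>0$ there exists $x\in B(y,r)^c$ with $|K(x,y)|\geq\frac1{c_0r^d}$; (ii) $K(x,y)=\frac{\Omega(x-y)}{|x-y|^d}$ where $\Omega(tx)=\Omega(x)$ for all $t>0$, and $\Omega\in L^1(S^{d-1})\setminus\{0\}$. *)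

(* Defs.v *)
From HB Require Import structures.
From mathcomp Require Import all_boot all_order all_algebra.
From mathcomp Require Import all_classical all_reals all_analysis.
From mathcomp Require Import measurable_realfun.
From mathcomp Require Export complex.

Set Implicit Arguments.
Unset Strict Implicit.
Unset Printing Implicit Defensive.

Import Order.TTheory GRing.Theory Num.Theory numFieldNormedType.Exports.
Import ComplexField.Normc.
Local Open Scope classical_set_scope.
Local Open Scope ring_scope.

(* R^n is 'rV[R]_n with the sigma-algebra generated by the coordinates, that
   is, its Borel sigma-algebra. *)
Section measurable_rV.
Context {R : realType}.
Variable n : nat.

Let coord : 'I_n -> 'rV[R]_n -> R := fun i x => x ord0 i.

Let rV_set0 : g_sigma_preimage coord set0.
Proof. exact: sigma_algebra0. Qed.

Let rV_setC A : g_sigma_preimage coord A -> g_sigma_preimage coord (~` A).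
Proof. exact: sigma_algebraC. Qed.

Let rV_bigcup (F : _^nat) : (forall i, g_sigma_preimage coord (F i)) ->
  g_sigma_preimage coord (\bigcup_i (F i)).
Proof. exact: sigma_algebra_bigcup. Qed.

HB.instance Definition _ := @isMeasurable.Build default_measure_display
  'rV[R]_n (g_sigma_preimage coord) rV_set0 rV_setC rV_bigcup.

Lemma measurable_coord (i : 'I_n) :
  measurable_fun [set: 'rV[R]_n] (fun x => x ord0 i).
Proof.
move=> _ Y mY; rewrite setTI; apply: sub_sigma_algebra => /=.
rewrite -bigcup_seq/=; exists i => /=; first by rewrite mem_index_enum.
by exists Y => //; rewrite setTI.
Qed.

Lemma measurable_fun_coordP d (T : measurableType d) (f : T -> 'rV[R]_n) :
  (forall i, measurable_fun [set: T] (fun t => f t ord0 i)) ->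
  measurable_fun [set: T] f.
Proof.
move=> mf.
suff H : g_sigma_preimage (fun i => coord i \o f) `<=` measurable.
  move=> _ A mA; apply: H; rewrite g_sigma_preimage_comp.
  by exists A.
apply: smallest_sub; first exact: sigma_algebra_measurable.
rewrite -bigcup_seq/=; apply: bigcup_sub => i _ A [B mB <-].
exact: mf.
Qed.

End measurable_rV.

Section rV_cons.
Context {R : realType}.
Variable n : nat.

Definition rV_cons (z : R * 'rV[R]_n) : 'rV[R]_n.+1 :=
  row_mx (const_mx z.1 : 'rV_1) z.2.

Definition rV_uncons (x : 'rV[R]_n.+1) : R * 'rV[R]_n :=
  (x ord0 ord0, \row_j x ord0 (lift ord0 j)).

Lemma rV_cons0 z : rV_cons z ord0 ord0 = z.1.
Proof.
have -> : (ord0 : 'I_n.+1) = lshift n (ord0 : 'I_1) by exact/val_inj.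
by rewrite [LHS]row_mxEl mxE.
Qed.

Lemma rV_consS z j : rV_cons z ord0 (lift ord0 j) = z.2 ord0 j.
Proof.
have -> : lift ord0 j = rshift 1 j :> 'I_n.+1 by exact/val_inj.
by rewrite [LHS]row_mxEr.
Qed.

Lemma rV_consK : cancel rV_cons rV_uncons.
Proof.
move=> [a v]; rewrite /rV_uncons rV_cons0; congr (_, _).
by apply/rowP => j; rewrite mxE rV_consS.
Qed.

Lemma measurable_rV_cons : measurable_fun [set: R * 'rV[R]_n] rV_cons.
Proof.
apply: measurable_fun_coordP => i; have [j ->|->] := unliftP ord0 i.
  rewrite (_ : (fun _ => _) = (fun x : 'rV[R]_n => x ord0 j) \o snd).
    by apply: measurableT_comp => //; exact: measurable_coord.
  by apply/funext => z /=; rewrite rV_consS.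
rewrite (_ : (fun _ => _) = fst); first exact: measurable_fst.
by apply/funext => z; rewrite rV_cons0.
Qed.

Lemma measurable_rV_uncons : measurable_fun [set: 'rV[R]_n.+1] rV_uncons.
Proof.
apply/measurable_fun_pairP; split; first exact: measurable_coord.
apply: measurable_fun_coordP => j /=.
rewrite (_ : (fun _ => _) = fun x : 'rV[R]_n.+1 => x ord0 (lift ord0 j)).
  exact: measurable_coord.
by apply/funext => x /=; rewrite mxE.
Qed.

End rV_cons.

Section lebesgue_rV_succ.
Context {R : realType}.
Variable n : nat.
Variable mu : {sigma_finite_measure set 'rV[R]_n -> \bar R}.
Local Open Scope ereal_scope.

Definition lebesgue_rV_succ : set 'rV[R]_n.+1 -> \bar R :=
  pushforward (@lebesgue_measure R \x mu) (@rV_cons R n).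

Let succ0 : lebesgue_rV_succ set0 = 0.
Proof. by rewrite /lebesgue_rV_succ /pushforward preimage_set0 measure0. Qed.

Let succ_ge0 A : 0 <= lebesgue_rV_succ A.
Proof. exact: (measure_ge0 (@lebesgue_measure R \x mu)). Qed.

Let succ_sigma_additive : semi_sigma_additive lebesgue_rV_succ.
Proof.
apply: (@measure_semi_sigma_additive _ _ _ (pushforward _ _)).
exact: measurable_rV_cons.
Qed.

HB.instance Definition _ := isMeasure.Build _ _ _ lebesgue_rV_succ
  succ0 succ_ge0 succ_sigma_additive.

Let succ_sigma_finite : sigma_finite setT lebesgue_rV_succ.
Proof.
have /sigma_finiteP[F [FT ndF Foo]] := sigma_finiteT (@lebesgue_measure R).
have /sigma_finiteP[G [GT ndG Goo]] := sigma_finiteT mu.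
exists (fun k => @rV_uncons R n @^-1` (F k `*` G k)).
  rewrite -preimage_bigcup -[LHS](preimage_setT (@rV_uncons R n)).
  congr (_ @^-1` _); rewrite -setXTT FT GT predeqE => -[x y]; split.
    move=> [/= [i _ Fix] [k _ Gky]]; exists (maxn i k) => //; split.
    - by move: x Fix; exact/subsetPset/ndF/leq_maxl.
    - by move: y Gky; exact/subsetPset/ndG/leq_maxr.
  by move=> [k _ []/= ? ?]; split; exists k.
move=> k; have [mFk Fkoo] := Foo k; have [mGk Gkoo] := Goo k; split.
  rewrite -[X in measurable X]setTI; apply: measurable_rV_uncons => //.
  exact: measurableX.
rewrite /lebesgue_rV_succ /pushforward -comp_preimage.
rewrite (_ : _ \o _ = id); last by apply/funext => z /=; rewrite rV_consK.
by rewrite preimage_id product_measure1E// lte_mul_pinfty// ge0_fin_numE.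
Qed.

HB.instance Definition _ := Measure_isSigmaFinite.Build _ _ _
  lebesgue_rV_succ succ_sigma_finite.

End lebesgue_rV_succ.

(* Lebesgue measure on R^n, on Borel sets: the n-fold product of the Lebesgue
   measure of R, transported along R * R^n = R^(n+1). *)
Fixpoint lebesgue_rV {R : realType} (n : nat) :
    {sigma_finite_measure set 'rV[R]_n -> \bar R} :=
  match n with
  | 0 => \d_(0 : 'rV[R]_0)
  | n'.+1 => lebesgue_rV_succ (lebesgue_rV n')
  end.

Lemma lebesgue_rV_box (R : realType) n (a b : 'rV[R]_n) :
  (forall i, a ord0 i <= b ord0 i) ->
  lebesgue_rV n [set x | forall i, a ord0 i <= x ord0 i <= b ord0 i] =
    (\prod_(i < n) (b ord0 i - a ord0 i))%:E.
Proof.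
elim: n => [|n IH] in a b *  => ab.
  rewrite big_ord0 /= diracE mem_set//= => -[]//.
pose a' : 'rV[R]_n := \row_j a ord0 (lift ord0 j).
pose b' : 'rV[R]_n := \row_j b ord0 (lift ord0 j).
have ab' j : a' ord0 j <= b' ord0 j by rewrite !mxE.
rewrite big_ord_recl [LHS]/= /lebesgue_rV_succ /pushforward.
rewrite (_ : _ @^-1` _ = [set` `[a ord0 ord0, b ord0 ord0]] `*`
  [set x : 'rV[R]_n | forall i, a' ord0 i <= x ord0 i <= b' ord0 i]); last first.
  apply/seteqP; split => [z /= H|z /= [H1 H2] i].
    split; first by have := H ord0; rewrite rV_cons0 in_itv.
    by move=> i; have := H (lift ord0 i); rewrite rV_consS !mxE.
  have [j ->|->] := unliftP ord0 i.
    by have := H2 j; rewrite rV_consS !mxE.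
  by move: H1; rewrite rV_cons0 in_itv.
rewrite product_measure1E//=; last first.
  rewrite (_ : [set _ | _] =
     \big[setI/setT]_(i < n) [set x : 'rV[R]_n | a' ord0 i <= x ord0 i <= b' ord0 i]).
    apply: bigsetI_measurable => i _.
    rewrite (_ : [set _ | _] = setT `&`
      (fun x : 'rV[R]_n => x ord0 i) @^-1` `[a' ord0 i, b' ord0 i]).
      exact: measurable_coord.
    by apply/seteqP; split => x /=; rewrite ?in_itv /=; [|case].
  rewrite -bigcap_seq; apply/seteqP; split => [x /= H i _|x /= H i].
    exact: H.
  by apply: H => /=; rewrite mem_index_enum.
rewrite IH// lebesgue_measure_itv /= lte_fin EFinM; congr (_ * _)%E; last first.
  by congr EFin; apply: eq_bigr => i _; rewrite !mxE.
have := ab ord0; rewrite le_eqVlt => /predU1P[->|->]; last by rewrite EFinB.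
by rewrite ltxx subrr.
Qed.

Section euclidean.
Context {R : realType} {n : nat}.
Implicit Types (x y : 'rV[R]_n) (A B : set 'rV[R]_n).

(* The norm that 'rV[R]_n carries in the library is the sup norm. *)
Definition enorm x : R := Num.sqrt (\sum_i x ord0 i ^+ 2).

Definition diam A : R := sup [set enorm (z.1 - z.2) | z in A `*` A].

Definition dist A B : R := inf [set enorm (z.1 - z.2) | z in A `*` B].

(* Cubes are nondegenerate and closed; half-open or open ones differ from these
   by null sets and have the same diameters and distances. *)
Definition is_cube A := exists (a : 'rV[R]_n) (l : R), 0 < l /\
  A = [set x | forall i, a ord0 i <= x ord0 i <= a ord0 i + l].

Definition usphere : set 'rV[R]_n := [set x | enorm x = 1].

Definition normalize x := (enorm x)^-1 *: x.

Definition punctured_ball : set 'rV[R]_n := [set x | 0 < enorm x <= 1].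

Lemma measurable_enorm : measurable_fun [set: 'rV[R]_n] enorm.
Proof.
apply: measurableT_comp.
  by apply: continuous_measurable_fun; exact: sqrt_continuous.
apply: measurable_sum => i; apply: measurable_funX; exact: measurable_coord.
Qed.

Lemma measurable_normalize : measurable_fun [set: 'rV[R]_n] normalize.
Proof.
apply: measurable_fun_coordP => i.
rewrite (_ : (fun _ => _) =
    (fun x => enorm x `^ (-1)) \* (fun x : 'rV[R]_n => x ord0 i)).
  apply: measurable_funM; last exact: measurable_coord.
  apply: (measurableT_comp (measurable_powR _)); exact: measurable_enorm.
by apply/funext => x /=; rewrite powR_inv1 ?sqrtr_ge0// !mxE.
Qed.

Lemma measurable_punctured_ball : measurable punctured_ball.
Proof.
rewrite (_ : punctured_ball = setT `&` enorm @^-1` `]0, 1]).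
  exact: measurable_enorm.
by rewrite setTI; apply/seteqP; split => x /=; rewrite in_itv.
Qed.

(* The surface measure of the unit sphere S, seen as a measure on R^n
   concentrated on S: n times the Lebesgue measure of the cone
   {t u : 0 < t <= 1, u in A}, for A a subset of S. This is the normalization
   for which integration in polar coordinates reads
   \int f = \int_0^oo t^(n-1) \int_S f(t u) dsigma(u) dt;
   for n = 1 it is the counting measure of {-1, 1}. *)
Definition sphere_measure (A : set 'rV[R]_n) : \bar R :=
  (n%:R%:E * lebesgue_rV n (punctured_ball `&` normalize @^-1` A))%E.

Let sphere0 : sphere_measure set0 = 0%E.
Proof.
by rewrite /sphere_measure preimage_set0 setI0 measure0 mule0.
Qed.

Let sphere_ge0 A : (0 <= sphere_measure A)%E.
Proof. by rewrite mule_ge0// lee_fin. Qed.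

Let sphere_sigma_additive : semi_sigma_additive sphere_measure.
Proof.
pose m1 : {measure set 'rV[R]_n -> \bar R} :=
  mrestr (lebesgue_rV n) measurable_punctured_ball.
have E A : sphere_measure A =
    mscale (n%:R%:nng : {nonneg R}) (pushforward m1 normalize) A.
  by rewrite /sphere_measure /mscale /pushforward /m1 /= /mrestr /= setIC.
rewrite (funext (E measurable_normalize)).
apply: (@measure_semi_sigma_additive _ _ _ (mscale _ (pushforward _ _))).
Qed.

HB.instance Definition _ := isMeasure.Build _ _ _ sphere_measure
  sphere0 sphere_ge0 sphere_sigma_additive.

End euclidean.

Section complex_functions.
Context {R : realType}.

Definition cmeasurable_fun d (T : measurableType d) (D : set T)
    (f : T -> R[i]) :=
  measurable_fun D (fun x => complex.Re (f x)) /\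
  measurable_fun D (fun x => complex.Im (f x)).

Context {n : nat}.
Implicit Types (f g : 'rV[R]_n -> R[i]) (A : set 'rV[R]_n) (p : \bar R).

(* Meaningful for absolutely integrable f only. *)
Definition cintegral f : R[i] :=
  Complex (\int[lebesgue_rV n]_x complex.Re (f x))%R
          (\int[lebesgue_rV n]_x complex.Im (f x))%R.

(* As usual, elements of the Lebesgue spaces are given by measurable
   representatives, and identities between them hold almost everywhere. *)
Definition cLnorm p f : \bar R :=
  Lnorm (lebesgue_rV n) p (fun x => (normc (f x))%:E).

Definition in_Lp p f := cmeasurable_fun setT f /\ (cLnorm p f < +oo)%E.

Definition in_Linfty_on A f := in_Lp +oo%E f /\
  {ae lebesgue_rV n, forall x, f x = (\1_A x)%:C%C * f x}.

Definition in_L1loc f := cmeasurable_fun setT f /\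
  forall A, compact A -> (\int[lebesgue_rV n]_(x in A) (normc (f x))%:E < +oo)%E.

End complex_functions.

Section kernels.
Context {R : realType} {n : nat}.
Local Notation V := 'rV[R]_n.
Implicit Types (K : V -> V -> R[i]) (omega : R -> R) (Omega : V -> R[i]).

(* A map [0, 1) -> [0, oo), nondecreasing; values outside [0, 1) are junk. *)
Definition modulus_type omega :=
  (forall t, 0 <= t < 1 -> 0 <= omega t) /\
  (forall s t, 0 <= s -> s <= t -> t < 1 -> omega s <= omega t).

(* Kernels are total functions; their values on the diagonal are junk. *)
Definition cz_kernel omega K :=
  [/\ modulus_type omega,
      cmeasurable_fun [set z : V * V | z.1 <> z.2] (fun z => K z.1 z.2),
      exists cK : R, forall x y, x <> y ->
        normc (K x y) <= cK * enorm (x - y) ^- n &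
      forall x x' y, enorm (x - x') < 2^-1 * enorm (x - y) ->
        normc (K x y - K x' y) + normc (K y x - K y x') <=
          enorm (x - y) ^- n * omega (enorm (x - x') / enorm (x - y))].

Definition nondegenerate_regular K :=
  (exists omega, cz_kernel omega K /\ omega t @[t --> 0^'+] --> (0 : R)) /\
  (exists c0 : R, 0 < c0 /\
    forall (y : V) (r : R), 0 < r ->
      exists x, r <= enorm (x - y) /\ (c0 * r ^+ n)^-1 <= normc (K x y)).

(* Omega is a function on R^n minus the origin, homogeneous of degree 0; only
   its restriction to the sphere is integrated. *)
Definition in_L1_sphere Omega :=
  cmeasurable_fun usphere Omega /\
  (\int[@sphere_measure R n]_(x in usphere) (normc (Omega x))%:E < +oo)%E.

Definition nondegenerate_rough K :=
  exists Omega,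
    [/\ forall x (t : R), x <> 0 -> 0 < t -> Omega (t *: x) = Omega x,
        in_L1_sphere Omega,
        ~ {ae @sphere_measure R n, forall x, usphere x -> Omega x = 0} &
        forall x y, x <> y ->
          K x y = Omega (x - y) / ((enorm (x - y) ^+ n)%:C)%C].

Definition nondegenerate_cz_kernel K :=
  nondegenerate_regular K \/ nondegenerate_rough K.

(* <[b,T]f,g>, bilinear in (f, g): there is no conjugation on g. *)
Definition commutator_form (b : V -> R[i]) K (f g : V -> R[i]) : R[i] :=
  cintegral (fun x => cintegral (fun y =>
    (b x - b y) * K x y * f y * g x)).

End kernels.

(* Main.v *)
(* For a cube Q the kernel is close, in the mean, to a nonzero constant on
   Q x Q' for some cube Q' at distance comparable to diam Q; hence the mean
   oscillation of b over Q is bounded by |<[b,T]f,g>| for two pairs of test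
   functions f on Q and g on Q'. Testing the hypothesis with weighted families
   of such pairs, and replacing the cubes Q' by the cubes Q in the norms
   (a consequence of the maximal inequality), one gets
     sum_j t_j^(r-1) osc(b, Q_j) <= C Theta |sum_j t_j^(r/p) 1_(Q_j)|_p
                                            |sum_j t_j^(r/q') 1_(Q_j)|_q'.
   In a cube Q0 this is applied to the maximal dyadic subcubes on which the
   average of |b - b_(Q0)| exceeds the levels of a geometric sequence; the
   right side is then a power of the L^r norm of the dyadic maximal function of
   b - b_(Q0), which can be absorbed. This bounds |b - b_(Q0)|_(L^r(Q0)) by
   C Theta uniformly in Q0, and c is the limit of b_(Q0) as Q0 grows. *)

Require Import Defs.
From HB Require Import structures.
From mathcomp Require Import all_boot all_order all_algebra.
From mathcomp Require Import all_classical all_reals all_analysis.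
From mathcomp Require Import complex.
From mathcomp Require Import measurable_realfun ess_sup_inf ring lra.
Import Order.TTheory GRing.Theory Num.Theory numFieldNormedType.Exports.
Import ComplexField.Normc.
Local Open Scope classical_set_scope.
Local Open Scope ring_scope.

Set Implicit Arguments.
Unset Strict Implicit.
Unset Printing Implicit Defensive.

(** * Geometric sums *)

Section geometric_levels.
Context {R : realType}.
Implicit Types t a e m : R.

(** Absorption needs quantities known to be finite, while [b] is only locally integrable. So only
    dyadic subcubes of at most [N] generations are used, with bounds independent of [N]; the limit
    in [N] rests on the density in L^1 of functions constant on cells, truncation, and Fatou's
    lemma. Two test pairs are needed per cube: one controls [b] on Q around its mean on Q', with an
    error containing the oscillation on Q', and the other does the reverse. The sum absorbs both
    errors when the relative deviation of the kernel from a constant is 1/8. With [s = q / (q - 1)]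
    one has [r - 1 = r/p + r/s], so a form weighted by [t^(r-1)] splits into weights [t^(r/p)] on f
    and [t^(r/s)] on g. Both norms are then powers of one sum S of [level^r * volume], and
    [1/p + 1/s = 1 - 1/r] turns the estimate into [S <= C Theta S^(1-1/r)]. Levels grow by the
    factor [2 * 2^n]: comparison with the parent shows that the average over a maximal cube is at
    most [2^n] times its level, so on the cubes of the next level at least half of the average is
    oscillation around the mean of the larger cube. *)

Definition geom_cst (a e : R) := (1 - a `^ (- e))^-1.

Lemma powRN_lt1 a e : 1 < a -> 0 < e -> a `^ (- e) < 1.
Proof.
move=> a1 e0; have a0 : 0 < a by exact: lt_trans a1.
rewrite powRN invf_lt1 ?powR_gt0//.
have := @gt0_ltr_powR R e e0 1 a; rewrite powR1; apply => //; rewrite ?nnegrE ?ltW//.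
Qed.

Lemma geom_cst_gt0 a e : 1 < a -> 0 < e -> 0 < geom_cst a e.
Proof. by move=> a1 e0; rewrite invr_gt0 subr_gt0 powRN_lt1. Qed.

(** The largest level below [m] dominates: going down from it, the terms form a geometric
    progression of ratio [a^-e], and [geom_cst a e] is the sum of the full series. *)
Lemma geom_levels_le t a e m K : 0 < t -> 1 < a -> 0 < e -> 0 <= m ->
  \sum_(k < K) (t * a ^+ k <= m)%R%:R * (t * a ^+ k) `^ e <= geom_cst a e * m `^ e.
Proof.
move=> t0 a1 e0 m0; have a0 : 0 < a by exact: lt_trans a1.
pose x := a `^ (- e); pose u k := (t * a ^+ k) `^ e; pose c := geom_cst a e.
have c0 : 0 < c by exact: geom_cst_gt0.
have u0 k : 0 <= u k by exact: powR_ge0.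
have ux k : x * u k.+1 = u k.
  rewrite /x /u exprS (mulrCA t) (powRM _ (ltW a0)) ?mulr_ge0 ?exprn_ge0 ?ltW//.
  by rewrite (mulrA (a `^ - e)) -powRD ?addNr ?powRr0 ?mul1r// (gt_eqF a0) implybT.
have cx : c * x + 1 = c.
  have := powRN_lt1 a1 e0; rewrite -/x /c /geom_cst -/x => x1.
  by field; rewrite subr_eq0 gt_eqF.
(* The identity [c * x + 1 = c] closes this induction with the same constant at every [k]. *)
have S1 k : \sum_(j < k) (t * a ^+ j <= m)%R%:R * u j <= c * x * u k.
  elim: k => [|k ih].
    by rewrite big_ord0 !mulr_ge0 ?powR_ge0// ltW.
  rewrite big_ord_recr/= -mulrA ux.
  have : (t * a ^+ k <= m)%R%:R * u k <= u k by case: (_ <= m); rewrite ?mul1r ?mul0r.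
  by rewrite -[X in _ <= X * _]cx mulrDl mul1r => ?; exact: lerD.
elim: K => [|k ih]; first by rewrite big_ord0 mulr_ge0 ?powR_ge0// ltW.
rewrite big_ord_recr/=; have [tm|_] := leP (t * a ^+ k) m; last by rewrite mul0r addr0.
rewrite mul1r (le_trans (lerD (S1 k) (lexx _)))// -[X in _ + X]mul1r -mulrDl cx.
by rewrite ler_pM2l// ge0_ler_powR ?nnegrE// ltW// ?mulr_gt0 ?exprn_gt0.
Qed.

(** One term suffices: the largest level not above [m] is within a factor [a] of [m]. *)
Lemma geom_levels_ge t a e m K : 0 < t -> 1 < a -> 0 < e ->
  t <= m -> m < t * a ^+ K ->
  m `^ e <= a `^ e * \sum_(k < K) (t * a ^+ k <= m)%R%:R * (t * a ^+ k) `^ e.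
Proof.
move=> t0 a1 e0 tm; have a0 : 0 < a by exact: lt_trans a1.
elim: K => [|k ih]; first by rewrite expr0 mulr1 ltNge tm.
move=> mt; rewrite big_ord_recr/=; have [tk|/ih] := leP (t * a ^+ k) m; last first.
  by rewrite mul0r addr0.
move=> {ih}; rewrite mul1r mulrDr; apply: ler_wpDl.
  by rewrite mulr_ge0 ?powR_ge0// sumr_ge0// => i _; rewrite mulr_ge0// powR_ge0.
have m0 : 0 <= m by rewrite (le_trans _ tm)// ltW.
have tk0 : 0 <= t * a ^+ k by rewrite mulr_ge0 ?exprn_ge0// ltW.
rewrite -(powRM e (ltW a0) tk0) (ge0_ler_powR (ltW e0))// ?nnegrE//.
  by rewrite mulr_ge0// ltW.
by rewrite ltW// mulrCA -exprS.
Qed.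

End geometric_levels.

(** * Step functions and the maximal inequality *)

Section nonneg_integral.
Local Open Scope ereal_scope.
Context d (T : measurableType d) (R : realType) (mu : {measure set T -> \bar R}).
Implicit Types (g h : T -> R).

(** Values stay in the extended reals, so that estimates can be chained before any integrability is
    known. *)
Definition nint g : \bar R := \int[mu]_x (g x)%:E.

Lemma nint_ge0 g : (forall x, 0 <= g x)%R -> 0 <= nint g.
Proof. by move=> g0; apply: integral_ge0 => x _; rewrite lee_fin. Qed.

Lemma nint_le g h : measurable_fun setT g -> measurable_fun setT h ->
  (forall x, 0 <= g x)%R -> (forall x, g x <= h x)%R -> nint g <= nint h.
Proof.
move=> mg mh g0 gh; apply: ge0_le_integral => //.
- by move=> x _; rewrite lee_fin.
- exact/measurable_EFinP.
- exact/measurable_EFinP.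
- by move=> x _; rewrite lee_fin.
Qed.

Lemma eq_nint g h : g =1 h -> nint g = nint h.
Proof. by move=> gh; apply: eq_integral => x _; rewrite gh. Qed.

Lemma nintZ k g : measurable_fun setT g -> (forall x, 0 <= g x)%R -> (0 <= k)%R ->
  nint (fun x => k * g x)%R = k%:E * nint g.
Proof.
move=> mg g0 k0; rewrite /nint -ge0_integralZl_EFin//.
- by move=> x _; rewrite lee_fin.
- exact/measurable_EFinP.
Qed.

Lemma nintD g h : measurable_fun setT g -> (forall x, 0 <= g x)%R ->
  measurable_fun setT h -> (forall x, 0 <= h x)%R ->
  nint (fun x => g x + h x)%R = nint g + nint h.
Proof.
move=> mg g0 mh h0; rewrite /nint -ge0_integralD//.
- by move=> x _; rewrite lee_fin.
- exact/measurable_EFinP.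
- by move=> x _; rewrite lee_fin.
- exact/measurable_EFinP.
Qed.

Lemma nint_sum (I : Type) (s : seq I) (P : pred I) (g : I -> T -> R) :
  (forall i, measurable_fun setT (g i)) -> (forall i x, 0 <= g i x)%R ->
  nint (fun x => \sum_(i <- s | P i) g i x)%R = \sum_(i <- s | P i) nint (g i).
Proof.
move=> mg g0; rewrite -big_filter /nint -ge0_integral_sum//.
- by apply: eq_integral => x _; rewrite sumEFin -big_filter.
- by move=> i; exact/measurable_EFinP.
- by move=> i x _; rewrite lee_fin.
Qed.

Lemma nint_indic A : measurable A -> nint (\1_A) = mu A.
Proof. by move=> mA; rewrite /nint integral_indic// setIT. Qed.

Lemma nint_step (I : Type) (s : seq I) (P : pred I) (A : I -> set T) (c : I -> R) :
  (forall i, measurable (A i)) -> (forall i, 0 <= c i)%R ->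
  nint (fun x => \sum_(i <- s | P i) c i * \1_(A i) x)%R =
    \sum_(i <- s | P i) (c i)%:E * mu (A i).
Proof.
move=> mA c0; rewrite nint_sum//.
- by apply: eq_bigr => i _; rewrite nintZ// nint_indic.
- by move=> i; apply: measurable_funM => //; exact: measurable_indic.
- by move=> i x; rewrite mulr_ge0.
Qed.

End nonneg_integral.

Lemma measurable_sum_cond d (T : measurableType d) (R : realType) (D : set T)
    (I : Type) (s : seq I) (P : pred I) (h : I -> T -> R) :
  (forall i, measurable_fun D (h i)) ->
  measurable_fun D (fun x => \sum_(i <- s | P i) h i x).
Proof.
by move=> mh; under eq_fun do rewrite -big_filter; exact: measurable_sum.
Qed.

Section step_functions.
Context d (T : measurableType d) (R : realType).
Context (I : finType) (A : I -> set T) (c : I -> R).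

Definition step_fun (x : T) : R := \sum_i c i * \1_(A i) x.

Lemma measurable_step_fun : (forall i, measurable (A i)) ->
  measurable_fun setT step_fun.
Proof.
move=> mA; apply: measurable_sum => i.
by apply: measurable_funM => //; exact: measurable_indic.
Qed.

Hypothesis c0 : forall i, 0 <= c i.

Lemma step_fun_ge0 x : 0 <= step_fun x.
Proof. by apply: sumr_ge0 => i _; rewrite mulr_ge0. Qed.

Lemma step_fun_le x : step_fun x <= \sum_i c i.
Proof.
apply: ler_sum => i _; rewrite -[leRHS]mulr1 ler_wpM2l//.
Qed.

Definition max_fun (x : T) : R := \big[Num.max/0]_i (c i * \1_(A i) x).

Lemma max_fun_ge0 x : 0 <= max_fun x.
Proof. exact: bigmax_ge_id. Qed.

Lemma max_fun_ge i x : A i x -> c i <= max_fun x.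
Proof.
by move=> Aix; apply: (bigmax_sup i) => //; rewrite indicE mem_set// mulr1.
Qed.

(** For [t > 0] the default value 0 of the maximum cannot reach [t], so one of the sets must. *)
Lemma max_fun_geP t x : 0 < t ->
  reflect (exists2 i, A i x & t <= c i) (t <= max_fun x).
Proof.
move=> t0; apply: (iffP idP) => [|[i Ai ti]]; last first.
  exact: (le_trans ti (max_fun_ge Ai)).
apply: contraPP => noi; apply/negP; rewrite -ltNge.
apply: bigmax_lt => // i _; rewrite indicE.
have [/set_mem Ax|_] := boolP (x \in A i); last by rewrite mulr0.
by rewrite mulr1 ltNge; apply/negP => tc; apply: noi; exists i.
Qed.

Lemma measurable_max_fun : (forall i, measurable (A i)) ->
  measurable_fun setT max_fun.
Proof.
move=> mA; rewrite /max_fun.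
elim: (index_enum I) => [|i s ih].
  by under eq_fun do rewrite big_nil; exact: measurable_cst.
under eq_fun do rewrite big_cons.
by apply: measurable_maxr => //; apply: measurable_funM.
Qed.

End step_functions.

(** * The maximal function of a finite family *)

Section finite_maximal_function.
Context d (T : measurableType d) (R : realType) (mu : {measure set T -> \bar R}).
Context (I : finType) (P : I -> set T) (v : I -> R) (E : R).
Hypothesis mP : forall i, measurable (P i).
Hypothesis muP : forall i, mu (P i) = (v i)%:E.
Hypothesis v0 : forall i, 0 < v i.
Hypothesis E0 : 0 <= E.
(** The covering lemma in abstract form: a disjoint subfamily carries a fixed part of the measure of
    the union. Cubes satisfy it with [E = 3 ^+ n]. *)
Hypothesis vitali : forall A : {set I}, exists B : {set I},
  [/\ B \subset A, forall x, \sum_(j in B) \1_(P j) x <= 1 :> R &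
      (mu (\big[setU/set0]_(i in A) P i) <= (E * \sum_(j in B) v j)%:E)%E].
Variables (h : T -> R) (B : R).
Hypothesis mh : measurable_fun setT h.
Hypothesis h0 : forall x, 0 <= h x.
Hypothesis hB : forall x, h x <= B.

Definition hint (i : I) : R := fine (nint mu (fun x => \1_(P i) x * h x)%R).

Lemma hintE i : nint mu (fun x => \1_(P i) x * h x)%R = (hint i)%:E.
Proof.
rewrite /hint fineK// ge0_fin_numE; last by apply: nint_ge0 => x; rewrite mulr_ge0.
have B0 : 0 <= B.
  have [x Px] : P i !=set0.
    apply/set0P; apply/negP => /eqP Pi0.
    by move: (v0 i); have := muP i; rewrite Pi0 measure0 => -[<-]; rewrite ltxx.
  exact: le_trans (h0 x) (hB x).
apply: (@le_lt_trans _ _ (nint mu (fun x => B * \1_(P i) x)%R)).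
  apply: nint_le => //.
  - by apply: measurable_funM => //; exact: measurable_indic.
  - by apply: measurable_funM => //; exact: measurable_indic.
  - by move=> x; rewrite mulr_ge0.
  - by move=> x; rewrite mulrC ler_wpM2r.
by rewrite nintZ// ?nint_indic// muP ltry.
Qed.

Lemma hint_ge0 i : 0 <= hint i.
Proof. by rewrite fine_ge0// nint_ge0// => x; rewrite mulr_ge0. Qed.

Definition havg i := hint i / v i.

Lemma havg_ge0 i : 0 <= havg i.
Proof. by rewrite divr_ge0 ?hint_ge0// ltW. Qed.

Definition hmax := max_fun P havg.

(** The level set is the union of the sets with average at least [t], and [t * v j] is at most the
    integral of [h] over such a set. The selected disjoint sets lie inside the level set, so the
    integral on the right can be confined to it; [doob_maximal] depends on this. *)
Lemma weak_maximal t : 0 < t ->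
  (t%:E * mu [set x | (t <= hmax x)%R] <=
    E%:E * nint mu (fun x => (t <= hmax x)%R%:R * h x)%R)%E.
Proof.
move=> t0; have [C [CA C1 muC]] := vitali [set i | t <= havg i]%SET.
have -> : [set x | t <= hmax x] = \big[setU/set0]_(i in [set i | t <= havg i]%SET) P i.
  rewrite -bigcup_seq_cond; apply/seteqP; split=> x /=.
    move=> /(max_fun_geP _ _ _ t0)[i Pi ti].
    by exists i => //=; rewrite mem_index_enum inE.
  move=> [i /=]; rewrite mem_index_enum inE /= => ti Pi.
  by apply/(max_fun_geP _ _ _ t0); exists i.
apply: (@le_trans _ _ (t%:E * (E * \sum_(j in C) v j)%:E)%E).
  by rewrite lee_pmul2l// lte_fin.
rewrite EFinM muleCA lee_wpmul2l ?lee_fin//.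
apply: (@le_trans _ _ (\sum_(j in C) nint mu (fun x => \1_(P j) x * h x)%R)%E).
  rewrite (eq_bigr (fun j => (hint j)%:E)); last by move=> j _; rewrite hintE.
  rewrite sumEFin -EFinM lee_fin mulr_sumr ler_sum// => j jC.
  by rewrite -ler_pdivlMr//; move/fintype.subsetP : CA => /(_ j jC); rewrite inE.
rewrite -nint_sum; last 2 first.
- by move=> i; apply: measurable_funM => //; exact: measurable_indic.
- by move=> i x; rewrite mulr_ge0.
apply: nint_le.
- by apply: measurable_sum_cond => i; apply: measurable_funM.
- apply: measurable_funM => //.
  rewrite (_ : (fun _ => _) = \1_[set x | t <= hmax x]); last first.
    by apply/funext => x; rewrite indicE mem_setE.
  apply: measurable_indic; rewrite -[X in measurable X]setTI.
  apply: measurable_fun_le => //; exact: measurable_max_fun.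
- by move=> x; rewrite sumr_ge0// => i _; rewrite mulr_ge0.
move=> x; rewrite -mulr_suml ler_wpM2r//.
have [tx|tx] := boolP (t <= hmax x); first exact: C1.
rewrite big1// => j jC; rewrite indicE memNset// => Pj; move/negP: tx; apply.
apply/(max_fun_geP _ _ _ t0); exists j => //.
by move/fintype.subsetP : CA => /(_ j jC); rewrite inE.
Qed.

Lemma hmax_ge0 x : 0 <= hmax x.
Proof. exact: max_fun_ge0. Qed.

Lemma measurable_hmax : measurable_fun setT hmax.
Proof. exact: measurable_max_fun. Qed.

Lemma hmax_attained x : 0 < hmax x -> exists2 i, P i x & hmax x <= havg i.
Proof. by move=> x0; exact: (max_fun_geP _ _ _ x0 (lexx _)). Qed.

Let mlevel t : measurable [set x | t <= hmax x].
Proof.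
rewrite -[X in measurable X]setTI.
by apply: measurable_fun_le => //; exact: measurable_hmax.
Qed.

Let levelE t : (fun x => (t <= hmax x)%R%:R) = \1_[set x | t <= hmax x] :> (T -> R).
Proof. by apply/funext => x; rewrite indicE mem_setE. Qed.

Variable q : R.
Hypothesis q1 : 1 < q.

Let q0 : 0 < q. Proof. exact: lt_trans q1. Qed.

Definition maximal_cst1 := 2 `^ q * E * geom_cst 2 (q - 1).

Let mpow (g : T -> R) s : measurable_fun setT g -> measurable_fun setT (fun x => g x `^ s).
Proof. by move=> mg; exact: (measurableT_comp (measurable_powR s)). Qed.

(** A layer-cake formula over the levels [u k = tau * 2 ^+ k]: the weak inequality at [u k] is
    multiplied by [u k ^ (q-1)], and at a point the sum of these weights over the levels below
    [hmax] is comparable to [hmax ^ (q-1)]. *)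
Lemma doob_maximal :
  (nint mu (fun x => hmax x `^ q)%R <=
    maximal_cst1%:E * nint mu (fun x => h x * hmax x `^ (q - 1))%R)%E.
Proof.
(* No positive value of [hmax] is smaller than [tau], so the lowest level is below all of them; the
   1 covers the case without positive averages. *)
pose tau : R := \big[Num.min/1]_(i | 0 < havg i) havg i.
have tau0 : 0 < tau by apply: lt_bigmin.
have [K tauK] : exists K, \sum_i havg i < tau * 2 ^+ K.
  have S0 : 0 <= \sum_i havg i by apply: sumr_ge0 => i _; exact: havg_ge0.
  exists (Num.truncn (tau^-1 * \sum_i havg i)).+1; rewrite -ltr_pdivrMl//.
  apply: (lt_le_trans (truncnS_gt _)); rewrite -natrX ler_nat.
  by apply: ltnW; exact: ltn_expl.
pose u k := tau * 2 ^+ k.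
have u0 k : 0 < u k by rewrite mulr_gt0// exprn_gt0.
have mlev k : measurable_fun setT (fun x => (u k <= hmax x)%R%:R : R).
  by rewrite levelE; exact: measurable_indic.
apply: (@le_trans _ _ (nint mu (fun x => 2 `^ q *
    \sum_(k < K) (u k <= hmax x)%R%:R * u k `^ q)%R)).
  apply: nint_le.
  - exact/mpow/measurable_hmax.
  - apply: measurable_funM => //; apply: measurable_sum => k.
    by apply: measurable_funM.
  - by move=> x; exact: powR_ge0.
  - move=> x; have := hmax_ge0 x; rewrite le_eqVlt => /predU1P[<-|x0].
      rewrite powR0 ?gt_eqF// mulr_ge0 ?powR_ge0// sumr_ge0// => k _.
      by rewrite mulr_ge0 ?powR_ge0.
    have [i Pi xi] := hmax_attained x0.
    apply: geom_levels_ge => //; first by rewrite ltr1n.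
      rewrite (@le_trans _ _ (havg i))//; last exact: max_fun_ge.
      by rewrite /tau bigmin_le_cond//; exact: lt_le_trans xi.
    rewrite (le_lt_trans _ tauK)// (le_trans xi)//.
    by rewrite (bigD1 i)//= lerDl sumr_ge0// => j _; exact: havg_ge0.
rewrite nintZ ?powR_ge0//; last 2 first.
- by apply: measurable_sum => k; apply: measurable_funM.
- by move=> x; rewrite sumr_ge0// => k _; rewrite mulr_ge0 ?powR_ge0.
rewrite /maximal_cst1 -!mulrA EFinM -muleA lee_wpmul2l ?lee_fin ?powR_ge0//.
rewrite nint_sum; last 2 first.
- by move=> k; apply: measurable_funM.
- by move=> k x; rewrite mulr_ge0 ?powR_ge0.
apply: (@le_trans _ _ (\sum_(k < K) (u k `^ (q - 1) * E)%:E *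
    nint mu (fun x => (u k <= hmax x)%R%:R * h x)%R)%E).
  apply: lee_sum => k _.
  under eq_nint do rewrite mulrC.
  rewrite nintZ ?powR_ge0// levelE nint_indic//.
  rewrite -(@mulr_powRB1 _ (u k)) ?(ltW (u0 _))// mulrC EFinM -muleA.
  by rewrite [X in (_ <= X * _)%E]EFinM -!muleA lee_wpmul2l ?lee_fin ?powR_ge0//; exact: weak_maximal.
rewrite (eq_bigr (fun k : 'I_K => nint mu (fun x =>
    (u k `^ (q - 1) * E) * ((u k <= hmax x)%R%:R * h x))%R)); last first.
  move=> k _; rewrite nintZ ?mulr_ge0 ?powR_ge0//; first exact: measurable_funM.
  by move=> x; rewrite mulr_ge0.
rewrite -nint_sum; last 2 first.
- move=> k; apply: measurable_funM => //; exact: measurable_funM.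
- by move=> k x; rewrite !mulr_ge0 ?powR_ge0.
have G0 : 0 < geom_cst 2 (q - 1) by rewrite geom_cst_gt0 ?ltr1n ?subr_gt0.
rewrite -nintZ; last 3 first.
- by apply: measurable_funM => //; exact/mpow/measurable_hmax.
- by move=> x; rewrite mulr_ge0 ?powR_ge0.
- by rewrite mulr_ge0// ltW.
apply: nint_le.
- apply: measurable_sum => k; apply: measurable_funM => //; exact: measurable_funM.
- apply: measurable_funM => //; apply: measurable_funM => //.
  exact/mpow/measurable_hmax.
- by move=> x; rewrite sumr_ge0// => k _; rewrite !mulr_ge0 ?powR_ge0.
- move=> x; have := @geom_levels_le _ tau 2 (q - 1) (hmax x) K tau0.
  rewrite ltr1n subr_gt0 hmax_ge0 => /(_ isT q1 isT) H.
  rewrite (_ : _ * _ * _ = E * h x * (geom_cst 2 (q - 1) * hmax x `^ (q - 1))); last by ring.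
  rewrite (_ : \sum_(k < K) _ = E * h x *
    \sum_(k < K) (tau * 2 ^+ k <= hmax x)%R%:R * (tau * 2 ^+ k) `^ (q - 1)).
    by rewrite ler_wpM2l// mulr_ge0.
  by rewrite mulr_sumr; apply: eq_bigr => k _; rewrite /u; ring.
Qed.

Definition maximal_cst := 2 * (2 * maximal_cst1) `^ q.

(** Young's inequality by cases: where [2 * maximal_cst1 * h <= hmax], the integrand of
    [doob_maximal] is at most half of [hmax ^ q] and is absorbed; elsewhere it is bounded by a
    multiple of [h ^ q]. *)
Lemma strong_maximal :
  (nint mu (fun x => hmax x `^ q)%R <= maximal_cst%:E * nint mu (fun x => h x `^ q)%R)%E.
Proof.
have C0 : 0 <= maximal_cst1.
  rewrite !mulr_ge0 ?powR_ge0// ltW// geom_cst_gt0 ?subr_gt0//.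
  by rewrite ltr1n.
(* Absorption requires this; it holds because [hmax] is dominated by a finite sum over sets of
   finite measure. *)
have Mfin : nint mu (fun x => hmax x `^ q)%R \is a fin_num.
  rewrite ge0_fin_numE; last by apply: nint_ge0 => x; exact: powR_ge0.
  apply: (@le_lt_trans _ _ (nint mu (fun x => \sum_i havg i `^ q * \1_(P i) x)%R)).
    apply: nint_le.
    - exact/mpow/measurable_hmax.
    - by apply: measurable_sum => i; apply: measurable_funM.
    - by move=> x; exact: powR_ge0.
    - move=> x; have S0 i : 0 <= havg i `^ q * \1_(P i) x.
        by rewrite mulr_ge0 ?powR_ge0.
      have := hmax_ge0 x; rewrite le_eqVlt => /predU1P[<-|x0].
        by rewrite powR0 ?gt_eqF// sumr_ge0.
      have [i Pi xi] := hmax_attained x0.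
      rewrite (bigD1 i)//= (@le_trans _ _ (havg i `^ q * \1_(P i) x))//.
        rewrite indicE mem_set// mulr1 ge0_ler_powR ?nnegrE ?hmax_ge0 ?havg_ge0//.
        exact: ltW.
      by rewrite lerDl sumr_ge0.
  rewrite nint_step//; last by move=> i; exact: powR_ge0.
  under eq_bigr do rewrite muP -EFinM.
  by rewrite sumEFin ltry.
rewrite -(fineK Mfin).
set X := fine _.
have X0 : 0 <= X by rewrite fine_ge0// nint_ge0// => x; exact: powR_ge0.
have : (X%:E <= (2^-1 * X)%:E + ((2 * maximal_cst1) `^ q)%:E * nint mu (fun x => h x `^ q)%R)%E.
  rewrite EFinM {1 2}/X (fineK Mfin).
  apply: (le_trans doob_maximal).
  have m1 : measurable_fun setT (fun x => hmax x `^ q) by exact/mpow/measurable_hmax.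
  have m2 : measurable_fun setT (fun x => h x `^ q) by exact/mpow.
  have m3 : measurable_fun setT (fun x => h x * hmax x `^ (q - 1)).
    by apply: measurable_funM => //; exact/mpow/measurable_hmax.
  have n1 x : 0 <= hmax x `^ q by exact: powR_ge0.
  have n2 x : 0 <= h x `^ q by exact: powR_ge0.
  have n3 x : 0 <= h x * hmax x `^ (q - 1) by rewrite mulr_ge0 ?powR_ge0.
  rewrite -!nintZ ?powR_ge0// -nintD; first last.
  - by move=> x; rewrite mulr_ge0 ?powR_ge0.
  - exact: measurable_funM.
  - by move=> x; rewrite mulr_ge0.
  - exact: measurable_funM.
  apply: nint_le.
  - exact: measurable_funM.
  - by apply: measurable_funD; apply: measurable_funM.
  - by move=> x; rewrite mulr_ge0.
  move=> x; set m := hmax x; have m0 : 0 <= m by exact: hmax_ge0.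
  have [hm|hm] := leP (2 * maximal_cst1 * h x) m.
    apply: ler_wpDr; first by rewrite mulr_ge0 ?powR_ge0.
    rewrite -(mulr_powRB1 m0 q0) mulrA mulrA ler_wpM2r ?powR_ge0//.
    by rewrite ler_pdivlMl// mulrA.
  apply: ler_wpDl; first by rewrite mulr_ge0 ?powR_ge0.
  have c0 : 0 <= 2 * maximal_cst1 * h x by apply: mulr_ge0 => //; apply: mulr_ge0.
  have c1 : 0 <= 2 * maximal_cst1 by exact: mulr_ge0.
  rewrite -(powRM q c1 (h0 x)) -(mulr_powRB1 c0 q0) [leLHS]mulrA.
  apply: (ler_pM (mulr_ge0 C0 (h0 x)) (powR_ge0 _ _)).
    by rewrite ler_wpM2r// ler_peMl// ler1n.
  by rewrite ge0_ler_powR ?nnegrE ?subr_ge0// ltW.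
case: (nint mu (fun x => h x `^ q)%R) (nint_ge0 mu (fun x => powR_ge0 (h x) q)) => [y| |]//.
  rewrite lee_fin => y0; rewrite /maximal_cst -!EFinM !lee_fin.
  set Z := (2 * maximal_cst1) `^ q; lra.
move=> _ H; rewrite /maximal_cst.
have := powR_ge0 (2 * maximal_cst1) q; rewrite le_eqVlt => /predU1P[Z0|Z0].
  by move: H; rewrite -Z0 mulr0 !mul0e adde0 !lee_fin; lra.
by rewrite gt0_muley ?leey// lte_fin mulr_gt0.
Qed.

End finite_maximal_function.

(** * Sums over dilated sets *)

Section dilation.
Context {R : realType}.

(** Here [s / (s - 1)] is the exponent dual to [s], [eta] makes [eta] times the maximal constant at
    most 1/2, and the outer factor 2 comes from the absorption. *)
Definition dilation_cst (D E s : R) : R :=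
  let eta := (2 * (maximal_cst E (s / (s - 1)) + 1))^-1 in
  2 * (eta * (D / eta) `^ s).

Lemma maximal_cst_ge0 (E q : R) : 0 <= maximal_cst E q.
Proof. by rewrite mulr_ge0// powR_ge0. Qed.

Lemma dilation_cst_ge0 (D E s : R) : 0 <= dilation_cst D E s.
Proof.
rewrite !mulr_ge0 ?powR_ge0// invr_ge0 mulr_ge0// addr_ge0//.
exact: maximal_cst_ge0.
Qed.

Context d (T : measurableType d) (mu : {measure set T -> \bar R}).
Context (I : finType) (P Q : I -> set T) (v w beta : I -> R) (D E s : R).
Hypothesis mP : forall i, measurable (P i).
Hypothesis mQ : forall i, measurable (Q i).
Hypothesis muP : forall i, mu (P i) = (v i)%:E.
Hypothesis muQ : forall i, mu (Q i) = (w i)%:E.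
Hypothesis v0 : forall i, 0 < v i.
Hypothesis E0 : 0 <= E.
Hypothesis D0 : 0 <= D.
Hypothesis vitali : forall A : {set I}, exists B : {set I},
  [/\ B \subset A, forall x, \sum_(j in B) \1_(P j) x <= 1 :> R &
      (mu (\big[setU/set0]_(i in A) P i) <= (E * \sum_(j in B) v j)%:E)%E].
Hypothesis QP : forall i, Q i `<=` P i.
Hypothesis vw : forall i, v i <= D * w i.
Hypothesis beta0 : forall i, 0 <= beta i.
Hypothesis s1 : 1 < s.

(* With [h = F^(s-1)], the left side is [\sum beta_i \int_(P i) h], which is at
   most [D \int G M] for [M] the maximal function of [h] over the sets [P i];
   then [M] is bounded in the dual exponent and the [F]-part is absorbed. *)
Lemma dilation :
  (nint mu (fun x => step_fun P beta x `^ s)%R <=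
    (dilation_cst D E s)%:E * nint mu (fun x => step_fun Q beta x `^ s)%R)%E.
Proof.
pose F := step_fun P beta; pose G := step_fun Q beta.
pose h x := F x `^ (s - 1).
pose q := s / (s - 1).
have s0 : 0 < s by exact: lt_trans s1.
have sm : 0 < s - 1 by rewrite subr_gt0.
have q1 : 1 < q by rewrite /q ltr_pdivlMr// mul1r; lra.
have q0 : 0 < q by exact: lt_trans q1.
have F0 x : 0 <= F x by exact: step_fun_ge0.
have G0 x : 0 <= G x by exact: step_fun_ge0.
have mF : measurable_fun setT F by exact: measurable_step_fun.
have mG : measurable_fun setT G by exact: measurable_step_fun.
have mpow (g : T -> R) e : measurable_fun setT g -> measurable_fun setT (fun x => g x `^ e).
  by move=> mg; exact: (measurableT_comp (measurable_powR e)).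
have mh : measurable_fun setT h by exact: mpow.
have h0 x : 0 <= h x by exact: powR_ge0.
have hB x : h x <= (\sum_i beta i) `^ (s - 1).
  by rewrite ge0_ler_powR ?nnegrE ?F0 ?sumr_ge0 ?(ltW sm)//; exact: step_fun_le.
pose M := hmax mu P v h.
have M0 x : 0 <= M x by exact: hmax_ge0.
have mM : measurable_fun setT M by exact: measurable_hmax.
pose Cm := maximal_cst E q.
have Cm0 : 0 <= Cm by exact: maximal_cst_ge0.
have strong : (nint mu (fun x => M x `^ q)%R <= Cm%:E * nint mu (fun x => F x `^ s)%R)%E.
  have := @strong_maximal _ _ _ mu I P v E mP muP v0 E0 vitali h _ mh h0 hB q q1.
  congr (_ <= _ * _)%E; apply: eq_nint => x.
  by rewrite /h -powRrM /q mulrCA divff ?gt_eqF// mulr1.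
(* Besides the duality, this shows that the integral of [F ^ s] is finite, hence absorbable. *)
have FE : nint mu (fun x => F x `^ s) = (\sum_i beta i * hint mu P h i)%:E.
  under eq_nint do rewrite -mulr_powRB1// mulr_suml.
  rewrite nint_sum; last 2 first.
  - by move=> i; apply: measurable_funM => //; apply: measurable_funM.
  - by move=> i x; rewrite !mulr_ge0 ?powR_ge0.
  rewrite -sumEFin; apply: eq_bigr => i _.
  under eq_nint do rewrite -mulrA.
  rewrite nintZ//; last 2 first.
  - by apply: measurable_funM.
  - by move=> x; rewrite mulr_ge0 ?powR_ge0.
  by rewrite EFinM -(hintE mP muP v0 mh h0 hB).
pose eta := (2 * (Cm + 1))^-1.
have eta0 : 0 < eta by rewrite invr_gt0 mulr_gt0// ltr_wpDl.
have etaC : eta * Cm <= 2^-1.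
  by rewrite /eta invfM -mulrA ler_piMr// ler_pdivrMl ?ltr_wpDl// mulr1 lerDl.
(* Young's inequality by cases. In the second case [M <= (D / eta * G) ^ (s-1)], because
   [(q - 1) * (s - 1) = 1]. *)
have young x : D * (G x * M x) <= eta * M x `^ q + eta * (D / eta) `^ s * G x `^ s.
  have [DG|DG] := leP (D * G x) (eta * M x `^ (q - 1)).
    apply: ler_wpDr; first by rewrite !mulr_ge0 ?powR_ge0// ltW.
    by rewrite -(mulr_powRB1 (M0 x) q0) [M x * _]mulrC 2!mulrA ler_wpM2r.
  apply: ler_wpDl; first by rewrite !mulr_ge0 ?powR_ge0// ltW.
  have z0 : 0 <= D / eta * G x by exact: mulr_ge0 (divr_ge0 D0 (ltW eta0)) (G0 x).
  rewrite -mulrA -powRM ?(divr_ge0 D0 (ltW eta0))// -(mulr_powRB1 z0 s0).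
  have -> : eta * (D / eta * G x * (D / eta * G x) `^ (s - 1)) =
     D * (G x * (D / eta * G x) `^ (s - 1)).
    by field; rewrite gt_eqF.
  rewrite ler_wpM2l// ler_wpM2l//.
  have -> : M x = (M x `^ (q - 1)) `^ (s - 1).
    rewrite -powRrM (_ : _ * _ = 1) ?powRr1// /q; field.
    by rewrite gt_eqF.
  rewrite ge0_ler_powR ?nnegrE ?powR_ge0 ?(ltW sm)//.
  by rewrite mulrAC ler_pdivlMr// mulrC ltW.
have young_int : (nint mu (fun x => F x `^ s)%R <=
    eta%:E * nint mu (fun x => M x `^ q)%R +
    (eta * (D / eta) `^ s)%:E * nint mu (fun x => G x `^ s)%R)%E.
  apply: (@le_trans _ _ (nint mu (fun x => D * (G x * M x)))).
    apply: (@le_trans _ _ (nint mu (fun x => \sum_i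
        (D * (beta i * havg mu P v h i)) * \1_(Q i) x))).
      have b0 i : 0 <= beta i * havg mu P v h i by rewrite mulr_ge0// havg_ge0.
      rewrite nint_step//; last by move=> i; exact: mulr_ge0.
      under eq_bigr do rewrite muQ -EFinM.
      rewrite sumEFin FE lee_fin; apply: ler_sum => i _.
      rewrite [leLHS](_ : _ = beta i * havg mu P v h i * v i); last first.
        by rewrite -mulrA /havg divfK ?gt_eqF.
      by rewrite [leRHS]mulrAC [leRHS]mulrC ler_wpM2l.
    apply: nint_le.
    - by apply: measurable_sum => i; apply: measurable_funM.
    - by apply: measurable_funM => //; exact: measurable_funM.
    - move=> x; apply: sumr_ge0 => i _; apply: mulr_ge0 => //; apply: mulr_ge0 => //.
      by apply: mulr_ge0 => //; apply: havg_ge0.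
    - move=> x; rewrite mulr_suml mulr_sumr ler_sum// => i _.
      rewrite -(mulrA D) ler_wpM2l// -!(mulrA (beta i)) ler_wpM2l//.
      rewrite indicE. have [/set_mem Qx|_] := boolP (x \in Q i); last by rewrite /= mulr0 mul0r.
      by rewrite /= mulr1 mul1r; apply: max_fun_ge; exact: QP.
  have mMq := mpow M q mM; have mGs := mpow G s mG.
  have eM x : 0 <= eta * M x `^ q by rewrite mulr_ge0 ?powR_ge0 ?(ltW eta0).
  have e2 : 0 <= eta * (D / eta) `^ s by rewrite mulr_ge0 ?powR_ge0 ?(ltW eta0).
  rewrite -!nintZ ?(ltW eta0)//; try by move=> x; exact: powR_ge0.
  rewrite -nintD//; first last.
  - by move=> x; rewrite mulr_ge0 ?powR_ge0.
  - exact: measurable_funM.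
  - exact: measurable_funM.
  apply: nint_le => //.
  - by apply: measurable_funM => //; exact: measurable_funM.
  - by apply: measurable_funD; apply: measurable_funM.
  - by move=> x; rewrite !mulr_ge0.
rewrite /dilation_cst -/q -/Cm -/eta.
move: young_int strong; rewrite -/F -/G FE.
set X := \sum_i _ => young_int strong.
have X0 : 0 <= X by apply: sumr_ge0 => i _; rewrite mulr_ge0// hint_ge0.
have {young_int} : (X%:E <= (2^-1 * X)%:E +
    (eta * (D / eta) `^ s)%:E * nint mu (fun x => G x `^ s)%R)%E.
  apply: (le_trans young_int); apply: leeD => //.
  apply: (@le_trans _ _ (eta%:E * (Cm%:E * X%:E))%E).
    by rewrite lee_wpmul2l ?lee_fin ?(ltW eta0).
  by rewrite -!EFinM lee_fin mulrA ler_wpM2r.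
have e2 : 0 <= eta * (D / eta) `^ s by rewrite mulr_ge0 ?powR_ge0 ?(ltW eta0).
case: (nint mu (fun x => G x `^ s)%R) (nint_ge0 mu (fun x => powR_ge0 (G x) s)) => [y| |]//.
  rewrite lee_fin => y0; rewrite -!EFinM !lee_fin.
  by set Z := _ * _ `^ s; lra.
move=> _; move: e2; rewrite le_eqVlt => /predU1P[<-|Z0].
  by rewrite mulr0 !mul0e adde0 !lee_fin; lra.
by move=> _; rewrite gt0_muley ?leey// lte_fin mulr_gt0.
Qed.

End dilation.

(** * Maximal averages over a laminar family *)

Section laminar_family.
Context d (T : measurableType d) (R : realType) (mu : {measure set T -> \bar R}).
Context (I : finType) (Q : I -> set T) (vol : I -> R) (gen : I -> nat) (i0 : I) (D : R).
Hypothesis mQ : forall i, measurable (Q i).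
Hypothesis muQ : forall i, mu (Q i) = (vol i)%:E.
Hypothesis vol0 : forall i, 0 < vol i.
Hypothesis D1 : 1 <= D.
Hypothesis gen_root : gen i0 = 0%N.
Hypothesis root_unique : forall i, gen i = 0%N -> i = i0.
Hypothesis Q_root : forall i, Q i `<=` Q i0.
Hypothesis laminar : forall i j x, Q i x -> Q j x -> (gen i <= gen j)%N -> Q j `<=` Q i.
Hypothesis same_gen : forall i j x, Q i x -> Q j x -> gen i = gen j -> i = j.
Hypothesis parent : forall i, (0 < gen i)%N ->
  exists j, [/\ (gen j < gen i)%N, Q i `<=` Q j & vol j <= D * vol i].

(** In the application the sets are dyadic cells, [osc i] is the distance of [b] to its mean over
    [Q i], [A i] is the average of [osc i0] over [Q i], and [X i] is the integral of [osc i] over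
    [Q i]. *)
Variables (osc : I -> T -> R) (A X : I -> R).
Hypothesis mosc : forall i, measurable_fun setT (osc i).
Hypothesis osc0 : forall i x, 0 <= osc i x.
Hypothesis A0 : forall i, 0 <= A i.
Hypothesis intX : forall i, nint mu (fun x => \1_(Q i) x * osc i x) = (X i)%:E.
Hypothesis intA : forall i, nint mu (fun x => \1_(Q i) x * osc i0 x) = (A i * vol i)%:E.
Hypothesis osc_le : forall i x, Q i x -> osc i0 x <= osc i x + A i.

Local Notation M := (max_fun Q A).
Local Notation alpha := (A i0).
Local Notation a := (2 * D).

(** Starting at the root average makes the root the only set selected at level 0. In the ratio
    [2 * D], the factor [D] pays for the passage to a parent and the 2 leaves half of the average in
    [good_lambda]. *)
Definition level (n : nat) : R := alpha * a ^+ n.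

(** The stopping sets of a Calderón-Zygmund decomposition at height [level n], inside the finite
    family. *)
Definition maximal_above (n : nat) (i : I) : bool := (level n <= A i) &&
  [forall j, (gen j < gen i)%N && `[< Q i `<=` Q j >] ==> (A j < level n)].

Let D0 : 0 < D. Proof. exact: lt_le_trans D1. Qed.
Let a1 : 1 < a. Proof. by move: D1; lra. Qed.
Let a0 : 0 < a. Proof. exact: lt_trans a1. Qed.

Let nonempty i : Q i !=set0.
Proof.
apply/set0P; apply/negP => /eqP Qi; have := muQ i; rewrite Qi measure0 => -[v].
by have := vol0 i; rewrite -v ltxx.
Qed.

Let A_root i j : Q i `<=` Q j -> A i * vol i <= A j * vol j.
Proof.
move=> ij; rewrite -lee_fin -!intA; apply: nint_le.
- exact: measurable_funM.
- exact: measurable_funM.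
- by move=> x; rewrite mulr_ge0.
- move=> x; rewrite ler_wpM2r// !indicE.
  have [/set_mem/ij Qj|_] := boolP (x \in Q i); last by rewrite /=.
  by rewrite mem_set.
Qed.

(** This case is treated apart because all the levels collapse to 0; the integral of [osc i0] over
    the root then vanishes, and with it every average. *)
Lemma max_fun_alpha0 : alpha = 0 -> forall x, M x = 0.
Proof.
move=> al0 x; apply/eqP; rewrite eq_le max_fun_ge0 andbT.
apply: bigmax_le => // i _; suff -> : A i = 0 by rewrite mul0r.
apply/eqP; rewrite eq_le A0 andbT -(pmulr_rle0 _ (vol0 i)) mulrC.
by rewrite (le_trans (A_root (@Q_root i)))// al0 mul0r.
Qed.

(** Selected sets at one level are disjoint: if two of them meet, the one of smaller generation
    contains the other and contradicts its maximality. *)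
Lemma maximal_above_mono i j x n : maximal_above n i -> maximal_above n j ->
  Q i x -> Q j x -> i = j.
Proof.
wlog ij : i j / (gen i <= gen j)%N.
  move=> H Ci Cj Qi Qj; have [ij|/ltnW ji] := leqP (gen i) (gen j); first exact: H.
  by apply/esym; exact: H.
move=> /andP[Ai _] /andP[_ /forallP/(_ i)] + Qi Qj.
move: ij; rewrite leq_eqVlt => /predU1P[gij _|gij]; first exact: (same_gen Qi Qj gij).
rewrite gij/= ltNge Ai/= implybF => /negP[].
by apply/asboolP; exact: (laminar Qi Qj (ltnW gij)).
Qed.

Section positive_average.
Hypothesis alpha0 : 0 < alpha.

Let level0 n : 0 < level n. Proof. by rewrite mulr_gt0// exprn_gt0. Qed.

Lemma maximal_above_exists n i x : Q i x -> level n <= A i ->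
  exists2 j, maximal_above n j & Q j x.
Proof.
move=> Qi Ai.
pose S := [pred j | `[< Q j x >] && (level n <= A j)].
have Si : S i by rewrite /S/= Ai andbT; apply/asboolP.
have [j /andP[/asboolP Qj Aj] jmin] := arg_minnP gen Si.
exists j => //; rewrite /maximal_above Aj/=; apply/forallP => k.
apply/implyP => /andP[kj /asboolP jk]; rewrite ltNge; apply/negP => Ak.
have /jmin : S k by rewrite /S/= Ak andbT; apply/asboolP; exact: jk.
by rewrite leqNgt kj.
Qed.

Lemma sum_maximal_above n x :
  \sum_(i | maximal_above n i) \1_(Q i) x = (level n <= M x)%R%:R :> R.
Proof.
have [/(max_fun_geP _ _ _ (level0 n))[i Qi Ai]|nM] := boolP (level n <= M x).
  have [j Cj Qj] := maximal_above_exists Qi Ai.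
  rewrite (bigD1 j)//= big1 ?addr0 ?indicE ?mem_set// => k /andP[Ck kj].
  rewrite indicE memNset// => Qk; move/eqP: kj; apply.
  exact: maximal_above_mono Ck Cj Qk Qj.
rewrite big1// => i /andP[Ai _]; rewrite indicE memNset// => Qi.
by move/negP: nM; apply; apply/(max_fun_geP _ _ _ (level0 n)); exists i.
Qed.

(** The parent was not selected, so its average is below [level n], and its volume is at most [D]
    times larger. At the root the average is [alpha], and [D >= 1] suffices. *)
Lemma maximal_above_le n i : maximal_above n i -> A i <= D * level n.
Proof.
have [gi|gi] := posnP (gen i); move=> /andP[Ai /forallP Ci].
  rewrite (root_unique gi) /level mulrCA ler_peMr// (le_trans D1)//.
  by rewrite ler_peMr// ?(ltW D0)// exprn_ege1// ltW.
have [j [gj ij vj]] := parent gi.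
have := Ci j; rewrite gj (asboolT ij)/= => Aj.
rewrite -(ler_pM2r (vol0 i)) (le_trans (A_root ij))// mulrAC mulrC.
apply: ler_pM => //; [exact: ltW|exact: ltW].
Qed.

Lemma maximal_above_nested n i : maximal_above n.+1 i ->
  exists2 j, maximal_above n j & Q i `<=` Q j.
Proof.
move=> /andP[Ai _]; have [x Qx] := nonempty i.
have An : level n <= A i.
  by rewrite (le_trans _ Ai)// /level exprS mulrCA ler_peMl ?ltW// level0.
have [j Cj Qj] := maximal_above_exists Qx An.
exists j => //; have [ji|ij] := leqP (gen j) (gen i).
  exact: (laminar Qj Qx ji).
have /andP[_ /forallP/(_ i)] := Cj; rewrite ij/= ltNge An/= implybF => /negP[].
by apply/asboolP; exact: (laminar Qx Qj (ltnW ij)).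
Qed.

Definition level_vol n := \sum_(i | maximal_above n i) vol i.

Let level_vol_ge0 n : 0 <= level_vol n.
Proof. by apply: sumr_ge0 => i _; exact: ltW. Qed.

Let X0 i : 0 <= X i.
Proof. by rewrite -lee_fin -intX nint_ge0// => x; rewrite mulr_ge0. Qed.

(** Let [k] be selected at level [n + 1] inside [i] selected at level [n]. On [Q k] one has
    [osc i0 <= osc i + A i] with [A i <= D * level n], which is half of [level n.+1]; so at least
    half of the average of [osc i0] over [Q k] comes from [osc i]. Disjointness of the sets [Q k]
    allows summation. *)
Lemma good_lambda n :
  2^-1 * level n.+1 * level_vol n.+1 <= \sum_(i | maximal_above n i) X i.
Proof.
pose g x := \sum_(i | maximal_above n i) \1_(Q i) x * osc i x.
have g0 x : 0 <= g x by apply: sumr_ge0 => i _; rewrite mulr_ge0.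
have mg : measurable_fun setT g.
  by apply: measurable_sum_cond => i; exact: measurable_funM.
rewrite -lee_fin.
have -> : ((\sum_(i | maximal_above n i) X i)%:E = nint mu g)%E.
  rewrite nint_sum.
  - by rewrite -sumEFin; apply: eq_bigr => i _; rewrite intX.
  - by move=> i; exact: measurable_funM.
  - by move=> i x; rewrite mulr_ge0.
apply: (@le_trans _ _ (\sum_(k | maximal_above n.+1 k) nint mu (fun x => \1_(Q k) x * g x)%R)%E).
  rewrite /level_vol mulr_sumr -sumEFin; apply: lee_sum => k Ck.
  have [i Ci ki] := maximal_above_nested Ck.
  apply: (@le_trans _ _ (nint mu (fun x => \1_(Q k) x * osc i x)%R)); last first.
    apply: nint_le.
    - exact: measurable_funM.
    - exact: measurable_funM.
    - by move=> x; rewrite mulr_ge0.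
    - move=> x; rewrite indicE; have [/set_mem Qx|_] := boolP (x \in Q k); last by rewrite /= !mul0r.
      rewrite /= !mul1r /g (bigD1 i)//= indicE mem_set ?mul1r; last exact: ki.
      by rewrite lerDl sumr_ge0// => j _; rewrite mulr_ge0.
  have lev : D * level n = 2^-1 * level n.+1.
    by rewrite /level exprS; field.
  have : ((level n.+1 * vol k)%:E <= nint mu (fun x => \1_(Q k) x * osc i x)%R +
      (D * level n * vol k)%:E)%E.
    apply: (@le_trans _ _ (A k * vol k)%:E).
      by rewrite lee_fin ler_pM2r ?vol0//; case/andP: Ck.
    have l0 : 0 <= D * level n := mulr_ge0 (ltW D0) (ltW (level0 n)).
    rewrite -intA EFinM -muQ -nint_indic// -nintZ//.
    rewrite -nintD//; first last.
    - by move=> x; rewrite mulr_ge0.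
    - exact: measurable_funM.
    - by move=> x; rewrite mulr_ge0.
    - exact: measurable_funM.
    apply: nint_le.
    - exact: measurable_funM.
    - by apply: measurable_funD; exact: measurable_funM.
    - by move=> x; rewrite mulr_ge0.
    - move=> x; rewrite [_ * \1_(Q k) x]mulrC -mulrDr indicE.
      have [/set_mem Qx|_] := boolP (x \in Q k); last by rewrite /= !mul0r.
      rewrite /= !mul1r (le_trans (osc_le (ki _ Qx)))// lerD2l.
      exact: maximal_above_le.
  rewrite lev; case: (nint _ _) => [y| |]//; last by move=> _; rewrite leey.
  by rewrite -EFinD !lee_fin; lra.
rewrite -nint_sum; last 2 first.
- by move=> i; exact: measurable_funM.
- by move=> i x; rewrite mulr_ge0.
apply: nint_le => //.
- by apply: measurable_sum_cond => i; exact: measurable_funM.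
- by move=> x; apply: sumr_ge0 => i _; rewrite mulr_ge0.
- move=> x; rewrite -mulr_suml sum_maximal_above.
  by have [_|_] := boolP (level n.+1 <= M x); rewrite ?mul1r ?mul0r.
Qed.

Lemma nint_level n :
  nint mu (fun x => (level n <= M x)%R%:R) = (level_vol n)%:E.
Proof.
under eq_nint do rewrite -sum_maximal_above.
rewrite nint_sum//; last by move=> i; exact: measurable_indic.
by rewrite -sumEFin; apply: eq_bigr => i _; rewrite nint_indic.
Qed.

Let mlevel n : measurable_fun setT (fun x => (level n <= M x)%R%:R : R).
Proof.
under eq_fun do rewrite -sum_maximal_above.
by apply: measurable_sum_cond => i; exact: measurable_indic.
Qed.

Let M0 x : 0 <= M x. Proof. exact: max_fun_ge0. Qed.

Let mM : measurable_fun setT M. Proof. exact: measurable_max_fun. Qed.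

Let mpow (g : T -> R) e : measurable_fun setT g -> measurable_fun setT (fun x => g x `^ e).
Proof. by move=> mg; exact: (measurableT_comp (measurable_powR e)). Qed.

Let M_alpha x : 0 < M x -> alpha <= M x.
Proof.
move=> Mx; have [i Qx _] := max_fun_geP _ _ _ Mx (lexx _).
by rewrite max_fun_ge//; exact: Q_root Qx.
Qed.

Lemma level_exceeds : exists K, forall x, M x < level K.
Proof.
exists (Num.truncn (alpha^-1 * \sum_i A i)).+1 => x.
apply: (@le_lt_trans _ _ (\sum_i A i)).
  apply: bigmax_le => [|i _]; first exact: sumr_ge0.
  rewrite (@le_trans _ _ (A i))//; first by rewrite ler_piMr.
  by rewrite (bigD1 i)//= lerDl sumr_ge0.
rewrite /level -ltr_pdivrMl//; apply: (lt_le_trans (truncnS_gt _)).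
apply: (@le_trans _ _ (2 ^+ (Num.truncn (alpha^-1 * \sum_i A i)).+1)).
  by rewrite -natrX ler_nat; apply: ltnW; exact: ltn_expl.
by rewrite lerXn2r ?nnegrE ?(ltW a0)//; move: D1; lra.
Qed.

Variables (p s r Bd : R).
Hypotheses (p0 : 0 < p) (s0 : 0 < s) (r1 : 1 < r) (Bd0 : 0 <= Bd).
Hypothesis psr : p^-1 + s^-1 = 1 - r^-1.

Let r0 : 0 < r. Proof. exact: lt_trans r1. Qed.

Let Sum K := \sum_(n < K.+1) level n `^ r * level_vol n.

Let Osc K := \sum_(n < K.+1) \sum_(i | maximal_above n i) level n `^ (r - 1) * X i.

Let Sum_ge0 K : 0 <= Sum K.
Proof. by apply: sumr_ge0 => n _; rewrite mulr_ge0 ?powR_ge0. Qed.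

Lemma nint_max_fun_le K : (forall x, M x < level K) ->
  (nint mu (fun x => M x `^ r)%R <= (a `^ r * Sum K)%:E)%E.
Proof.
move=> MK.
apply: (@le_trans _ _ (nint mu (fun x => a `^ r * \sum_(n < K.+1)
    (level n <= M x)%R%:R * level n `^ r)%R)).
  apply: nint_le.
  - exact: mpow.
  - apply: measurable_funM => //; apply: measurable_sum => n.
    by apply: measurable_funM => //; exact: mlevel.
  - by move=> x; exact: powR_ge0.
  - move=> x; have := M0 x; rewrite le_eqVlt => /predU1P[<-|Mx].
      rewrite powR0 ?gt_eqF// mulr_ge0 ?powR_ge0// sumr_ge0// => n _.
      by rewrite mulr_ge0 ?powR_ge0.
    apply: geom_levels_ge => //; first exact: M_alpha.
    rewrite (lt_le_trans (MK x))// /level exprS mulrCA ler_peMl ?(ltW a1)//.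
    exact: ltW (level0 K).
rewrite nintZ ?powR_ge0//; last 2 first.
- apply: measurable_sum => n.
  by apply: measurable_funM => //; exact: mlevel.
- by move=> x; apply: sumr_ge0 => n _; rewrite mulr_ge0 ?powR_ge0.
rewrite nint_sum; last 2 first.
- by move=> n; apply: measurable_funM => //; exact: mlevel.
- by move=> n x; rewrite mulr_ge0 ?powR_ge0.
rewrite EFinM lee_wpmul2l ?lee_fin ?powR_ge0// /Sum -sumEFin.
apply: lee_sum => n _; under eq_nint do rewrite mulrC.
by rewrite nintZ ?powR_ge0// nint_level EFinM.
Qed.

(** Level [n + 1] is paid for by the oscillation at level [n] through [good_lambda]. Level 0
    consists of the root alone, where [level 0 * vol i0] equals [X i0]. *)
Lemma Sum_le_Osc K : Sum K <= (1 + 2 * a `^ (r - 1)) * Osc K.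
Proof.
rewrite /Sum mulrDl mul1r big_ord_recl.
have Osc0 n : 0 <= \sum_(i | maximal_above n i) level n `^ (r - 1) * X i.
  by apply: sumr_ge0 => i _; rewrite mulr_ge0 ?powR_ge0.
apply: lerD.
  rewrite /Osc big_ord_recl; apply: ler_wpDr; first exact: sumr_ge0.
  rewrite /level_vol mulr_sumr ler_sum// => i /andP[_ /forallP/(_ i0)].
  have [gi|gi] := posnP (gen i); last first.
    by rewrite gen_root gi (asboolT (@Q_root i))/= /level expr0 mulr1 ltxx.
  move=> _; rewrite (root_unique gi) -(mulr_powRB1 (ltW (level0 _)) r0).
  rewrite mulrC mulrA mulrC ler_wpM2l ?powR_ge0// {1}/level expr0 mulr1.
  by rewrite -lee_fin mulrC -intA intX.
rewrite -mulrA [X in _ <= _ * X]mulr_sumr mulr_sumr big_ord_recr/=.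
apply: ler_wpDr; first by rewrite !mulr_ge0 ?powR_ge0.
apply: ler_sum => n _; rewrite /bump leq0n add1n.
rewrite -(mulr_powRB1 (ltW (level0 _)) r0) -mulr_sumr.
have := good_lambda n; have -> : level n.+1 = a * level n.
  by rewrite /level exprS mulrCA.
rewrite powRM ?(ltW a0)// ?(ltW (level0 _))// => H.
rewrite (_ : a * level n * _ * _ = 2 * (a `^ (r - 1) * level n `^ (r - 1)) *
   (2^-1 * (a * level n) * level_vol n.+1)); last by field.
rewrite [leRHS](_ : _ = 2 * (a `^ (r - 1) * level n `^ (r - 1)) *
   \sum_(i | maximal_above n i) X i); last by ring.
by rewrite ler_wpM2l// !mulr_ge0 ?powR_ge0.
Qed.

Hypothesis osc_bound : forall (J : finType) (k : J -> I) (tau : J -> R) (U W : R),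
  (forall j, 0 <= tau j) -> 0 <= U -> 0 <= W ->
  (nint mu (fun x => step_fun (Q \o k) (fun j => tau j `^ (r / p)) x `^ p)%R <= U%:E)%E ->
  (nint mu (fun x => step_fun (Q \o k) (fun j => tau j `^ (r / s)) x `^ s)%R <= W%:E)%E ->
  \sum_j tau j `^ (r - 1) * X (k j) <= Bd * U `^ p^-1 * W `^ s^-1.

(** Zero weights let one product type index the selected sets of all levels; positive powers
    preserve the zeros. *)
Let tau K (u : 'I_K.+1 * I) := (maximal_above u.1 u.2)%:R * level u.1.

Let tau_powR K (u : 'I_K.+1 * I) e : 0 < e ->
  tau u `^ e = (maximal_above u.1 u.2)%:R * level u.1 `^ e.
Proof.
rewrite /tau => e0; case: maximal_above; rewrite ?mul1r ?mul0r//.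
by rewrite powR0 ?gt_eqF.
Qed.

Let step_tau K e x : 0 < e ->
  step_fun (Q \o snd) (fun u : 'I_K.+1 * I => tau u `^ e) x =
  \sum_(n < K.+1) (level n <= M x)%R%:R * level n `^ e.
Proof.
move=> e0; rewrite /step_fun.
rewrite -(pair_bigA _ (fun n i => tau (n, i) `^ e * \1_(Q i) x))/=.
apply: eq_bigr => n _; rewrite -sum_maximal_above mulr_suml.
rewrite [RHS]big_mkcond/=; apply: eq_bigr => i _; rewrite tau_powR//=.
by case: maximal_above; rewrite ?mul1r ?mul0r// mulrC.
Qed.

(** At a point, the weights present are powers of exactly the levels below [M], so their sum is at
    most a constant times [M ^ (r/w)]. Its [w]-th power is [M ^ r] whatever [w] is, which is why
    both norms reduce to the same sum. *)
Let step_tau_int K w : 0 < w ->  (forall x, M x < level K) ->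
  (nint mu (fun x => step_fun (Q \o snd) (fun u : 'I_K.+1 * I => tau u `^ (r / w)) x `^ w)%R
    <= (geom_cst a (r / w) `^ w * (a `^ r * Sum K))%:E)%E.
Proof.
move=> w0 MK; have rw : 0 < r / w by rewrite divr_gt0.
rewrite EFinM; apply: (@le_trans _ _
  ((geom_cst a (r / w) `^ w)%:E * nint mu (fun x => M x `^ r)%R)%E); last first.
  by rewrite lee_wpmul2l ?lee_fin ?powR_ge0//; exact: nint_max_fun_le.
have c0 : 0 <= geom_cst a (r / w) by rewrite ltW// geom_cst_gt0.
rewrite -nintZ ?powR_ge0//; last 2 first.
- exact: mpow.
- by move=> x; exact: powR_ge0.
have st0 x : 0 <= step_fun (Q \o snd) (fun u : 'I_K.+1 * I => tau u `^ (r / w)) x.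
  by apply: step_fun_ge0 => u; exact: powR_ge0.
apply: nint_le.
- by apply: mpow; apply: measurable_step_fun => u /=.
- by apply: measurable_funM => //; exact: mpow.
- by move=> x; exact: powR_ge0.
- move=> x; have -> : M x `^ r = (M x `^ (r / w)) `^ w.
    by rewrite -powRrM divfK ?gt_eqF.
  rewrite -powRM ?powR_ge0// ge0_ler_powR ?nnegrE ?(ltW w0) ?st0//.
    by rewrite mulr_ge0 ?powR_ge0.
  by rewrite step_tau//; apply: geom_levels_le.
Qed.

(** The first factor comes from [Sum_le_Osc], the two geometric constants from the two norms, and
    [a ^ (r-1)] is [(a ^ r) ^ (1/p + 1/s)]. *)
Definition laminar_cst0 := (1 + 2 * a `^ (r - 1)) *
  (geom_cst a (r / p) * geom_cst a (r / s) * a `^ (r - 1)).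

(** The testing bound gives [S <= C * Bd * S ^ (1 - 1/r)] for [S = Sum K]. As a finite sum, [S] is a
    real number, so the power can be divided out once [S = 0] is set aside. *)
Lemma laminar_core_pos :
  (nint mu (fun x => M x `^ r)%R <= ((a * (laminar_cst0 * Bd)) `^ r)%:E)%E.
Proof.
have [K MK] := level_exceeds.
apply: (le_trans (nint_max_fun_le MK)).
have cp0 : 0 < geom_cst a (r / p) by rewrite geom_cst_gt0// divr_gt0.
have cs0 : 0 < geom_cst a (r / s) by rewrite geom_cst_gt0// divr_gt0.
have C0 : 0 <= laminar_cst0.
  rewrite !mulr_ge0 ?powR_ge0 ?(ltW cp0) ?(ltW cs0)//.
  by rewrite addr_ge0// mulr_ge0// powR_ge0.
rewrite lee_fin (powRM r (ltW a0) (mulr_ge0 C0 Bd0)) ler_wpM2l ?powR_ge0//.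
have := Sum_ge0 K; rewrite le_eqVlt => /predU1P[<-|S0]; first exact: powR_ge0.
have H : Sum K <= laminar_cst0 * Bd * Sum K `^ (1 - r^-1).
  apply: (le_trans (Sum_le_Osc K)).
  have aS0 : 0 <= a `^ r * Sum K by rewrite mulr_ge0 ?powR_ge0// ltW.
  have pw c e : 0 < c -> 0 < e -> exists U, [/\ U = c `^ e * (a `^ r * Sum K), 0 <= U &
      U `^ e^-1 = c * (a `^ r * Sum K) `^ e^-1].
    move=> c0 e0; exists (c `^ e * (a `^ r * Sum K)); split => //.
      by rewrite mulr_ge0 ?powR_ge0.
    rewrite (powRM _ (powR_ge0 _ _) aS0) -powRrM divff ?gt_eqF//.
    by rewrite powRr1// ltW.
  have [U [UE U0 Up]] := pw _ _ cp0 p0; have [W [WE W0 Ws]] := pw _ _ cs0 s0.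
  have := @osc_bound _ snd (@tau K) U W.
  have -> : \sum_(j : 'I_K.+1 * I) tau j `^ (r - 1) * X j.2 = Osc K.
    rewrite -(pair_bigA _ (fun n i => tau (n, i) `^ (r - 1) * X i))/=.
    apply: eq_bigr => n _; rewrite [RHS]big_mkcond; apply: eq_bigr => i _.
    rewrite tau_powR ?subr_gt0//=.
    by case: maximal_above; rewrite ?mul1r ?mul0r.
  rewrite Up Ws UE WE in U0 W0 *.
  move=> /(_ _ U0 W0 (step_tau_int p0 MK) (step_tau_int s0 MK)) osc_le'.
  rewrite /laminar_cst0 -!mulrA ler_wpM2l//.
    by rewrite addr_ge0// mulr_ge0// powR_ge0.
  apply: (le_trans (osc_le' _)).
    by move=> u; rewrite mulr_ge0// ltW.
  rewrite [leLHS](_ : _ = geom_cst a (r / p) * (geom_cst a (r / s) * (Bd *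
    ((a `^ r * Sum K) `^ p^-1 * (a `^ r * Sum K) `^ s^-1)))); last by ring.
  have aS : 0 < a `^ r * Sum K by rewrite mulr_gt0 ?powR_gt0.
  rewrite -powRD ?psr; last by rewrite (gt_eqF aS) implybT.
  rewrite powRM ?powR_ge0 ?(ltW S0)// -powRrM mulrBr divff ?gt_eqF// mulr1.
  by rewrite (mulrCA Bd).
have : Sum K `^ r^-1 <= laminar_cst0 * Bd.
  rewrite -(ler_pM2r (powR_gt0 (1 - r^-1) S0)) -powRD; last first.
    by rewrite (gt_eqF S0) implybT.
  by rewrite addrC subrK powRr1// ltW.
move=> /(@ge0_ler_powR _ r (ltW r0)).
rewrite !nnegrE powR_ge0 mulr_ge0// -powRrM mulVf ?gt_eqF// powRr1 ?(ltW S0)//.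
exact.
Qed.

End positive_average.

Definition laminar_cst p s r := a * laminar_cst0 p s r.

Lemma laminar_core (p s r Bd : R) : 0 < p -> 0 < s -> 1 < r -> 0 <= Bd ->
  p^-1 + s^-1 = 1 - r^-1 ->
  (forall (J : finType) (k : J -> I) (tau : J -> R) (U W : R),
    (forall j, 0 <= tau j) -> 0 <= U -> 0 <= W ->
    (nint mu (fun x => step_fun (Q \o k) (fun j => tau j `^ (r / p)) x `^ p)%R <= U%:E)%E ->
    (nint mu (fun x => step_fun (Q \o k) (fun j => tau j `^ (r / s)) x `^ s)%R <= W%:E)%E ->
    \sum_j tau j `^ (r - 1) * X (k j) <= Bd * U `^ p^-1 * W `^ s^-1) ->
  (nint mu (fun x => M x `^ r)%R <= ((laminar_cst p s r * Bd) `^ r)%:E)%E.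
Proof.
move=> p0 s0 r1 Bd0 psr H.
have := A0 i0; rewrite le_eqVlt => /predU1P[al0|al0]; last first.
  by rewrite -mulrA; exact: laminar_core_pos.
rewrite (@eq_nint _ _ _ _ _ (fun=> 0)); last first.
  by move=> x; rewrite max_fun_alpha0// powR0// gt_eqF// (lt_trans _ r1).
by rewrite /nint integral0 lee_fin powR_ge0.
Qed.

End laminar_family.

(** * Lebesgue measure and cubes *)

Lemma measure_bigsetU_le d (T : measurableType d) (R : realType)
    (mu : {measure set T -> \bar R}) (I : Type) (s : seq I) (P : pred I)
    (A : I -> set T) : (forall i, measurable (A i)) ->
  (mu (\big[setU/set0]_(i <- s | P i) A i) <= \sum_(i <- s | P i) mu (A i))%E.
Proof.
move=> mA; elim: s => [|i t ih]; first by rewrite !big_nil measure0.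
rewrite !big_cons; case: ifPn => // Pi.
apply: (@le_trans _ _ (mu (A i) + mu (\big[setU/set0]_(j <- t | P j) A j))%E).
  by apply: measureU2 => //; exact: bigsetU_measurable.
exact: leeD2l.
Qed.

Section boxes.
Context {R : realType} {n : nat}.
Implicit Types (a b v x : 'rV[R]_n) (l t : R).
Local Notation mu := (lebesgue_rV n : {measure set 'rV[R]_n -> \bar R}).

Definition box a b : set 'rV[R]_n := [set x | forall i, a ord0 i <= x ord0 i <= b ord0 i].

Lemma mu_box a b : (forall i, a ord0 i <= b ord0 i) ->
  mu (box a b) = (\prod_(i < n) (b ord0 i - a ord0 i))%:E.
Proof. exact: lebesgue_rV_box. Qed.

Definition cub a l : set 'rV[R]_n := [set x | forall i, a ord0 i <= x ord0 i <= a ord0 i + l].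

Definition hcub a l : set 'rV[R]_n := [set x | forall i, a ord0 i <= x ord0 i < a ord0 i + l].

Lemma measurable_coordwise (P : 'I_n -> set R) : (forall i, measurable (P i)) ->
  measurable [set x : 'rV[R]_n | forall i, P i (x ord0 i)].
Proof.
move=> mP.
rewrite (_ : [set _ | _] = \big[setI/setT]_(i < n) ((fun x : 'rV[R]_n => x ord0 i) @^-1` P i)).
  apply: bigsetI_measurable => i _; rewrite -[X in measurable X]setTI.
  exact: measurable_coord.
rewrite -bigcap_seq; apply/seteqP; split => [x /= H i _|x /= H i].
  exact: H.
by apply: H => /=; rewrite mem_index_enum.
Qed.

Lemma measurable_box a b : measurable (box a b).
Proof.
rewrite (_ : box a b = [set x | forall i, `[a ord0 i, b ord0 i]%classic (x ord0 i)]).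
  by apply: (@measurable_coordwise (fun i => `[a ord0 i, b ord0 i]%classic)).
by apply/seteqP; split => x /= H i; have := H i; rewrite /= in_itv.
Qed.

Lemma cubE a l : cub a l = box a (\row_i (a ord0 i + l)).
Proof. by apply/seteqP; split => x H i; have := H i; rewrite mxE. Qed.

Lemma measurable_cub a l : measurable (cub a l).
Proof. by rewrite cubE; exact: measurable_box. Qed.

Lemma measurable_hcub a l : measurable (hcub a l).
Proof.
rewrite (_ : hcub a l = [set x | forall i, `[a ord0 i, a ord0 i + l[%classic (x ord0 i)]).
  by apply: (@measurable_coordwise (fun i => `[a ord0 i, a ord0 i + l[%classic)).
by apply/seteqP; split => x /= H i; have := H i; rewrite /= in_itv.
Qed.

Lemma mu_cub a l : 0 <= l -> mu (cub a l) = (l ^+ n)%:E.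
Proof.
move=> l0; rewrite cubE mu_box => [|i]; last by rewrite mxE lerDl.
under eq_bigr do rewrite mxE addrAC subrr add0r.
by rewrite prodr_const card_ord.
Qed.

Lemma hcub_sub a l : hcub a l `<=` cub a l.
Proof. by move=> x H i; have /andP[-> /ltW ->] := H i. Qed.

(** The closed cube exceeds the half-open one by at most [n] upper faces, which are degenerate boxes
    of measure 0. *)
Lemma mu_hcub a l : 0 < l -> mu (hcub a l) = (l ^+ n)%:E.
Proof.
move=> l0; apply/eqP; rewrite eq_le; apply/andP; split.
  rewrite -(mu_cub a (ltW l0)) le_measure ?inE//; last exact: hcub_sub.
    exact: measurable_hcub.
  exact: measurable_cub.
pose face i := box (\row_j if j == i then a ord0 i + l else a ord0 j) (\row_j (a ord0 j + l)).
have face0 i : mu (face i) = 0%E.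
  rewrite mu_box.
    by rewrite (bigD1 i)//= !mxE eqxx subrr mul0r.
  by move=> j; rewrite !mxE; case: eqP => [->|_]//; rewrite lerDl ltW.
have mface i : measurable (face i) by exact: measurable_box.
rewrite -(mu_cub a (ltW l0)).
apply: (@le_trans _ _ (mu (hcub a l `|` \big[setU/set0]_(i < n) face i))).
  rewrite le_measure ?inE//; first exact: measurable_cub.
    by apply: measurableU; [exact: measurable_hcub|exact: bigsetU_measurable].
  move=> x cx; have [[i xi]|nx] := pselect (exists i, x ord0 i = a ord0 i + l).
    right; rewrite -bigcup_seq; exists i; first by rewrite /= mem_index_enum.
    move=> j; rewrite !mxE; case: eqP => [->|_]; first by rewrite xi lexx.
    exact: cx.
  left => i; have /andP[-> ] := cx i; rewrite le_eqVlt => /predU1P[xi|//].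
  by exfalso; apply: nx; exists i.
apply: (le_trans (measureU2 _ _ _)); first exact: measurable_hcub.
  exact: bigsetU_measurable.
rewrite -[leRHS]adde0 leeD// (le_trans (measure_bigsetU_le _ _ _ _))//.
by rewrite big1// => i _; exact: face0.
Qed.

Lemma setI_box a b a' b' : box a b `&` box a' b' =
  box (\row_i Num.max (a ord0 i) (a' ord0 i)) (\row_i Num.min (b ord0 i) (b' ord0 i)).
Proof.
apply/seteqP; split => x /=.
  move=> [H H'] i; have /andP[h1 h2] := H i; have /andP[h3 h4] := H' i.
  by rewrite !mxE ge_max le_min h1 h2 h3 h4.
by move=> H; split => i; have := H i; rewrite !mxE ge_max le_min => /andP[/andP[h1 h2] /andP[h3 h4]]; apply/andP.
Qed.

Definition sum_norm x := \sum_i `|x ord0 i|.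

Lemma le_sum_norm x i : `|x ord0 i| <= sum_norm x.
Proof. by rewrite /sum_norm (bigD1 i)//= lerDl sumr_ge0. Qed.

Definition boxes : set (set 'rV[R]_n) := [set A | exists a b, A = box a b].

Lemma rV_measurable_boxes : (@measurable _ 'rV[R]_n) = <<s boxes >>.
Proof.
apply/seteqP; split; last first.
  apply: smallest_sub; first exact: sigma_algebra_measurable.
  by move=> _ [a [b ->]]; exact: measurable_box.
apply: smallest_sub; first exact: smallest_sigma_algebra.
rewrite -bigcup_seq/=; apply: bigcup_sub => i _ _ [B mB <-].
pose coord : g_sigma_algebraType boxes -> R := fun x : 'rV[R]_n => x ord0 i.
suff mc : measurable_fun setT coord by exact: mc.
apply: (measurability _ (RGenCInfty.measurableE R)) => //.
move=> /= _ [_ [r ->] <-]; rewrite setTI.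
(* These boxes exhaust the half-space: the lower bound [r] in coordinate [i] is fixed while all the
   other bounds recede. *)
pose lo (k : nat) : 'rV[R]_n := \row_j if j == i then r else - k%:R.
pose hi (k : nat) : 'rV[R]_n := const_mx k%:R.
rewrite (_ : _ @^-1` _ = \bigcup_k box (lo k) (hi k)).
  by apply: bigcup_measurable => k _; apply: sub_sigma_algebra; exists (lo k), (hi k).
apply/seteqP; split => [x /=|x [k _ /(_ i)]]; last first.
  by rewrite !mxE eqxx /= in_itv/= andbT => /andP[].
rewrite in_itv/= andbT => rx.
exists (Num.truncn (sum_norm x)).+1 => // j; rewrite !mxE.
have /ler_normlP[x1 x2] : `|x ord0 j| <= (Num.truncn (sum_norm x)).+1%:R.
  by rewrite (le_trans (le_sum_norm x j))// ltW// truncnS_gt.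
by rewrite x2 andbT; case: eqP => [->//|_]; rewrite lerNl.
Qed.

Lemma lebesgue_rV_unique (m : {measure set 'rV[R]_n -> \bar R}) :
  (forall a b, (forall i, a ord0 i <= b ord0 i) -> m (box a b) = mu (box a b)) ->
  forall A, measurable A -> m A = mu A.
Proof.
move=> H A mA; apply/esym; move: A mA.
pose g (k : nat) := box (const_mx (- k%:R)) (const_mx k%:R) : set 'rV[R]_n.
apply: (@measure_unique _ _ _ boxes g).
- exact: rV_measurable_boxes.
- move=> _ _ [a [b ->]] [a' [b' ->]]; rewrite setI_box.
  by eexists; eexists.
- by move=> k; eexists; eexists.
- apply/seteqP; split => // x _; exists (Num.truncn (sum_norm x)).+1 => // j.
  rewrite !mxE -ler_norml (le_trans (le_sum_norm x j))//.
  by rewrite ltW// truncnS_gt.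
- move=> _ [a [b ->]]; have [ab|] := pselect (forall i, a ord0 i <= b ord0 i).
    by rewrite H.
  move=> /existsNP[i /negP]; rewrite -ltNge => ba.
  rewrite (_ : box a b = set0) ?measure0//.
  by rewrite -subset0 => x /(_ i) /andP[ax xb]; have := le_trans ax xb; rewrite leNgt ba.
- move=> k.
  rewrite /g mu_box ?ltry// => i; rewrite !mxE.
  by rewrite lerNl (le_trans _ (ler0n _ k))// oppr_le0.
Qed.

Definition affine t v x : 'rV[R]_n := t *: x + v.

Lemma measurable_affine t v : measurable_fun setT (affine t v).
Proof.
apply: measurable_fun_coordP => i; rewrite /affine.
rewrite (_ : (fun _ => _) = (fun x : 'rV[R]_n => t * x ord0 i + v ord0 i)).
  apply: measurable_funD => //; apply: measurable_funM => //.
  exact: measurable_coord.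
by apply/funext => x; rewrite !mxE.
Qed.

Lemma affine_box t v a b : t != 0 -> (forall i, a ord0 i <= b ord0 i) ->
  exists a' b', [/\ affine t v @^-1` (box a b) = box a' b',
    forall i, a' ord0 i <= b' ord0 i &
    forall i, b' ord0 i - a' ord0 i = `|t|^-1 * (b ord0 i - a ord0 i)].
Proof.
move=> t0 ab; have [tp|tn] := leP 0 t.
  have {t0}tp : 0 < t by rewrite lt_neqAle eq_sym t0.
  exists (\row_i ((a ord0 i - v ord0 i) / t)), (\row_i ((b ord0 i - v ord0 i) / t)).
  split.
  - apply/seteqP; split => x /= H i; have := H i; rewrite !mxE.
      by rewrite ler_pdivrMr// ler_pdivlMr// lerBlDr lerBrDr mulrC.
    by rewrite ler_pdivrMr// ler_pdivlMr// lerBlDr lerBrDr mulrC.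
  - by move=> i; rewrite !mxE ler_pM2r ?invr_gt0// lerD2r.
  - by move=> i; rewrite !mxE gtr0_norm//; field; rewrite gt_eqF.
(* For negative [t] the two corners exchange roles. *)
exists (\row_i ((b ord0 i - v ord0 i) / t)), (\row_i ((a ord0 i - v ord0 i) / t)).
split.
- apply/seteqP; split => x /= H i; have := H i; rewrite !mxE.
    by rewrite ler_ndivrMr// ler_ndivlMr// lerBlDr lerBrDr mulrC andbC.
  by rewrite ler_ndivrMr// ler_ndivlMr// lerBlDr lerBrDr mulrC andbC.
- by move=> i; rewrite !mxE ler_nM2r ?invr_lt0// lerD2r.
- by move=> i; rewrite !mxE ltr0_norm//; field; rewrite lt_eqF.
Qed.

(** The image measure multiplied by [|t|^n] agrees with Lebesgue measure on boxes, hence on all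
    Borel sets. *)
Lemma mu_affine t v A : t != 0 -> measurable A ->
  mu (affine t v @^-1` A) = ((`|t| ^+ n)^-1%:E * mu A)%E.
Proof.
move=> t0; move: A.
have tn0 : 0 <= `|t| ^+ n by rewrite exprn_ge0.
have tnN0 : `|t| ^+ n != 0 by rewrite expf_neq0// normr_eq0.
pose push : {measure set 'rV[R]_n -> \bar R} :=
  pushforward mu (affine t v).
pose m1 := push (measurable_affine t v).
pose m2 : {measure set 'rV[R]_n -> \bar R} := mscale (NngNum tn0) m1.
have H : forall A, measurable A -> m2 A = mu A.
  apply: lebesgue_rV_unique => a b ab.
  have [a' [b' [E ab' len]]] := affine_box v t0 ab.
  transitivity ((`|t| ^+ n)%:E * mu (affine t v @^-1` box a b))%E => //.
  rewrite E !mu_box//.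
  under eq_bigr do rewrite len.
  by rewrite big_split/= prodr_const card_ord -EFinM exprVn mulVKf.
move=> A mA.
have HA : ((`|t| ^+ n)%:E * mu (affine t v @^-1` A) = mu A)%E := H A mA.
by rewrite -HA muleA -EFinM mulVf// mul1e.
Qed.

Lemma nint_affine t v (g : 'rV[R]_n -> R) : t != 0 -> measurable_fun setT g ->
  (forall x, 0 <= g x) ->
  nint mu (fun x => g (t *: x + v)) = ((`|t| ^+ n)^-1%:E * nint mu g)%E.
Proof.
move=> t0 mg g0.
pose push : {measure set 'rV[R]_n -> \bar R} :=
  pushforward mu (affine t v).
pose m1 := push (measurable_affine t v).
have tn0 : 0 <= (`|t| ^+ n)^-1 by rewrite invr_ge0 exprn_ge0.
transitivity (nint m1 g).
  rewrite /nint ge0_integral_pushforward//.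
  - exact: measurable_affine.
  - exact/measurable_EFinP.
  - by move=> y _; rewrite lee_fin.
rewrite /nint -[X in (X * _)%E]/((NngNum tn0)%:num%:E) -ge0_integral_mscale//.
- by apply: eq_measure_integral => A mA _; exact: mu_affine.
- exact/measurable_EFinP.
- by move=> x _; rewrite lee_fin.
Qed.

Lemma cub_meet_sub a b l k x : l <= k -> cub a l x -> cub b k x ->
  cub a l `<=` cub (b - const_mx k) (3 * k).
Proof.
move=> lk ax bx y ay i; rewrite !mxE.
have := ax i; have := bx i; have := ay i; lra.
Qed.

(** Greedy selection: keep a cube of largest side, discard the cubes that meet it, and repeat with
    the remaining ones. A discarded cube lies in the threefold enlargement of the cube that removed
    it, whence [3 ^+ n]. *)
Lemma vitali_cubes (I : finType) (a : I -> 'rV[R]_n) (l : I -> R) :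
  (forall i, 0 < l i) -> forall A : {set I}, exists B : {set I},
  [/\ B \subset A, forall x, \sum_(j in B) \1_(cub (a j) (l j)) x <= 1 :> R &
      (mu (\big[setU/set0]_(i in A) cub (a i) (l i)) <=
        (3 ^+ n * \sum_(j in B) l j ^+ n)%:E)%E].
Proof.
move=> l0 A; pose C i := cub (a i) (l i).
have [B [BA disj cov]] : exists B : {set I}, [/\ B \subset A,
    forall i j x, i \in B -> j \in B -> C i x -> C j x -> i = j &
    forall i, i \in A -> exists j, [/\ j \in B, l i <= l j & exists x, C i x /\ C j x]].
  have [m] := ubnP #|A|; elim: m A => // m ih A Am.
  have [->|/set0Pn[i0 i0A]] := eqVneq A finset.set0.
    by exists finset.set0; split => // i; [move=> j x|]; rewrite inE.
  have [j jA0 jmax] := arg_maxP l i0A; have jA : j \in A := jA0.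
  pose A' := [set i in A | ~~ `[< exists x, C i x /\ C j x >]]%SET.
  have jj : exists x, C j x /\ C j x.
    by exists (a j); split => i; rewrite lexx lerDl ltW.
  have A'A : A' \subset A by apply/fintype.subsetP => i; rewrite inE => /andP[].
  have A'm : (#|A'| < m)%N.
    rewrite -ltnS (leq_trans _ Am)// ltnS; apply: proper_card.
    rewrite fintype.properE A'A; apply/fintype.subsetPn; exists j => //.
    by rewrite inE jA/= negbK; apply/asboolP.
  have [B' [B'A' disj' cov']] := ih A' A'm.
  have B'nj i : i \in B' -> ~ exists x, C i x /\ C j x.
    move=> iB; have := fintype.subsetP B'A' _ iB; rewrite inE => /andP[_].
    by move=> /asboolP.
  exists (j |: B')%SET; split.
  - apply/fintype.subsetP => i; rewrite !inE => /predU1P[->//|iB].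
    by apply: (fintype.subsetP A'A); apply: (fintype.subsetP B'A').
  - move=> i k x; rewrite !inE => /predU1P[->|iB] /predU1P[->|kB]// Ci Ck.
    + by exfalso; apply: (B'nj _ kB); exists x.
    + by exfalso; apply: (B'nj _ iB); exists x.
    + exact: disj' Ck.
  - move=> i iA; have [ij|ij] := pselect (exists x, C i x /\ C j x).
      by exists j; split => //; [rewrite !inE eqxx|exact: jmax].
    have /cov'[k [kB lik ik]] : i \in A' by rewrite inE iA; apply/asboolP.
    by exists k; split => //; rewrite !inE kB orbT.
exists B; split => //.
  move=> x; have [[j [jB Cj]]|nB] := pselect (exists j, j \in B /\ C j x).
    rewrite (bigD1 j)//= big1 ?addr0; first by rewrite indicE; case: (_ \in _).
    move=> i /andP[iB ij]; rewrite indicE memNset// => Ci.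
    by move/eqP: ij; apply; exact: disj Ci Cj.
  rewrite big1// => i iB; rewrite indicE memNset// => Ci.
  by apply: nB; exists i.
pose C3 j := cub (a j - const_mx (l j)) (3 * l j).
have mC3 j : measurable (C3 j) by exact: measurable_cub.
apply: (@le_trans _ _ (mu (\big[setU/set0]_(j in B) C3 j))).
  rewrite le_measure ?inE//; [|exact: bigsetU_measurable|].
    by apply: bigsetU_measurable => i _; exact: measurable_cub.
  rewrite -!bigcup_seq_cond => x [i /= /andP[_ iA] Cix].
  have [j [jB lij [y [Ciy Cjy]]]] := cov i iA.
  exists j; first by rewrite /= mem_index_enum.
  exact: (cub_meet_sub lij Ciy Cjy).
apply: (le_trans (measure_bigsetU_le _ _ _ mC3)).
rewrite mulr_sumr -sumEFin lee_sum// => j _.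
by rewrite /C3 mu_cub ?exprMn// mulr_ge0// ltW.
Qed.

End boxes.

(** * Dyadic cells *)

Section dyadic_cells.
Context {R : realType} {n : nat}.
Variables (a : 'rV[R]_n) (L : R).
Hypothesis L0 : 0 < L.
Local Notation V := 'rV[R]_n.
Local Notation mu := (lebesgue_rV n : {measure set 'rV[R]_n -> \bar R}).

Definition cell_corner k (j : {ffun 'I_n -> 'I_(2 ^ k)}) : V :=
  \row_i (a ord0 i + L * (j i)%:R / 2 ^+ k).

Definition cell k (j : {ffun 'I_n -> 'I_(2 ^ k)}) : set V :=
  hcub (cell_corner j) (L / 2 ^+ k).

(** In coordinates relative to the root, the index is the integer part of [2^k] times the
    coordinate; nesting and disjointness of cells become facts about integer parts. *)
Lemma cellP k j (x : V) : @cell k j x <->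
  forall i, (j i)%:R <= 2 ^+ k * ((x ord0 i - a ord0 i) / L) < (j i).+1%:R.
Proof.
pose c := L / 2 ^+ k; have c0 : 0 < c by rewrite divr_gt0// exprn_gt0.
have E i : x ord0 i = a ord0 i + c * (2 ^+ k * ((x ord0 i - a ord0 i) / L)).
  by rewrite /c; field; rewrite gt_eqF//= expf_neq0.
have Ei i : (cell_corner j ord0 i <= x ord0 i < cell_corner j ord0 i + c) =
    ((j i)%:R <= 2 ^+ k * ((x ord0 i - a ord0 i) / L) < (j i).+1%:R).
  have -> : cell_corner j ord0 i = a ord0 i + c * (j i)%:R.
    by rewrite mxE /c mulrAC.
  rewrite {1 2}(E i) -addrA lerD2l ltrD2l ler_pM2l//.
  by rewrite -[X in _ < _ + X]mulr1 -mulrDr ltr_pM2l// natr1.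
by split => H i; have := H i; rewrite -/c Ei.
Qed.

Lemma rootP (x : V) : hcub a L x <->
  forall i, 0 <= (x ord0 i - a ord0 i) / L < 1.
Proof.
split => H i; have := H i.
  by rewrite ltr_pdivrMr// mul1r ltrBlDl => /andP[h ->]; rewrite divr_ge0 ?subr_ge0// ltW.
by rewrite ltr_pdivrMr// mul1r ltrBlDl pmulr_lge0 ?invr_gt0// subr_ge0.
Qed.

Lemma cell_ex k (x : V) : hcub a L x -> exists j, @cell k j x.
Proof.
move=> /rootP H; pose y i := (x ord0 i - a ord0 i) / L.
have k0 : 0 < 2 ^+ k :> R by rewrite exprn_gt0.
have yk i : (Num.truncn (2 ^+ k * y i) < 2 ^ k)%N.
  rewrite -(ltr_nat R) natrX; have /andP[y0 y1] := H i.
  rewrite (@le_lt_trans _ _ (2 ^+ k * y i))//; last by rewrite gtr_pMr.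
  by rewrite truncn_le mulr_ge0// ltW.
exists [ffun i => Ordinal (yk i)]; apply/cellP => i; rewrite ffunE/=.
have /andP[y0 y1] := H i.
by rewrite truncnS_gt andbT truncn_le mulr_ge0// ltW.
Qed.

Lemma cell_nested k k' j j' x : (k <= k')%N -> @cell k j x -> @cell k' j' x ->
  cell j' `<=` cell j.
Proof.
move=> kk' /cellP xj /cellP xj' z /cellP zj'; apply/cellP => i.
set m := (2 ^ (k' - k))%N.
have Em : 2 ^+ k' = 2 ^+ k * m%:R :> R by rewrite natrX -exprD subnKC.
have m0 : 0 < m%:R :> R by rewrite ltr0n expn_gt0.
move: (xj i) (xj' i) (zj' i); rewrite Em.
rewrite !(mulrAC _ m%:R); set xi := 2 ^+ k * _; set zi := 2 ^+ k * _.
move=> /andP[x1 x2] /andP[x3 x4] /andP[z1 z2].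
have jj' : (j i * m <= j' i)%N.
  rewrite -ltnS -(ltr_nat R) natrM (le_lt_trans _ x4)//.
  by rewrite ler_pM2r.
have j'j : (j' i < (j i).+1 * m)%N.
  by rewrite -(ltr_nat R) natrM (le_lt_trans x3)// ltr_pM2r.
rewrite -(ler_pM2r m0) -[X in _ && X](ltr_pM2r m0) -!natrM.
rewrite (le_trans _ z1) ?ler_nat//=.
by rewrite (lt_le_trans z2)// ler_nat.
Qed.

Lemma cell_inj k j j' x : @cell k j x -> @cell k j' x -> j = j'.
Proof.
move=> /cellP xj /cellP xj'; apply/ffunP => i; apply/val_inj/eqP => /=.
have /andP[h1 h2] := xj i; have /andP[h3 h4] := xj' i.
rewrite eqn_leq; apply/andP; split; rewrite -ltnS -(ltr_nat R).
- exact: le_lt_trans h1 h4.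
- exact: le_lt_trans h3 h2.
Qed.

Lemma cell_root k j : @cell k j `<=` hcub a L.
Proof.
move=> x /cellP xj; apply/rootP => i; have /andP[h1 h2] := xj i.
have k0 : 0 < 2 ^+ k :> R by rewrite exprn_gt0.
rewrite -(pmulr_rge0 _ k0) (le_trans _ h1)//= -(ltr_pM2l k0) mulr1.
by rewrite (lt_le_trans h2)// -natrX ler_nat.
Qed.

Lemma measurable_cell k j : measurable (@cell k j).
Proof. exact: measurable_hcub. Qed.

Lemma mu_cell k j : mu (@cell k j) = ((L / 2 ^+ k) ^+ n)%:E.
Proof. by rewrite mu_hcub// divr_gt0// exprn_gt0. Qed.

Lemma sum_cell k x : \sum_j \1_(@cell k j) x = \1_(hcub a L) x :> R.
Proof.
rewrite [RHS]indicE; have [/set_mem xr|xr] := boolP (x \in hcub a L).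
  have [j xj] := cell_ex k xr.
  rewrite (bigD1 j)//= indicE mem_set// big1 ?addr0// => i /eqP ij.
  by rewrite indicE memNset// => /cell_inj - /(_ _ xj).
rewrite big1// => j _; rewrite indicE memNset// => /cell_root xj.
by move/negP: xr; apply; exact: mem_set.
Qed.

(** Inside the root, [B] is a union of cells of generation [N]; outside it is arbitrary. *)
Definition invariant N (B : set V) :=
  forall j x y, @cell N j x -> cell j y -> B x -> B y.

Lemma invariant_le N M B : (N <= M)%N -> invariant N B -> invariant M B.
Proof.
move=> NM BN j x y xj yj.
have [i xi] := cell_ex N (cell_root xj).
by apply: (BN i) => //; exact: (cell_nested NM xi xj) yj.
Qed.

Definition approximable (A : set V) := forall e : R, 0 < e ->
  exists N (B : set V), [/\ measurable B, invariant N B &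
    (mu (hcub a L `&` (A `\` B `|` B `\` A)) < e%:E)%E].

Let mroot : measurable (hcub a L). Proof. exact: measurable_hcub. Qed.

Lemma invariant_approximable N B : measurable B -> invariant N B -> approximable B.
Proof.
move=> mB BN e e0; exists N, B; split => //.
by rewrite setDv setUid setI0 measure0.
Qed.

Lemma approximable_eq A A' : hcub a L `&` A = hcub a L `&` A' ->
  approximable A -> approximable A'.
Proof.
move=> AA' aA e /aA[N [B [mB BN mAB]]]; exists N, B; split => //.
rewrite (_ : _ `&` _ = hcub a L `&` (A `\` B `|` B `\` A))//.
have E x : hcub a L x -> (A x <-> A' x).
  move=> rx; have := congr1 (fun S => S x) AA' => /= H.
  by split => h; [have : hcub a L x /\ A x by []; rewrite H => -[]
                 |have : hcub a L x /\ A' x by []; rewrite -H => -[]].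
apply/seteqP; split => x [rx H]; split => //; move: H.
- by move=> [[/(E _ rx).2 h1 h2]|[h1 h2]]; [left|right; split => // /(E _ rx).1].
- by move=> [[/(E _ rx).1 h1 h2]|[h1 h2]]; [left|right; split => // /(E _ rx).2].
Qed.

Lemma approximableC A : approximable A -> approximable (~` A).
Proof.
move=> aA e /aA[N [B [mB BN mAB]]]; exists N, (~` B); split => //.
- exact: measurableC.
- by move=> j x y xj yj + By; apply; exact: (BN j y x).
- rewrite (_ : _ `&` _ = hcub a L `&` (A `\` B `|` B `\` A))//; congr (_ `&` _).
  by rewrite setUC !setDE !setCK [~` B `&` _]setIC [B `&` ~` A]setIC.
Qed.

Lemma approximableU A A' : measurable A -> measurable A' ->
  approximable A -> approximable A' -> approximable (A `|` A').
Proof.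
move=> mA mA' aA aA' e e0; have e2 : 0 < e / 2 by rewrite divr_gt0.
have [N [B [mB BN mAB]]] := aA _ e2; have [N' [B' [mB' BN' mAB']]] := aA' _ e2.
exists (maxn N N'), (B `|` B'); split.
- exact: measurableU.
- move=> j x y xj yj [Bx|Bx]; [left|right].
    exact: (invariant_le (leq_maxl _ _) BN) xj yj Bx.
  exact: (invariant_le (leq_maxr _ _) BN') xj yj Bx.
- have m1 C D : measurable C -> measurable D -> measurable (hcub a L `&` (C `\` D `|` D `\` C)).
    by move=> mC mD; apply: measurableI => //; apply: measurableU; exact: measurableD.
  apply: (@le_lt_trans _ _ (mu (hcub a L `&` (A `\` B `|` B `\` A) `|`
                             hcub a L `&` (A' `\` B' `|` B' `\` A')))).
    rewrite le_measure ?inE//.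
    + by apply: m1; exact: measurableU.
    + by apply: measurableU; exact: m1.
    + move=> x [rx [[[Ax|Ax] nB]|[[Bx|Bx] nA]]].
      * by left; split => //; left; split => // Cx; apply: nB; left.
      * by right; split => //; left; split => // Cx; apply: nB; right.
      * by left; split => //; right; split => // Cx; apply: nA; left.
      * by right; split => //; right; split => // Cx; apply: nA; right.
  apply: (le_lt_trans (measureU2 _ _ _)); [exact: m1|exact: m1|].
  by rewrite [e]splitr EFinD lteD.
Qed.

(** Inside the root, which has finite measure, continuity from below replaces the union by a finite
    one up to [e / 2]. *)
Lemma approximable_bigcup (F : nat -> set V) : (forall k, measurable (F k)) ->
  (forall k, approximable (F k)) -> approximable (\bigcup_k F k).
Proof.
move=> mF aF e e0; have e2 : 0 < e / 2 by rewrite divr_gt0.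
pose U m := \big[setU/set0]_(k < m) F k.
have mU m : measurable (U m) by exact: bigsetU_measurable.
have aU m : approximable (U m).
  elim: m => [|m ih]; rewrite /U.
    by rewrite big_ord0; apply: (@invariant_approximable 0%N).
  by rewrite big_ord_recr/=; apply: approximableU => //; exact: mU.
pose S := \bigcup_k F k.
have mS : measurable S by exact: bigcup_measurable.
have : mu (hcub a L `&` U m) @[m --> \oo] --> mu (hcub a L `&` S).
  have -> : hcub a L `&` S = \bigcup_m (hcub a L `&` U m).
    rewrite -setI_bigcupr; congr (_ `&` _); rewrite /S.
    apply/seteqP; split => [x [k _ Fx]|x [m _]].
      by exists k.+1 => //; rewrite /U big_ord_recr/=; right.
    by rewrite /U -bigcup_mkord => -[k _ Fx]; exists k.
  apply: nondecreasing_cvg_mu.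
  - by move=> m; exact: measurableI.
  - by apply: bigcup_measurable => m _; exact: measurableI.
  - by move=> k m km; apply/subsetPset; apply: setIS; exact: subset_bigsetU.
have fr : (mu (hcub a L) < +oo)%E by rewrite mu_hcub// ltry.
have Sfin : mu (hcub a L `&` S) \is a fin_num.
  rewrite ge0_fin_numE// (le_lt_trans _ fr)// le_measure ?inE//.
  exact: measurableI.
rewrite -(fineK Sfin) => /fine_cvgP[_ /cvgrPdist_lt/(_ _ e2)[m _ /(_ m (leqnn _))]] /= H.
have Ufin : mu (hcub a L `&` U m) \is a fin_num.
  rewrite ge0_fin_numE// (le_lt_trans _ fr)// le_measure ?inE//.
  exact: measurableI.
have SU : (mu (hcub a L `&` (S `\` U m)) < (e / 2)%:E)%E.
  rewrite (_ : _ `&` _ = (hcub a L `&` S) `\` (hcub a L `&` U m)); last first.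
    apply/seteqP; split => x /=; first by move=> [rx [Sx Ux]]; split => // -[].
    by move=> [[rx Sx] nU]; split => //; split => // Ux; apply: nU.
  have sub : hcub a L `&` U m `<=` hcub a L `&` S.
    by apply: setIS; rewrite /U -bigcup_mkord => x [k _ Fx]; exists k.
  have -> : (mu ((hcub a L `&` S) `\` (hcub a L `&` U m)) =
      mu (hcub a L `&` S) - mu (hcub a L `&` U m))%E.
    rewrite -[in RHS](setIidr sub); apply: measureD; [exact: measurableI..|].
    by rewrite -ge0_fin_numE.
  rewrite -(fineK Sfin) -(fineK Ufin) -EFinB lte_fin.
  exact: le_lt_trans (ler_norm _) H.
have [N [B [mB BN mAB]]] := aU m _ e2.
exists N, B; split => //.
apply: (@le_lt_trans _ _ (mu (hcub a L `&` (S `\` U m) `|`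
   hcub a L `&` (U m `\` B `|` B `\` U m)))).
  rewrite le_measure ?inE//.
  - by apply: measurableI => //; apply: measurableU; exact: measurableD.
  - apply: measurableU; first by apply: measurableI => //; exact: measurableD.
    by apply: measurableI => //; apply: measurableU; exact: measurableD.
  - move=> x [rx [[Sx nB]|[Bx nS]]].
      have [Ux|nU] := pselect (U m x); last by left.
      by right; split => //; left.
    right; split => //; right; split => // Ux; apply: nS.
    by move: Ux; rewrite /U -bigcup_mkord => -[k _ Fx]; exists k.
apply: (le_lt_trans (measureU2 _ _ _)).
- by apply: measurableI => //; exact: measurableD.
- by apply: measurableI => //; apply: measurableU; exact: measurableD.
- by rewrite [e]splitr EFinD lteD.
Qed.

End dyadic_cells.

(** * Approximation in L^1 by functions constant on cells *)

Section dyadic_approximation.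
Context {R : realType} {n : nat}.
Variables (a : 'rV[R]_n) (L : R).
Hypothesis L0 : 0 < L.
Local Notation V := 'rV[R]_n.
Implicit Types (f g : V -> R).
Local Notation mu := (lebesgue_rV n : {measure set 'rV[R]_n -> \bar R}).
Local Notation cell := (cell a L).
Local Notation approximable := (approximable a L).

(** Inside the root such a set is a countable union, over the generations, of finite unions of
    cells. *)
Lemma approximable_cells (p : forall N, {ffun 'I_n -> 'I_(2 ^ N)} -> bool) (A : set V) :
  (forall x, hcub a L x -> A x <-> exists N j, p N j /\ @cell N j x) ->
  approximable A.
Proof.
move=> HA; pose B N := \big[setU/set0]_(j | p N j) @cell N j.
have BP N x : B N x <-> exists2 j, p N j & @cell N j x.
  rewrite /B -bigcup_seq_cond; split.
    by move=> [j /= /andP[_ pj] xj]; exists j.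
  by move=> [j pj xj]; exists j => //=; rewrite mem_index_enum.
have mB N : measurable (B N).
  by apply: bigsetU_measurable => j _; exact: measurable_cell.
apply: (approximable_eq (A := \bigcup_N B N)).
  apply/seteqP; split => x [rx].
    by move=> [N _ /BP[j pj xj]]; split => //; apply/HA => //; exists N, j.
  by move=> /(HA _ rx)[N [j [pj xj]]]; split => //; exists N => //; apply/BP; exists j.
apply: approximable_bigcup => // N; apply: (@invariant_approximable _ _ _ _ N) => //.
move=> j x y xj yj /BP[k pk xk]; apply/BP; exists j => //.
by rewrite (cell_inj L0 xj xk).
Qed.

Lemma small_cells (d : R) : 0 < d -> exists N, L / 2 ^+ N <= d.
Proof.
move=> d0; exists (Num.truncn (L / d)).+1.
rewrite ler_pdivrMr ?exprn_gt0// mulrC -ler_pdivrMr//.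
apply: (@le_trans _ _ (Num.truncn (L / d)).+1%:R); first by rewrite ltW// truncnS_gt.
by rewrite -natrX ler_nat ltnW// ltn_expl.
Qed.

Lemma cell_coord N j (x : V) i : @cell N j x ->
  a ord0 i + L * (j i)%:R / 2 ^+ N <= x ord0 i < a ord0 i + L * (j i)%:R / 2 ^+ N + L / 2 ^+ N.
Proof. by move=> /(_ i); rewrite mxE. Qed.

(** The strict inequality leaves room for a whole cell of a fine generation around each point. *)
Lemma approximable_lt i c : approximable [set x : V | x ord0 i < c].
Proof.
apply: (@approximable_cells
  (fun N j => a ord0 i + L * (j i)%:R / 2 ^+ N + L / 2 ^+ N <= c)) => x rx /=.
split=> [xc|[N [j [jc /cell_coord-/(_ i)/andP[_ xj]]]]]; last exact: lt_le_trans jc.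
have [N NL] : exists N, L / 2 ^+ N <= c - x ord0 i by apply: small_cells; rewrite subr_gt0.
have [j xj] := cell_ex L0 N rx; exists N, j; split => //.
by have /andP[] := cell_coord i xj; move: NL; lra.
Qed.

Lemma approximable_gt i c : approximable [set x : V | c < x ord0 i].
Proof.
apply: (@approximable_cells
  (fun N j => c < a ord0 i + L * (j i)%:R / 2 ^+ N)) => x rx /=.
split=> [xc|[N [j [jc /cell_coord-/(_ i)/andP[xj _]]]]]; last exact: lt_le_trans xj.
have [N NL] : exists N, L / 2 ^+ N <= x ord0 i - c by apply: small_cells; rewrite subr_gt0.
have [j xj] := cell_ex L0 N rx; exists N, j; split => //.
by have /andP[] := cell_coord i xj; move: NL; lra.
Qed.

Lemma measurable_coord_lt i c : measurable [set x : V | x ord0 i < c].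
Proof.
rewrite (_ : [set _ | _] = setT `&` (fun x : V => x ord0 i) @^-1` `]-oo, c[%classic).
  exact: measurable_coord.
by apply/seteqP; split => x /=; rewrite in_itv /= ?andbT; [|case].
Qed.

Lemma measurable_coord_gt i c : measurable [set x : V | c < x ord0 i].
Proof.
rewrite (_ : [set _ | _] = setT `&` (fun x : V => x ord0 i) @^-1` `]c, +oo[%classic).
  exact: measurable_coord.
by apply/seteqP; split => x /=; rewrite in_itv /= ?andbT; [|case].
Qed.

(** The approximable measurable sets form a sigma-algebra, and it contains the boxes because a box
    is the complement of a finite union of open half-spaces. *)
Lemma measurable_approximable A : measurable A -> approximable A.
Proof.
suff : @measurable _ V `<=` [set A | measurable A /\ approximable A].
  by move=> H /H[].
rewrite [X in X `<=` _]rV_measurable_boxes.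
have ap0 : approximable set0 by apply: (@invariant_approximable _ _ _ _ 0%N).
have SA : sigma_algebra setT [set A : set V | measurable A /\ approximable A].
  split.
  - by split.
  - by move=> B [mB aB]; rewrite setTD; split; [exact: measurableC|exact: approximableC].
  - move=> F H; split; first by apply: bigcup_measurable => k _; exact: (H k).1.
    by apply: approximable_bigcup => // k; [exact: (H k).1|exact: (H k).2].
apply: smallest_sub => // _ [c [e ->]].
pose S i := [set x : V | x ord0 i < c ord0 i] `|` [set x | e ord0 i < x ord0 i].
have -> : box c e = ~` \big[setU/set0]_(i < n) S i.
  rewrite -bigcup_seq; apply/seteqP; split => x /=.
    move=> H [i _ [/=|/=]]; rewrite ltNge; have /andP[h1 h2] := H i; by rewrite ?h1 ?h2.
  move=> H i; rewrite !leNgt; apply/andP; split; apply/negP => h; apply: H.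
    by exists i; [rewrite /= mem_index_enum|left].
  by exists i; [rewrite /= mem_index_enum|right].
have mS i : measurable (S i).
  by apply: measurableU; [exact: measurable_coord_lt|exact: measurable_coord_gt].
have aS i : approximable (S i).
  apply: approximableU => //; [exact: measurable_coord_lt|exact: measurable_coord_gt|
    exact: approximable_lt|exact: approximable_gt].
split; first by apply: measurableC; exact: bigsetU_measurable.
apply: approximableC.
have : measurable (\big[setU/set0]_(i < n) S i) /\ approximable (\big[setU/set0]_(i < n) S i).
  elim: (index_enum _) => [|i s [ms ih]]; first by rewrite big_nil.
  by rewrite big_cons; split; [exact: measurableU|exact: approximableU].
by case.
Qed.

Definition cell_dist (f : V -> R) N (c : {ffun 'I_n -> 'I_(2 ^ N)} -> R) : \bar R :=
  (\sum_j nint mu (fun x => \1_(@cell N j) x * `|f x - c j|)%R)%E.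

(** All sufficiently fine generations must work, so that several functions can be approximated on
    one common generation. *)
Definition cell_limit (f : V -> R) := forall e : R, 0 < e ->
  exists N0, forall N, (N0 <= N)%N -> exists c, (@cell_dist f N c < e%:E)%E.

Lemma cell_limit_indic A : measurable A -> cell_limit \1_A.
Proof.
move=> mA e e0; have [N0 [B [mB BN AB]]] := measurable_approximable mA e0.
exists N0 => N N0N.
have {}BN := invariant_le L0 N0N BN.
(* The constant is 1 on the cells that meet [B]; by invariance these are the cells contained in
   [B]. *)
exists (fun j => `[< exists2 x, @cell N j x & B x >]%:R).
apply: le_lt_trans AB.
pose D := A `\` B `|` B `\` A.
have mD : measurable D by apply: measurableU; exact: measurableD.
have -> : (mu (hcub a L `&` D) = \sum_j nint mu (fun x => \1_(@cell N j) x * \1_D x)%R)%E.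
  rewrite -nint_sum.
  - rewrite -nint_indic; last by apply: measurableI => //; exact: measurable_hcub.
    by apply: eq_nint => x; rewrite -mulr_suml sum_cell// indicI.
  - by move=> j; apply: measurable_funM => //; apply: measurable_indic; exact: measurable_cell.
  - by move=> j x; rewrite mulr_ge0.
apply: lee_sum => j _; rewrite le_eqVlt; apply/orP; left; apply/eqP.
apply: eq_nint => x; rewrite indicE.
have [/set_mem xj|_] := boolP (x \in cell j); last by rewrite !mul0r.
congr (_ * _).
have -> : `[< exists2 x, cell j x & B x >] = `[< B x >].
  by apply: asbool_equiv_eq; split => [[y yj]|]; [exact: BN|exists x].
have -> : `[< B x >] = (x \in B) by apply/asboolP/idP; [exact: mem_set|exact: set_mem].
rewrite !indicE /D in_setU !in_setD.
case: (x \in A); case: (x \in B) => /=.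
- by rewrite subrr normr0.
- by rewrite subr0 normr1.
- by rewrite sub0r normrN1.
- by rewrite subrr normr0.
Qed.

Lemma cell_limitD f g : measurable_fun setT f -> measurable_fun setT g ->
  cell_limit f -> cell_limit g -> cell_limit (fun x => f x + g x).
Proof.
move=> mf mg lf lg e e0; have e2 : 0 < e / 2 by rewrite divr_gt0.
have [N1 h1] := lf _ e2; have [N2 h2] := lg _ e2.
exists (maxn N1 N2) => N; rewrite geq_max => /andP[/h1[c1 d1] /h2[c2 d2]].
exists (fun j => c1 j + c2 j).
have mterm (h : V -> R) N' (j : {ffun 'I_n -> 'I_(2 ^ N')}) (c : R) : measurable_fun setT h ->
    measurable_fun setT (fun x => \1_(cell j) x * `|h x - c|).
  move=> mh; apply: measurable_funM; first by apply: measurable_indic; exact: measurable_cell.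
  by apply: measurableT_comp => //; exact: measurable_funB.
rewrite [e]splitr EFinD; apply: le_lt_trans (lteD d1 d2).
rewrite -big_split/=; apply: lee_sum => j _; rewrite -nintD//; first last.
- exact: mterm.
- exact: mterm.
apply: nint_le => //.
- apply: mterm; exact: measurable_funD.
- by apply: measurable_funD; exact: mterm.
- move=> x; rewrite -mulrDr ler_wpM2l//.
  by rewrite opprD addrACA ler_normD.
Qed.

Lemma cell_limitZ k f : measurable_fun setT f -> cell_limit f -> cell_limit (fun x => k * f x).
Proof.
move=> mf lf e e0; have k0 : 0 < `|k| + 1 by rewrite ltr_wpDl.
have [N0 h0] := lf _ (divr_gt0 e0 k0); exists N0 => N /h0[c dc].
exists (fun j => k * c j).
apply: (@le_lt_trans _ _ (`|k|%:E * cell_dist f c)%E).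
  rewrite /cell_dist ge0_sume_distrr; last first.
    by move=> j _; apply: nint_ge0 => x; rewrite mulr_ge0.
  apply: lee_sum => j _; rewrite -nintZ//; last first.
    apply: measurable_funM; first by apply: measurable_indic; exact: measurable_cell.
    by apply: measurableT_comp => //; exact: measurable_funB.
  rewrite le_eqVlt; apply/orP; left; apply/eqP; apply: eq_nint => x.
  by rewrite -mulrBr normrM mulrCA.
have d0 : (0 <= cell_dist f c)%E.
  by apply: sume_ge0 => j _; apply: nint_ge0 => x; rewrite mulr_ge0.
apply: (@le_lt_trans _ _ ((`|k| + 1)%:E * cell_dist f c)%E).
  by rewrite lee_wpmul2r// lee_fin lerDl.
by rewrite -lte_pdivlMl// -EFinM mulrC.
Qed.

Lemma cell_limit_lim f : measurable_fun setT f ->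
  (forall e, 0 < e -> exists g, [/\ measurable_fun setT g, cell_limit g &
    (nint mu (fun x => \1_(hcub a L) x * `|f x - g x|)%R < e%:E)%E]) -> cell_limit f.
Proof.
move=> mf H e e0; have e2 : 0 < e / 2 by rewrite divr_gt0.
have [g [mg lg fg]] := H _ e2; have [N0 h0] := lg _ e2.
exists N0 => N /h0[c dc]; exists c.
have mterm (h k : V -> R) (j : {ffun 'I_n -> 'I_(2 ^ N)}) : measurable_fun setT h -> measurable_fun setT k ->
    measurable_fun setT (fun x => \1_(cell j) x * `|h x - k x|).
  move=> mh mk; apply: measurable_funM; first by apply: measurable_indic; exact: measurable_cell.
  by apply: measurableT_comp => //; exact: measurable_funB.
rewrite [e]splitr EFinD; apply: le_lt_trans (lteD fg dc).
have -> : nint mu (fun x => \1_(hcub a L) x * `|f x - g x|) =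
    (\sum_j nint mu (fun x => \1_(@cell N j) x * `|f x - g x|)%R)%E.
  rewrite -nint_sum.
  - by apply: eq_nint => x; rewrite -mulr_suml sum_cell.
  - by move=> j; exact: mterm.
  - by move=> j x; rewrite mulr_ge0.
rewrite -big_split/=; apply: lee_sum => j _; rewrite -nintD//; first last.
- exact: mterm.
- exact: mterm.
apply: nint_le => //.
- exact: mterm.
- by apply: measurable_funD; exact: mterm.
- move=> x; rewrite -mulrDr ler_wpM2l//.
  by rewrite (le_trans _ (ler_normD _ _))// subrKA.
Qed.

Import HBSimple.

(** Simple functions are dense in L^1 and are finite combinations of indicators. This serves twice:
    to find a cell where a rough kernel is nearly constant, and to pass to the limit in the dyadic
    bound. *)
Lemma integrable_cell_limit f : measurable_fun setT f ->
  (nint mu (fun x => \1_(hcub a L) x * `|f x|)%R < +oo)%E -> cell_limit f.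
Proof.
move=> mf fi; have mroot := measurable_hcub a L.
have intf : mu.-integrable (hcub a L) (EFin \o f).
  apply/integrableP; split; first by apply/measurable_EFinP; exact: measurable_funTS.
  move: fi; congr (_ < _)%E; rewrite [RHS]integral_mkcond; apply: eq_integral => x _.
  by rewrite patchE indicE; case: (x \in hcub a L); rewrite ?mul1r ?mul0r.
have [g [ig gf gl]] := approximation_sfun_integrable mroot intf.
apply: cell_limit_lim => // e e0.
have /fine_cvgP[fin /cvgrPdist_lt/(_ _ e0) near] := gl.
have [m _ /(_ m (leqnn _))[gfin]] := filterI fin near.
rewrite sub0r normrN => glt; exists (fun x => g m x); split => //.
  have -> : (fun x => g m x) = (fun x => \sum_(y <- finmap.enum_fset (fset_set (range (g m)))) y * \1_(g m @^-1` [set y]) x).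
    by apply/funext => x; rewrite fimfunE fsbig_finite.
  have mi y : measurable_fun setT (fun x => y * \1_(g m @^-1` [set y]) x).
    by apply: measurable_funM.
  elim: (finmap.enum_fset _) => [|y s ih].
    under eq_fun do rewrite big_nil.
    move=> e' e'0; exists 0%N => N _; exists (fun=> 0).
    rewrite /cell_dist big1 ?lte_fin// => j _.
    rewrite (@eq_nint _ _ _ _ _ (fun=> 0)) ?/nint ?integral0// => x.
    by rewrite subrr normr0 mulr0.
  under eq_fun do rewrite big_cons.
  apply: cell_limitD => //; first exact: measurable_sum.
  by apply: cell_limitZ => //; exact: cell_limit_indic.
have -> : nint mu (fun x => \1_(hcub a L) x * `|f x - g m x|) =
    (\int[mu]_(z in hcub a L) `|(f z)%:E - (g m z)%:E|)%E.
  rewrite [RHS]integral_mkcond; apply: eq_integral => x _.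
  by rewrite patchE indicE; case: (x \in hcub a L); rewrite ?mul1r ?mul0r.
rewrite -(fineK gfin) lte_fin.
exact: le_lt_trans (ler_norm _) glt.
Qed.

End dyadic_approximation.

(** * Complex-valued averages *)

Section complex_norm.
Context {R : realType}.
Implicit Types x y z : R[i].
Local Notation Re := complex.Re.
Local Notation Im := complex.Im.

Lemma cReD x y : Re (x + y) = Re x + Re y. Proof. by case: x; case: y. Qed.
Lemma cImD x y : Im (x + y) = Im x + Im y. Proof. by case: x; case: y. Qed.
Lemma cReN x : Re (- x) = - Re x. Proof. by case: x. Qed.
Lemma cImN x : Im (- x) = - Im x. Proof. by case: x. Qed.
Lemma cReM x y : Re (x * y) = Re x * Re y - Im x * Im y. Proof. by case: x; case: y. Qed.
Lemma cImM x y : Im (x * y) = Re x * Im y + Im x * Re y. Proof. by case: x; case: y. Qed.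

Lemma normcE2 x : normc x = Num.sqrt (Re x ^+ 2 + Im x ^+ 2).
Proof. by case: x. Qed.

Lemma normc_ge0' x : 0 <= normc x.
Proof. by rewrite normcE2 sqrtr_ge0. Qed.

Lemma normc_sqr x : normc x ^+ 2 = Re x ^+ 2 + Im x ^+ 2.
Proof. by rewrite normcE2 sqr_sqrtr// addr_ge0 ?sqr_ge0. Qed.

Lemma normRe_le x : `|Re x| <= normc x.
Proof.
rewrite -(@ler_pXn2r _ 2%N) ?nnegrE ?normc_ge0'//.
by rewrite normc_sqr real_normK ?num_real// lerDl sqr_ge0.
Qed.

Lemma normIm_le x : `|Im x| <= normc x.
Proof.
rewrite -(@ler_pXn2r _ 2%N) ?nnegrE ?normc_ge0'//.
by rewrite normc_sqr real_normK ?num_real// lerDr sqr_ge0.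
Qed.

Lemma normc_le_ReIm x : normc x <= `|Re x| + `|Im x|.
Proof.
rewrite -(@ler_pXn2r _ 2%N) ?nnegrE ?normc_ge0' ?addr_ge0//.
rewrite normc_sqr sqrrD !real_normK ?num_real//.
by rewrite -addrA [_ *+ 2 + _]addrC addrA lerDl mulrn_wge0// mulr_ge0.
Qed.

Lemma ler_normc_dist x y z : normc (x - z) <= normc (x - y) + normc (y - z).
Proof. by rewrite -(subrKA y) le_normcD. Qed.

Lemma normc_distC x y : normc (x - y) = normc (y - x).
Proof. by rewrite -normcN opprB. Qed.

Lemma normc_real (t : R) : normc (t%:C)%C = `|t|.
Proof. by rewrite /= expr0n addr0 sqrtr_sqr. Qed.

Lemma ReIm_dot_le x y : Re x * Re y + Im x * Im y <= normc x * normc y.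
Proof.
have E : normc (Complex (Re x) (- Im x)) = normc x by rewrite !normcE2 /= sqrrN.
rewrite -E -normcM (le_trans _ (normRe_le _))// (le_trans _ (ler_norm _))//.
by rewrite cReM /= mulNr opprK.
Qed.

(** The conjugate phase, so that multiplying by it yields the modulus; its value at 0 is 0, since
    division by 0 gives 0. *)
Definition csgn x : R[i] := Complex (Re x / normc x) (- Im x / normc x).

Lemma csgnM x : csgn x * x = (normc x)%:C%C.
Proof.
have [x0|x0] := eqVneq (normc x) 0.
  by rewrite x0 (eq0_normc x0) mulr0.
apply/eqP; rewrite eq_complex cReM cImM /=; apply/andP; split; apply/eqP.
  by have := normc_sqr x; rewrite expr2 => H; apply: (mulIf x0); rewrite H; field.
by field.
Qed.

Lemma normc_csgn_le x : normc (csgn x) <= 1.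
Proof.
have [x0|x0] := eqVneq (normc x) 0.
  by rewrite (eq0_normc x0) normcE2 /= oppr0 !mul0r expr0n/= addr0 sqrtr0.
have : normc (csgn x * x) = normc x by rewrite csgnM normc_real ger0_norm// normc_ge0'.
by rewrite normcM => /eqP; rewrite -subr_eq0 -[X in _ - X]mul1r -mulrBl mulf_eq0 (negbTE x0) orbF subr_eq0 => /eqP ->.
Qed.

End complex_norm.

Section complex_measurable.
Context d (T : measurableType d) (R : realType) (D : set T).
Implicit Types f g : T -> R[i].
Local Notation Re := complex.Re.
Local Notation Im := complex.Im.

Lemma cmeasurable_cst c : cmeasurable_fun D (fun=> c : R[i]).
Proof. by split; exact: measurable_cst. Qed.

Lemma cmeasurable_real (h : T -> R) : measurable_fun D h -> cmeasurable_fun D (fun x => (h x)%:C%C).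
Proof. by move=> mh; split => //=. Qed.

Lemma cmeasurableD f g : cmeasurable_fun D f -> cmeasurable_fun D g ->
  cmeasurable_fun D (fun x => f x + g x).
Proof.
move=> [f1 f2] [g1 g2]; split.
  by under eq_fun do rewrite cReD; exact: measurable_funD.
by under eq_fun do rewrite cImD; exact: measurable_funD.
Qed.

Lemma cmeasurableN f : cmeasurable_fun D f -> cmeasurable_fun D (fun x => - f x).
Proof.
move=> [f1 f2]; split.
  by under eq_fun do rewrite cReN; exact: measurableT_comp.
by under eq_fun do rewrite cImN; exact: measurableT_comp.
Qed.

Lemma cmeasurableB f g : cmeasurable_fun D f -> cmeasurable_fun D g ->
  cmeasurable_fun D (fun x => f x - g x).
Proof. by move=> mf mg; apply: cmeasurableD => //; exact: cmeasurableN. Qed.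

Lemma cmeasurableM f g : cmeasurable_fun D f -> cmeasurable_fun D g ->
  cmeasurable_fun D (fun x => f x * g x).
Proof.
move=> [f1 f2] [g1 g2]; split.
  by under eq_fun do rewrite cReM; apply: measurable_funB; exact: measurable_funM.
by under eq_fun do rewrite cImM; apply: measurable_funD; exact: measurable_funM.
Qed.

Lemma measurable_normc f : cmeasurable_fun D f -> measurable_fun D (fun x => normc (f x)).
Proof.
move=> [f1 f2]; under eq_fun do rewrite normcE2.
apply: (@measurableT_comp _ _ _ _ _ _ (@Num.sqrt R)).
  by apply: continuous_measurable_fun; exact: sqrt_continuous.
by apply: measurable_funD; exact: measurable_funX.
Qed.

Lemma cmeasurable_csgn f : cmeasurable_fun D f -> cmeasurable_fun D (fun x => csgn (f x)).
Proof.
move=> mf; have mi : measurable_fun D (fun x => (normc (f x))^-1).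
  under eq_fun do rewrite -powR_inv1 ?normc_ge0'//.
  by apply: (measurableT_comp (measurable_powR _)); exact: measurable_normc.
case: mf => f1 f2; split => /=; apply: measurable_funM => //.
exact: measurableT_comp.
Qed.

End complex_measurable.

Lemma cmeasurable_comp d1 d2 (T1 : measurableType d1) (T2 : measurableType d2)
    (R : realType) (f : T2 -> R[i]) (h : T1 -> T2) :
  cmeasurable_fun setT f -> measurable_fun setT h -> cmeasurable_fun setT (fun x => f (h x)).
Proof.
move=> [f1 f2] mh; split.
  exact: (measurableT_comp f1 mh).
exact: (measurableT_comp f2 mh).
Qed.

Section complex_average.
Context d (T : measurableType d) (R : realType) (mu : {measure set T -> \bar R}).
Variables (A : set T) (v : R).
Hypotheses (mA : measurable A) (muA : mu A = v%:E) (v0 : 0 < v).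
Implicit Types b h : T -> R[i].
Local Notation Re := complex.Re.
Local Notation Im := complex.Im.

Definition cnint b : \bar R := nint mu (fun x => \1_A x * normc (b x)).

Definition cint_over b : R[i] :=
  Complex (\int[mu]_(x in A) Re (b x))%R (\int[mu]_(x in A) Im (b x))%R.

Definition cavg b : R[i] := (v^-1)%:C%C * cint_over b.

Lemma cnintE b : cnint b = (\int[mu]_(x in A) (normc (b x))%:E)%E.
Proof.
rewrite /cnint [RHS]integral_mkcond; apply: eq_integral => x _.
by rewrite patchE indicE; case: (x \in A); rewrite ?mul1r ?mul0r.
Qed.

Lemma cnint_ge0 b : (0 <= cnint b)%E.
Proof. by apply: nint_ge0 => x; rewrite mulr_ge0 ?normc_ge0'. Qed.

Lemma cnintD b h : cmeasurable_fun setT b -> cmeasurable_fun setT h ->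
  (cnint (fun x => b x + h x)%R <= cnint b + cnint h)%E.
Proof.
move=> mb mh; have mt (k : T -> R[i]) : cmeasurable_fun setT k ->
    measurable_fun setT (fun x => \1_A x * normc (k x)).
  by move=> mk; apply: measurable_funM => //; exact: measurable_normc.
have nt (k : T -> R[i]) x : 0 <= \1_A x * normc (k x) by rewrite mulr_ge0 ?normc_ge0'.
rewrite /cnint -nintD//; [|exact: mt|exact: mt].
apply: nint_le.
- by apply: mt; exact: cmeasurableD.
- by apply: measurable_funD; exact: mt.
- exact: nt.
- by move=> x; rewrite -mulrDr ler_wpM2l// le_normcD.
Qed.

Lemma cnint_cst c : cnint (fun=> c) = (v * normc c)%:E.
Proof.
rewrite /cnint; under eq_nint do rewrite mulrC.
by rewrite nintZ ?normc_ge0'// nint_indic// muA -EFinM mulrC.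
Qed.

Lemma cnintB_lty b c : cmeasurable_fun setT b -> (cnint b < +oo)%E ->
  (cnint (fun x => (b x - c)%R) < +oo)%E.
Proof.
move=> mb fb; apply: (le_lt_trans (cnintD mb (cmeasurable_cst _ (- c)))).
by rewrite cnint_cst lte_add_pinfty// ltry.
Qed.

Lemma cint_integrable b : cmeasurable_fun setT b -> (cnint b < +oo)%E ->
  mu.-integrable A (EFin \o (fun x => Re (b x))) /\
  mu.-integrable A (EFin \o (fun x => Im (b x))).
Proof.
rewrite cnintE => mb fb.
have mn : measurable_fun A (fun x => (normc (b x))%:E).
  by apply/measurable_EFinP; apply: measurable_funTS; exact: measurable_normc.
split; apply/integrableP; split.
- by apply/measurable_EFinP; apply: measurable_funTS; exact: mb.1.
- apply: le_lt_trans fb; apply: ge0_le_integral => //.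
  + apply: measurableT_comp => //; apply/measurable_EFinP.
    by apply: measurable_funTS; exact: mb.1.
  + by move=> x _; rewrite /= lee_fin normRe_le.
- by apply/measurable_EFinP; apply: measurable_funTS; exact: mb.2.
- apply: le_lt_trans fb; apply: ge0_le_integral => //.
  + apply: measurableT_comp => //; apply/measurable_EFinP.
    by apply: measurable_funTS; exact: mb.2.
  + by move=> x _; rewrite /= lee_fin normIm_le.
Qed.

Lemma integrable_cst c : mu.-integrable A (EFin \o (fun=> c : R)).
Proof.
apply/integrableP; split; first exact/measurable_EFinP.
by rewrite /= integral_cst// muA -EFinM ltry.
Qed.

Lemma Rintegral_cstE c : (\int[mu]_(x in A) c)%R = c * v :> R.
Proof. by rewrite Rintegral_cst// muA. Qed.

Lemma cint_overB b c : cmeasurable_fun setT b -> (cnint b < +oo)%E ->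
  cint_over (fun x => b x - c) = (v%:C)%C * (cavg b - c).
Proof.
move=> mb fb; have [i1 i2] := cint_integrable mb fb.
rewrite /cavg mulrBr mulrA -rmorphM/= mulfV ?gt_eqF// mul1r.
apply/eqP; rewrite eq_complex; apply/andP; split; apply/eqP.
  rewrite cReD cReN cReM /= mul0r subr0.
  under eq_Rintegral do rewrite cReD cReN.
  by rewrite RintegralB//; [rewrite Rintegral_cstE mulrC|exact: integrable_cst].
rewrite cImD cImN cImM /= mul0r addr0.
under eq_Rintegral do rewrite cImD cImN.
by rewrite RintegralB//; [rewrite Rintegral_cstE mulrC|exact: integrable_cst].
Qed.

(** Pair [h] with its own integral [z]: [|z|^2] is the integral of the real dot product of [z] and
    [h], which is at most [|z| * |h|] pointwise. *)
Lemma normc_cint_over_le h : cmeasurable_fun setT h -> (cnint h < +oo)%E ->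
  ((normc (cint_over h))%:E <= cnint h)%E.
Proof.
move=> mh fh; have [i1 i2] := cint_integrable mh fh.
set z := cint_over h.
have fin : cnint h \is a fin_num by rewrite ge0_fin_numE// cnint_ge0.
rewrite -(fineK fin) lee_fin.
have [->|z0] := eqVneq (normc z) 0; first by rewrite fine_ge0// cnint_ge0.
have {}z0 : 0 < normc z by rewrite lt_neqAle eq_sym z0 normc_ge0'.
rewrite -(ler_pM2l z0) -expr2 normc_sqr.
have j1 : mu.-integrable A (EFin \o (fun x => Re z * Re (h x))) by exact: (integrableZl mA (Re z) i1).
have j2 : mu.-integrable A (EFin \o (fun x => Im z * Im (h x))) by exact: (integrableZl mA (Im z) i2).
have E : Re z ^+ 2 + Im z ^+ 2 = (\int[mu]_(x in A) (Re z * Re (h x) + Im z * Im (h x)))%R.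
  by rewrite RintegralD// !RintegralZl.
have -> : fine (cnint h) = (\int[mu]_(x in A) normc (h x))%R by rewrite cnintE.
have ni : mu.-integrable A (EFin \o (fun x => normc (h x))).
  apply/integrableP; split.
    by apply/measurable_EFinP; apply: measurable_funTS; exact: measurable_normc.
  move: fh; rewrite cnintE; apply: le_lt_trans; rewrite le_eqVlt; apply/orP; left.
  by apply/eqP; apply: eq_integral => x _; rewrite /= ger0_norm// normc_ge0'.
rewrite E -RintegralZl//; apply: le_Rintegral => //.
- exact: (integrableD mA j1 j2).
- exact: (integrableZl mA (normc z) ni).
by move=> x _; exact: ReIm_dot_le.
Qed.

Lemma cavg_dist_le b c : cmeasurable_fun setT b -> (cnint b < +oo)%E ->
  ((v * normc (cavg b - c))%:E <= cnint (fun x => b x - c)%R)%E.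
Proof.
move=> mb fb; have := @normc_cint_over_le (fun x => b x - c).
rewrite cint_overB// normcM normc_real gtr0_norm//; apply.
  by apply: cmeasurableB => //; exact: cmeasurable_cst.
exact: cnintB_lty.
Qed.

(** The mean is at least half as good as any constant [c], because its distance to [c] is at most
    the average of [|b - c|]. *)
Lemma cavg_osc_le b c : cmeasurable_fun setT b -> (cnint b < +oo)%E ->
  (cnint (fun x => b x - cavg b)%R <= 2%:E * cnint (fun x => b x - c)%R)%E.
Proof.
move=> mb fb.
apply: (@le_trans _ _ (cnint (fun x => (b x - c) + (c - cavg b))%R)).
  by rewrite le_eqVlt; apply/orP; left; apply/eqP; apply: eq_nint => x; rewrite subrKA.
have mbc : cmeasurable_fun setT (fun x => b x - c).
  by apply: cmeasurableB => //; exact: cmeasurable_cst.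
apply: (le_trans (cnintD mbc (cmeasurable_cst _ _))).
rewrite cnint_cst normc_distC.
have fin : cnint (fun x => b x - c) \is a fin_num.
  by rewrite ge0_fin_numE ?cnint_ge0// cnintB_lty.
have := cavg_dist_le c mb fb; rewrite -(fineK fin) -EFinM -EFinD !lee_fin; lra.
Qed.

(** This cancellation removes one of the two terms of [b x - b y] when the other variable is tested
    by a sign. *)
Lemma Rintegral_mean_zero b z : cmeasurable_fun setT b -> (cnint b < +oo)%E ->
  (\int[mu]_(x in A) Re ((b x - cavg b) * z))%R = 0.
Proof.
move=> mb fb; set c := cavg b.
have mbc : cmeasurable_fun setT (fun x => b x - c).
  by apply: cmeasurableB => //; exact: cmeasurable_cst.
have [i1 i2] := cint_integrable mbc (cnintB_lty c mb fb).
have E : cint_over (fun x => b x - c) = 0 by rewrite cint_overB// subrr mulr0.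
under eq_Rintegral do rewrite cReM mulrC [Im _ * _]mulrC.
rewrite RintegralB//; [|exact: (integrableZl mA (Re z) i1)|exact: (integrableZl mA (Im z) i2)].
rewrite !RintegralZl//.
move: E => /eqP; rewrite eq_complex /= => /andP[/eqP -> /eqP ->].
by rewrite !mulr0 subrr.
Qed.

End complex_average.

(** * Lower bounds for the commutator form *)

Lemma Re_realM (R : realType) (t : R) (z : R[i]) :
  complex.Re (t%:C%C * z) = t * complex.Re z.
Proof. by rewrite cReM /= mul0r subr0. Qed.

Section real_fubini.
Context d1 d2 (T1 : measurableType d1) (T2 : measurableType d2) (R : realType).
Variables (m1 : {sigma_finite_measure set T1 -> \bar R}) (m2 : {sigma_finite_measure set T2 -> \bar R}).
Variable G : T1 * T2 -> R.
Hypothesis iG : (m1 \x m2)%E.-integrable setT (EFin \o G).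

(** A real-valued inner integral takes a junk value where the slice is not integrable; integrability
    on the product confines this to a null set. *)
Lemma Rintegral_fubini12 :
  (\int[m1]_x \int[m2]_y G (x, y) = \int[(m1 \x m2)%E]_z G z)%R.
Proof.
rewrite /Rintegral -integral12_prod_meas1//; congr fine.
apply: ae_eq_integral => //.
- apply/measurable_EFinP; apply: measurableT_comp => //.
  exact: (measurable_fubini_F iG).
- exact: (measurable_fubini_F iG).
have := ae_integrable1 iG; apply: filterS => x ix _ /=.
rewrite fineK// /fubini_F; exact: integrable_fin_num.
Qed.

Lemma Rintegral_fubini21 :
  (\int[m2]_y \int[m1]_x G (x, y) = \int[(m1 \x m2)%E]_z G z)%R.
Proof.
rewrite /Rintegral -integral21_prod_meas1//; congr fine.
apply: ae_eq_integral => //.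
- apply/measurable_EFinP; apply: measurableT_comp => //.
  exact: (measurable_fubini_G iG).
- exact: (measurable_fubini_G iG).
have := ae_integrable2 iG; apply: filterS => x ix _ /=.
rewrite fineK// /fubini_G; exact: integrable_fin_num.
Qed.

End real_fubini.

Section tonelli_bounds.
Context d1 d2 (T1 : measurableType d1) (T2 : measurableType d2) (R : realType).
Variables (m1 : {sigma_finite_measure set T1 -> \bar R}) (m2 : {sigma_finite_measure set T2 -> \bar R}).
Variable k : T1 * T2 -> R.
Hypotheses (mk : measurable_fun setT k) (k0 : forall z, 0 <= k z).
Local Notation P := (m1 \x m2)%E.

Lemma nint_prod12_le (u : T1 -> R) (B : R) : measurable_fun setT u -> (forall x, 0 <= u x) ->
  0 <= B -> (forall x, nint m2 (fun y => k (x, y)) <= B%:E)%E ->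
  (nint P (fun z => u z.1 * k z)%R <= B%:E * nint m1 u)%E.
Proof.
move=> mu u0 B0 kB.
have mz : measurable_fun setT (fun z : T1 * T2 => (u z.1 * k z)%:E).
  apply/measurable_EFinP; apply: measurable_funM => //.
  exact: (measurableT_comp mu measurable_fst).
have nz z : (0 <= (u z.1 * k z)%:E)%E by rewrite lee_fin mulr_ge0.
rewrite /nint fubini_tonelli1// -nintZ//; apply: ge0_le_integral => //.
- by move=> x _; apply: integral_ge0.
- exact: (measurable_fun_fubini_tonelli_F _ mz).
- by apply/measurable_EFinP; exact: measurable_funM.
move=> x _; rewrite /fubini_F/=.
have mkx : measurable_fun setT (fun y => k (x, y)).
  by apply: (measurableT_comp mk); exact: pair1_measurable.
rewrite -/(nint m2 (fun y => u x * k (x, y))) nintZ// mulrC EFinM.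
by rewrite lee_wpmul2l// lee_fin.
Qed.

Lemma nint_prod21_le (u : T2 -> R) (B : R) : measurable_fun setT u -> (forall x, 0 <= u x) ->
  0 <= B -> (forall y, nint m1 (fun x => k (x, y)) <= B%:E)%E ->
  (nint P (fun z => u z.2 * k z)%R <= B%:E * nint m2 u)%E.
Proof.
move=> mu u0 B0 kB.
have mz : measurable_fun setT (fun z : T1 * T2 => (u z.2 * k z)%:E).
  apply/measurable_EFinP; apply: measurable_funM => //.
  exact: (measurableT_comp mu measurable_snd).
have nz z : (0 <= (u z.2 * k z)%:E)%E by rewrite lee_fin mulr_ge0.
rewrite /nint fubini_tonelli2// -nintZ//; apply: ge0_le_integral => //.
- by move=> x _; apply: integral_ge0.
- exact: (measurable_fun_fubini_tonelli_G _ mz).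
- by apply/measurable_EFinP; exact: measurable_funM.
move=> y _; rewrite /fubini_G/=.
have mky : measurable_fun setT (fun x => k (x, y)).
  by apply: (measurableT_comp mk); exact: pair2_measurable.
rewrite -/(nint m1 (fun x => u y * k (x, y))) nintZ// mulrC EFinM.
by rewrite lee_wpmul2l// lee_fin.
Qed.

End tonelli_bounds.

Section commutator_lower_bound.
Context {R : realType} {n : nat}.
Local Notation V := 'rV[R]_n.
Local Notation mu := (lebesgue_rV n : {measure set 'rV[R]_n -> \bar R}).
Local Notation P := (lebesgue_rV n \x lebesgue_rV n)%E.
Local Notation Re := complex.Re.
Local Notation Im := complex.Im.
Variables (K : V -> V -> R[i]) (Q Q' : set V) (v delta : R) (K0 : R[i]).
Hypotheses (mQ : measurable Q) (mQ' : measurable Q').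
Hypotheses (muQ : mu Q = v%:E) (muQ' : mu Q' = v%:E) (v0 : 0 < v) (delta0 : 0 <= delta).

(** The first variable is the output variable of the kernel, where g lives, hence [Q'] comes before
    [Q]. *)
Definition rect (z : V * V) : R := \1_Q' z.1 * \1_Q z.2.

Hypothesis mK : cmeasurable_fun setT (fun z : V * V => (rect z)%:C%C * K z.1 z.2).

Definition kerr (z : V * V) : R := rect z * normc (K z.1 z.2 - K0).

(** Marginal bounds replace a pointwise bound because a rough kernel is nearly constant only in the
    mean; both are needed since [b] is evaluated in either variable. *)
Hypothesis kerr1 : forall x, (nint mu (fun y => kerr (x, y)) <= delta%:E)%E.
Hypothesis kerr2 : forall y, (nint mu (fun x => kerr (x, y)) <= delta%:E)%E.

Variable b : V -> R[i].
Hypotheses (mb : cmeasurable_fun setT b) (bQ : (cnint mu Q b < +oo)%E)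
  (bQ' : (cnint mu Q' b < +oo)%E).

Definition osc_over (A : set V) (c : R[i]) : R := fine (cnint mu A (fun x => b x - c)).

Lemma osc_overE c : cnint mu Q (fun x => b x - c) = (osc_over Q c)%:E.
Proof.
by rewrite /osc_over fineK// ge0_fin_numE ?cnint_ge0// (cnintB_lty mQ muQ).
Qed.

Lemma osc_overE' c : cnint mu Q' (fun x => b x - c) = (osc_over Q' c)%:E.
Proof.
by rewrite /osc_over fineK// ge0_fin_numE ?cnint_ge0// (cnintB_lty mQ' muQ').
Qed.

Lemma rect_ge0 z : 0 <= rect z. Proof. by rewrite mulr_ge0. Qed.

Lemma measurable_rect : measurable_fun setT rect.
Proof.
have h' : measurable_fun setT (\1_Q' : V -> R) by exact: measurable_indic.
have h : measurable_fun setT (\1_Q : V -> R) by exact: measurable_indic.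
apply: measurable_funM.
  exact: (measurableT_comp h' measurable_fst).
exact: (measurableT_comp h measurable_snd).
Qed.

Lemma rect_idem z : rect z * rect z = rect z.
Proof. by rewrite /rect !indicE; case: (_ \in Q'); case: (_ \in Q); rewrite ?mul1r ?mulr0 ?mul0r. Qed.

Lemma kerr_ge0 z : 0 <= kerr z. Proof. by rewrite mulr_ge0 ?rect_ge0 ?normc_ge0'. Qed.

Lemma measurable_kerr : measurable_fun setT kerr.
Proof.
rewrite (_ : kerr = fun z => normc ((rect z)%:C%C * K z.1 z.2 + (rect z)%:C%C * - K0)).
  apply: measurable_normc; apply: cmeasurableD => //; apply: cmeasurableM.
    by apply: cmeasurable_real; exact: measurable_rect.
  exact: cmeasurable_cst.
apply/funext => z; rewrite -mulrDr normcM normc_real ger0_norm//.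
exact: rect_ge0.
Qed.

Let mb1 c : measurable_fun setT (fun z : V * V => normc (b z.1 - c)).
Proof.
apply: measurable_normc; apply: cmeasurableB; last exact: cmeasurable_cst.
exact: (cmeasurable_comp mb measurable_fst).
Qed.

Let mb2 c : measurable_fun setT (fun z : V * V => normc (b z.2 - c)).
Proof.
apply: measurable_normc; apply: cmeasurableB; last exact: cmeasurable_cst.
exact: (cmeasurable_comp mb measurable_snd).
Qed.

Definition osc2 (c : R[i]) (z : V * V) : R := normc (b z.1 - c) + normc (b z.2 - c).

Lemma osc2_ge0 c z : 0 <= osc2 c z. Proof. by rewrite addr_ge0 ?normc_ge0'. Qed.

Lemma measurable_osc2 c : measurable_fun setT (osc2 c).
Proof. by apply: measurable_funD; [exact: mb1|exact: mb2]. Qed.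

Let mbi A (mA : measurable A) c : measurable_fun setT (fun x => \1_A x * normc (b x - c)).
Proof.
apply: measurable_funM => //; apply: measurable_normc; apply: cmeasurableB => //.
Qed.

(* Any kernel with bounded marginals, cut off to the rectangle, integrates
   [|b(x)-c| + |b(y)-c|] to at most the marginal bound times the one-variable
   oscillations. *)
Lemma nint_osc2_le (k : V * V -> R) (B c : _) : measurable_fun setT k ->
  (forall z, 0 <= k z) -> (forall z, rect z * k z = k z) -> 0 <= B ->
  (forall x, nint mu (fun y => k (x, y)) <= B%:E)%E ->
  (forall y, nint mu (fun x => k (x, y)) <= B%:E)%E ->
  (nint P (fun z => osc2 c z * k z)%R <= (B * (osc_over Q' c + osc_over Q c))%:E)%E.
Proof.
move=> mk k0 rk B0 k1 k2.
apply: (@le_trans _ _ (nint P (fun z => (\1_Q' z.1 * normc (b z.1 - c)) * k z +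
    (\1_Q z.2 * normc (b z.2 - c)) * k z)%R)).
  rewrite le_eqVlt; apply/orP; left; apply/eqP; apply: eq_nint => z.
  rewrite -(rk z) /osc2 /rect !indicE.
  by case: (_ \in Q'); case: (_ \in Q); rewrite /= ?mul1r ?mulr0 ?mul0r ?mulr0 ?addr0// mulrDl.
rewrite nintD; first last.
- by move=> z; rewrite !mulr_ge0 ?normc_ge0'.
- apply: measurable_funM => //; apply: (measurableT_comp (mbi mQ c)); exact: measurable_snd.
- by move=> z; rewrite !mulr_ge0 ?normc_ge0'.
- apply: measurable_funM => //; apply: (measurableT_comp (mbi mQ' c)); exact: measurable_fst.
rewrite mulrDr EFinD; apply: leeD.
  rewrite EFinM -osc_overE'.
  have u0 x : 0 <= \1_Q' x * normc (b x - c) by rewrite mulr_ge0 ?normc_ge0'.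
  have := nint_prod12_le (lebesgue_rV n) (m2 := lebesgue_rV n) mk k0 (mbi mQ' c) u0 B0 k1.
  exact.
rewrite EFinM -osc_overE.
have u0 x : 0 <= \1_Q x * normc (b x - c) by rewrite mulr_ge0 ?normc_ge0'.
have := nint_prod21_le (m1 := lebesgue_rV n) (lebesgue_rV n) mk k0 (mbi mQ c) u0 B0 k2.
exact.
Qed.

Lemma nint_rect1 x : (nint mu (fun y => rect (x, y)) <= v%:E)%E.
Proof.
rewrite /rect/= nintZ// nint_indic// muQ -EFinM lee_fin.
by rewrite ler_piMl ?(ltW v0)// indicE; case: (_ \in _).
Qed.

Lemma nint_rect2 y : (nint mu (fun x => rect (x, y)) <= v%:E)%E.
Proof.
rewrite /rect/=; under eq_nint do rewrite mulrC.
rewrite nintZ// nint_indic// muQ' -EFinM lee_fin.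
by rewrite ler_piMl ?(ltW v0)// indicE; case: (_ \in _).
Qed.

Section test_functions.
Variables (phi psi : V -> R[i]).
Hypotheses (mphi : cmeasurable_fun setT phi) (mpsi : cmeasurable_fun setT psi).
Hypotheses (phiQ : forall y, normc (phi y) <= \1_Q y) (psiQ' : forall x, normc (psi x) <= \1_Q' x).

Definition form_integrand (k : V * V -> R[i]) (z : V * V) : R :=
  Re ((b z.1 - b z.2) * k z * phi z.2 * psi z.1).

(** The test functions vanish off [Q] and [Q'], so the kernel may be cut off to the rectangle, where
    its measurability is known. *)
Lemma form_cutoff (k : V * V -> R[i]) z :
  form_integrand (fun z => (rect z)%:C%C * k z) z = form_integrand k z.
Proof.
have cut (A : set V) (f : V -> R[i]) (x : V) : normc (f x) <= \1_A x ->
    (\1_A x : R)%:C%C * f x = f x.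
  rewrite indicE; case: (_ \in A) => /=; first by rewrite mul1r.
  move=> fx; rewrite (_ : f x = 0) ?mulr0//; apply: eq0_normc; apply/eqP.
  by rewrite eq_le fx normc_ge0'.
rewrite /form_integrand /rect rmorphM/=.
rewrite -[in RHS](cut _ _ _ (phiQ z.2)) -[in RHS](cut _ _ _ (psiQ' z.1)).
by congr Re; ring.
Qed.

Lemma form_integrand_le (k : V * V -> R[i]) c z :
  `|form_integrand k z| <= osc2 c z * (rect z * normc (k z)).
Proof.
rewrite (le_trans (normRe_le _))// !normcM.
have o2 : normc (b z.1 - b z.2) <= osc2 c z.
  by rewrite (le_trans (ler_normc_dist _ c _))// /osc2 (normc_distC c).
have pp : normc (phi z.2) * normc (psi z.1) <= rect z.
  by rewrite mulrC; apply: ler_pM; rewrite ?normc_ge0'.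
rewrite -[leLHS]mulrA -[leLHS]mulrA; apply: (ler_pM (normc_ge0' _) _ o2).
  by rewrite !mulr_ge0 ?normc_ge0'.
by rewrite [leRHS]mulrC ler_wpM2l ?normc_ge0'.
Qed.

Let mbb : cmeasurable_fun setT (fun z : V * V => b z.1 - b z.2).
Proof.
apply: cmeasurableB.
  exact: (cmeasurable_comp mb measurable_fst).
exact: (cmeasurable_comp mb measurable_snd).
Qed.

Lemma measurable_form_integrand (k : V * V -> R[i]) :
  cmeasurable_fun setT (fun z => (rect z)%:C%C * k z) ->
  measurable_fun setT (form_integrand k).
Proof.
move=> mk; rewrite (_ : form_integrand k =
    form_integrand (fun z => (rect z)%:C%C * k z)); last first.
  by apply/funext => z; rewrite form_cutoff.
have : cmeasurable_fun setT (fun z => (b z.1 - b z.2) * ((rect z)%:C%C * k z) * phi z.2 * psi z.1).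
  apply: cmeasurableM; last exact: (cmeasurable_comp mpsi measurable_fst).
  apply: cmeasurableM; last exact: (cmeasurable_comp mphi measurable_snd).
  exact: cmeasurableM.
by case.
Qed.

Let mrect0 : cmeasurable_fun setT (fun z => (rect z)%:C%C * K0).
Proof.
apply: cmeasurableM; last exact: cmeasurable_cst.
by apply: cmeasurable_real; exact: measurable_rect.
Qed.

Lemma nint_err_le c :
  (nint P (fun z => osc2 c z * kerr z)%R <= (delta * (osc_over Q' c + osc_over Q c))%:E)%E.
Proof.
apply: nint_osc2_le => //.
- exact: measurable_kerr.
- exact: kerr_ge0.
- by move=> z; rewrite /kerr mulrA rect_idem.
Qed.

Lemma nint_rect_le c :
  (nint P (fun z => osc2 c z * rect z)%R <= (v * (osc_over Q' c + osc_over Q c))%:E)%E.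
Proof.
apply: nint_osc2_le => //.
- exact: measurable_rect.
- exact: rect_ge0.
- exact: rect_idem.
- exact: ltW.
- exact: nint_rect1.
- exact: nint_rect2.
Qed.

Lemma integrable_dom (h g : V * V -> R) : measurable_fun setT h -> measurable_fun setT g ->
  (forall z, `|h z| <= g z) -> (nint P g < +oo)%E -> P.-integrable setT (EFin \o h).
Proof.
move=> mh mg hg gfin; apply/integrableP; split; first exact/measurable_EFinP.
apply: le_lt_trans gfin; apply: ge0_le_integral => //.
- by apply: measurableT_comp => //; exact/measurable_EFinP.
- exact/measurable_EFinP.
- by move=> z _; rewrite /= lee_fin.
Qed.

Lemma nint_dom_lty c :
  (nint P (fun z => osc2 c z * kerr z + normc K0 * (osc2 c z * rect z))%R < +oo)%E.
Proof.
have m1 : measurable_fun setT (fun z => osc2 c z * kerr z).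
  by apply: measurable_funM; [exact: measurable_osc2|exact: measurable_kerr].
have m2 : measurable_fun setT (fun z => osc2 c z * rect z).
  by apply: measurable_funM; [exact: measurable_osc2|exact: measurable_rect].
have n1 z : 0 <= osc2 c z * kerr z by rewrite mulr_ge0 ?osc2_ge0 ?kerr_ge0.
have n2 z : 0 <= osc2 c z * rect z by rewrite mulr_ge0 ?osc2_ge0 ?rect_ge0.
rewrite nintD//; first last.
- by move=> z; rewrite mulr_ge0 ?normc_ge0'.
- exact: measurable_funM.
rewrite nintZ ?normc_ge0'// lte_add_pinfty//.
  exact: le_lt_trans (nint_err_le c) (ltry _).
have nf : nint P (fun z => osc2 c z * rect z) \is a fin_num.
  rewrite ge0_fin_numE; last exact: nint_ge0.
  exact: le_lt_trans (nint_rect_le c) (ltry _).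
by rewrite -(fineK nf) -EFinM ltry.
Qed.

Lemma integrable_form_dom (h : V * V -> R) c : measurable_fun setT h ->
  (forall z, `|h z| <= normc K0 * (osc2 c z * rect z)) -> P.-integrable setT (EFin \o h).
Proof.
move=> mh hb.
apply: (integrable_dom mh _ _ (nint_dom_lty c)).
  apply: measurable_funD.
    by apply: measurable_funM; [exact: measurable_osc2|exact: measurable_kerr].
  apply: measurable_funM => //.
  by apply: measurable_funM; [exact: measurable_osc2|exact: measurable_rect].
by move=> z; rewrite (le_trans (hb z))// lerDr mulr_ge0 ?osc2_ge0 ?kerr_ge0.
Qed.

(** On the rectangle [|K| <= |K - K0| + |K0|], and each part has bounded marginals; local
    integrability of [b] then suffices for Fubini's theorem. *)
Lemma integrable_form : P.-integrable setT
  (EFin \o form_integrand (fun z => K z.1 z.2)).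
Proof.
apply: (integrable_dom _ _ _ (nint_dom_lty 0)).
- exact: measurable_form_integrand.
- apply: measurable_funD.
    by apply: measurable_funM; [exact: measurable_osc2|exact: measurable_kerr].
  apply: measurable_funM => //.
  by apply: measurable_funM; [exact: measurable_osc2|exact: measurable_rect].
- move=> z; rewrite (le_trans (form_integrand_le _ 0 z))//.
  rewrite [X in _ + X]mulrCA -mulrDr ler_wpM2l ?osc2_ge0// /kerr.
  rewrite [normc K0 * _]mulrC -mulrDr ler_wpM2l ?rect_ge0//.
  by rewrite -{1}[K z.1 z.2](subrK K0) le_normcD.
Qed.

Lemma integrable_form0 : P.-integrable setT (EFin \o form_integrand (fun=> K0)).
Proof.
apply: (integrable_form_dom (c := 0)).
  exact: measurable_form_integrand.
move=> z; rewrite (le_trans (form_integrand_le _ 0 z))//.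
by rewrite mulrA mulrC.
Qed.

Lemma Re_commutator_form : Re (commutator_form b K phi psi) =
  (\int[P]_z form_integrand (fun z => K z.1 z.2) z)%R.
Proof. by rewrite -(Rintegral_fubini12 (integrable_form)). Qed.

Lemma Re_commutator_formZ (s t : R) :
  Re (commutator_form b K (fun y => s%:C%C * phi y) (fun x => t%:C%C * psi x)) =
  s * t * Re (commutator_form b K phi psi).
Proof.
rewrite [X in _ = _ * X]Re_commutator_form.
have iZ : P.-integrable setT (EFin \o (fun z => s * t * form_integrand (fun z => K z.1 z.2) z)).
  exact: (integrableZl measurableT (s * t) integrable_form).
rewrite -[RHS](RintegralZl _ measurableT integrable_form) -(Rintegral_fubini12 iZ) /=.
apply: eq_Rintegral => x _; apply: eq_Rintegral => y _.
rewrite /form_integrand /= -Re_realM rmorphM/=; congr Re; ring.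
Qed.

(** Replacing the kernel by [K0] costs the integral of [|b x - b y| * kerr]; inserting any constant
    [c] bounds this by the marginals and the one-variable oscillations. *)
Lemma commutator_form_ge c :
  (\int[P]_z form_integrand (fun=> K0) z)%R - delta * (osc_over Q' c + osc_over Q c) <=
  Re (commutator_form b K phi psi).
Proof.
rewrite Re_commutator_form lerBlDr.
have m1 : measurable_fun setT (fun z => osc2 c z * kerr z).
  by apply: measurable_funM; [exact: measurable_osc2|exact: measurable_kerr].
have n1 z : 0 <= osc2 c z * kerr z by rewrite mulr_ge0 ?osc2_ge0 ?kerr_ge0.
have iN : P.-integrable setT (EFin \o (fun z => osc2 c z * kerr z)).
  apply: (integrable_dom m1 m1).
    by move=> z; rewrite ger0_norm.
  exact: le_lt_trans (nint_err_le c) (ltry _).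
apply: (@le_trans _ _ (\int[P]_z (form_integrand (fun z => K z.1 z.2) z + osc2 c z * kerr z))%R).
  apply: le_Rintegral => //.
  - exact: integrable_form0.
  - exact: (integrableD measurableT integrable_form iN).
  move=> z _; rewrite -lerBlDl (le_trans (ler_norm _))//.
  have -> : form_integrand (fun=> K0) z - form_integrand (fun z => K z.1 z.2) z =
      form_integrand (fun z => K0 - K z.1 z.2) z.
    by rewrite /form_integrand -cReN -cReD; congr Re; ring.
  by rewrite (le_trans (form_integrand_le _ c z))// normc_distC.
rewrite (RintegralD measurableT integrable_form iN) lerD2l.
have fin : nint P (fun z => osc2 c z * kerr z) \is a fin_num.
  rewrite ge0_fin_numE; last exact: nint_ge0.
  exact: le_lt_trans (nint_err_le c) (ltry _).
by rewrite -lee_fin /Rintegral fineK//; exact: nint_err_le.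
Qed.

End test_functions.

Let mindic A : measurable A -> measurable_fun setT (\1_A : V -> R).
Proof. exact: measurable_indic. Qed.

Let int_indic A : measurable A -> mu A = v%:E -> mu.-integrable setT (EFin \o (\1_A : V -> R)).
Proof.
move=> mA muA; apply/integrableP; split; first by apply/measurable_EFinP; exact: mindic.
under eq_integral do rewrite /= ger0_norm//.
by rewrite integral_indic// setIT muA ltry.
Qed.

Let Rint_indic A : measurable A -> mu A = v%:E -> (\int[mu]_x (\1_A x : R))%R = v.
Proof. by move=> mA muA; rewrite /Rintegral integral_indic// setIT muA. Qed.

Let int_osc A c : measurable A -> mu A = v%:E -> (cnint mu A b < +oo)%E ->
  mu.-integrable setT (EFin \o (fun x => \1_A x * normc (b x - c))).
Proof.
move=> mA muA bA; apply/integrableP; split; first by apply/measurable_EFinP; exact: mbi.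
apply: le_lt_trans (cnintB_lty mA muA c mb bA).
by under eq_integral do rewrite /= ger0_norm ?mulr_ge0 ?normc_ge0'//.
Qed.

Let Rint_mean_zero A z : measurable A -> mu A = v%:E -> (cnint mu A b < +oo)%E ->
  (\int[mu]_x (\1_A x * Re ((b x - cavg mu A v b) * z)))%R = 0.
Proof.
move=> mA muA bA; rewrite -(Rintegral_mean_zero mA muA v0 z mb bA) [RHS]Rintegral_mkcond.
apply: eq_Rintegral => x _; rewrite patchE indicE.
by case: (x \in A); rewrite ?mul1r ?mul0r.
Qed.

(** The factor [csgn K0] removes the phase of the kernel constant along with that of [b x - c]. *)
Definition test_sgn A c x : R[i] := (\1_A x : R)%:C%C * (csgn (b x - c) * csgn K0).

Lemma cmeasurable_test_sgn A c : measurable A -> cmeasurable_fun setT (test_sgn A c).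
Proof.
move=> mA; apply: cmeasurableM; first by apply: cmeasurable_real; exact: mindic.
apply: cmeasurableM; last exact: cmeasurable_cst.
apply: cmeasurable_csgn; apply: cmeasurableB => //; exact: cmeasurable_cst.
Qed.

Lemma normc_test_sgn_le A c x : normc (test_sgn A c x) <= \1_A x.
Proof.
rewrite normcM normc_real ger0_norm// ler_piMr// normcM.
by rewrite mulr_ile1 ?normc_ge0' ?normc_csgn_le.
Qed.

Lemma normc_indic_le (A : set V) (x : V) : normc ((\1_A x : R)%:C%C) <= \1_A x.
Proof. by rewrite normc_real ger0_norm. Qed.

Lemma cmeasurable_cindic A : measurable A -> cmeasurable_fun setT (fun x : V => (\1_A x : R)%:C%C).
Proof. by move=> mA; apply: cmeasurable_real; exact: mindic. Qed.

Lemma test_sgnE A c x : (b x - c) * K0 * test_sgn A c x =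
  (\1_A x * (normc K0 * normc (b x - c)))%:C%C.
Proof.
rewrite /test_sgn rmorphM/= rmorphM/= -!csgnM; ring.
Qed.

(** Write [b x - b y = (b x - c) - (b y - c)]. As [c] is the mean over [Q'], where the test function
    is constant, the first term ([Gb]) integrates to 0 in x. The second ([Ga]) becomes
    [|K0| * |b y - c|] through the sign; the minus sign of the test function cancels the one in
    front of it. *)
Lemma form_first_osc (c := cavg mu Q' v b) :
  normc K0 * v * osc_over Q c - delta * (osc_over Q' c + osc_over Q c) <=
  Re (commutator_form b K (fun y => - test_sgn Q c y) (fun x => (\1_Q' x : R)%:C%C)).
Proof.
have mphi : cmeasurable_fun setT (fun y => - test_sgn Q c y).
  by apply: cmeasurableN; exact: cmeasurable_test_sgn.
have phiQ y : normc (- test_sgn Q c y) <= \1_Q y by rewrite normcN normc_test_sgn_le.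
have mpsi := cmeasurable_cindic mQ'.
have psiQ' := normc_indic_le Q'.
apply: le_trans (commutator_form_ge mphi mpsi phiQ psiQ' c).
rewrite lerB// le_eqVlt; apply/orP; left; apply/eqP.
pose Ga (z : V * V) := rect z * (normc K0 * normc (b z.2 - c)).
pose Gb (z : V * V) := \1_Q' z.1 * Re ((b z.1 - c) * (K0 * - test_sgn Q c z.2)).
have mGa : measurable_fun setT Ga.
  apply: measurable_funM; first exact: measurable_rect.
  by apply: measurable_funM => //; exact: mb2.
have mGb : measurable_fun setT Gb.
  apply: measurable_funM; first exact: (measurableT_comp (mindic mQ') measurable_fst).
  have : cmeasurable_fun setT (fun z : V * V => (b z.1 - c) * (K0 * - test_sgn Q c z.2)).
    apply: cmeasurableM.
      apply: cmeasurableB; last exact: cmeasurable_cst.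
      exact: (cmeasurable_comp mb measurable_fst).
    apply: cmeasurableM; first exact: cmeasurable_cst.
    exact: (cmeasurable_comp mphi measurable_snd).
  by case.
have iGa : P.-integrable setT (EFin \o Ga).
  apply: (integrable_form_dom (c := c) mGa) => z.
  rewrite ger0_norm ?mulr_ge0 ?rect_ge0 ?normc_ge0'//.
  rewrite /Ga mulrCA ler_wpM2l ?normc_ge0'// mulrC ler_wpM2r ?rect_ge0//.
  by rewrite /osc2 lerDr normc_ge0'.
have iGb : P.-integrable setT (EFin \o Gb).
  apply: (integrable_form_dom (c := c) mGb) => z.
  rewrite normrM ger0_norm// (@le_trans _ _ (\1_Q' z.1 * (normc (b z.1 - c) * (normc K0 * \1_Q z.2))))//.
    rewrite ler_wpM2l// (le_trans (normRe_le _))// !normcM ler_wpM2l ?normc_ge0'//.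
    by rewrite ler_wpM2l ?normc_ge0'.
  rewrite [leLHS](_ : _ = normc K0 * (normc (b z.1 - c) * rect z)); last by rewrite /rect; ring.
  rewrite ler_wpM2l ?normc_ge0'// ler_wpM2r ?rect_ge0//.
  by rewrite /osc2 lerDl normc_ge0'.
have -> : (\int[P]_z form_integrand (fun y => - test_sgn Q c y)
    (fun x => (\1_Q' x : R)%:C%C) (fun=> K0) z = \int[P]_z (Ga z + Gb z))%R.
  apply: eq_Rintegral => z _; rewrite /form_integrand /Ga /Gb.
  have -> : (b z.1 - b z.2) * K0 * - test_sgn Q c z.2 * (\1_Q' z.1 : R)%:C%C =
     (\1_Q' z.1 : R)%:C%C * ((b z.2 - c) * K0 * test_sgn Q c z.2) +
     (\1_Q' z.1 : R)%:C%C * ((b z.1 - c) * (K0 * - test_sgn Q c z.2)) by ring.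
  by rewrite test_sgnE cReD !Re_realM /= /rect; congr (_ + _); rewrite mulrA.
rewrite (RintegralD measurableT iGa iGb).
have -> : (\int[P]_z Gb z = 0)%R.
  rewrite -(Rintegral_fubini21 iGb).
  under eq_Rintegral do rewrite /Gb/= Rint_mean_zero//.
  by rewrite Rintegral_cst// mul0r.
rewrite addr0 -(Rintegral_fubini12 iGa).
have inner x : (\int[mu]_y Ga (x, y) = (normc K0 * osc_over Q c) * \1_Q' x)%R.
  have -> : osc_over Q c = (\int[mu]_y (\1_Q y * normc (b y - c)))%R by [].
  rewrite mulrAC -RintegralZl//; last exact: int_osc.
  by apply: eq_Rintegral => y _; rewrite /Ga /rect/=; ring.
under eq_Rintegral do rewrite inner.
rewrite RintegralZl//; last exact: int_indic.
by rewrite Rint_indic//; ring.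
Qed.

(** With the roles of the cubes exchanged, the term in [b y - c] is the one with mean zero. *)
Lemma form_second_osc (c := cavg mu Q v b) :
  normc K0 * v * osc_over Q' c - delta * (osc_over Q' c + osc_over Q c) <=
  Re (commutator_form b K (fun y => (\1_Q y : R)%:C%C) (test_sgn Q' c)).
Proof.
have mpsi : cmeasurable_fun setT (test_sgn Q' c) by exact: cmeasurable_test_sgn.
have psiQ' := normc_test_sgn_le Q' c.
have mphi := cmeasurable_cindic mQ.
have phiQ := normc_indic_le Q.
apply: le_trans (commutator_form_ge mphi mpsi phiQ psiQ' c).
rewrite lerB// le_eqVlt; apply/orP; left; apply/eqP.
pose Ga (z : V * V) := rect z * (normc K0 * normc (b z.1 - c)).
pose Gb (z : V * V) := \1_Q z.2 * Re ((b z.2 - c) * (K0 * - test_sgn Q' c z.1)).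
have mGa : measurable_fun setT Ga.
  apply: measurable_funM; first exact: measurable_rect.
  by apply: measurable_funM => //; exact: mb1.
have mGb : measurable_fun setT Gb.
  apply: measurable_funM; first exact: (measurableT_comp (mindic mQ) measurable_snd).
  have : cmeasurable_fun setT (fun z : V * V => (b z.2 - c) * (K0 * - test_sgn Q' c z.1)).
    apply: cmeasurableM.
      apply: cmeasurableB; last exact: cmeasurable_cst.
      exact: (cmeasurable_comp mb measurable_snd).
    apply: cmeasurableM; first exact: cmeasurable_cst.
    by apply: cmeasurableN; exact: (cmeasurable_comp mpsi measurable_fst).
  by case.
have iGa : P.-integrable setT (EFin \o Ga).
  apply: (integrable_form_dom (c := c) mGa) => z.
  rewrite ger0_norm ?mulr_ge0 ?rect_ge0 ?normc_ge0'//.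
  rewrite /Ga mulrCA ler_wpM2l ?normc_ge0'// mulrC ler_wpM2r ?rect_ge0//.
  by rewrite /osc2 lerDl normc_ge0'.
have iGb : P.-integrable setT (EFin \o Gb).
  apply: (integrable_form_dom (c := c) mGb) => z.
  rewrite normrM ger0_norm// (@le_trans _ _ (\1_Q z.2 * (normc (b z.2 - c) * (normc K0 * \1_Q' z.1))))//.
    rewrite ler_wpM2l// (le_trans (normRe_le _))// !normcM ler_wpM2l ?normc_ge0'//.
    by rewrite normcN ler_wpM2l ?normc_ge0'.
  rewrite [leLHS](_ : _ = normc K0 * (normc (b z.2 - c) * rect z)); last by rewrite /rect; ring.
  rewrite ler_wpM2l ?normc_ge0'// ler_wpM2r ?rect_ge0//.
  by rewrite /osc2 lerDr normc_ge0'.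
have -> : (\int[P]_z form_integrand (fun y => (\1_Q y : R)%:C%C)
    (test_sgn Q' c) (fun=> K0) z = \int[P]_z (Ga z + Gb z))%R.
  apply: eq_Rintegral => z _; rewrite /form_integrand /Ga /Gb.
  have -> : (b z.1 - b z.2) * K0 * (\1_Q z.2 : R)%:C%C * test_sgn Q' c z.1 =
     (\1_Q z.2 : R)%:C%C * ((b z.1 - c) * K0 * test_sgn Q' c z.1) +
     (\1_Q z.2 : R)%:C%C * ((b z.2 - c) * (K0 * - test_sgn Q' c z.1)) by ring.
  by rewrite test_sgnE cReD !Re_realM /= /rect; congr (_ + _); ring.
rewrite (RintegralD measurableT iGa iGb).
have -> : (\int[P]_z Gb z = 0)%R.
  rewrite -(Rintegral_fubini12 iGb).
  under eq_Rintegral do rewrite /Gb/= Rint_mean_zero//.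
  by rewrite Rintegral_cst// mul0r.
rewrite addr0 -(Rintegral_fubini21 iGa).
have inner y : (\int[mu]_x Ga (x, y) = (normc K0 * osc_over Q' c) * \1_Q y)%R.
  have -> : osc_over Q' c = (\int[mu]_x (\1_Q' x * normc (b x - c)))%R by [].
  rewrite mulrAC -RintegralZl//; last exact: int_osc.
  by apply: eq_Rintegral => x _; rewrite /Ga /rect/=; ring.
under eq_Rintegral do rewrite inner.
rewrite RintegralZl//; last exact: int_indic.
by rewrite Rint_indic//; ring.
Qed.

End commutator_lower_bound.

(** * Pairs of cubes on which the kernel is nearly constant *)

Section euclidean_norm.
Context {R : realType} {n : nat}.
Implicit Types (x y z a b : 'rV[R]_n) (l t : R).

Lemma enorm_ge0 x : 0 <= enorm x. Proof. exact: sqrtr_ge0. Qed.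

Lemma enorm_sqr x : enorm x ^+ 2 = \sum_i x ord0 i ^+ 2.
Proof. by rewrite sqr_sqrtr// sumr_ge0// => i _; rewrite sqr_ge0. Qed.

Lemma enorm0 : enorm (0 : 'rV[R]_n) = 0.
Proof. by rewrite /enorm big1 ?sqrtr0// => i _; rewrite mxE expr0n. Qed.

Lemma enorm_eq0 x : enorm x = 0 -> x = 0.
Proof.
move=> x0; have := enorm_sqr x; rewrite x0 expr0n/= => /esym/eqP.
rewrite psumr_eq0; last by move=> i _; rewrite sqr_ge0.
move=> /allP H; apply/rowP => i; have := H i; rewrite mem_index_enum => /(_ isT)/=.
by rewrite sqrf_eq0 => /eqP ->; rewrite mxE.
Qed.

Lemma enorm_gt0 x : x <> 0 -> 0 < enorm x.
Proof.
move=> x0; rewrite lt_neqAle enorm_ge0 andbT eq_sym.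
by apply/eqP => /enorm_eq0.
Qed.

Lemma enormZ t x : enorm (t *: x) = `|t| * enorm x.
Proof.
rewrite /enorm; under eq_bigr do rewrite mxE exprMn.
by rewrite -mulr_sumr sqrtrM ?sqr_ge0// sqrtr_sqr.
Qed.

Lemma enormN x : enorm (- x) = enorm x.
Proof. by rewrite -scaleN1r enormZ normrN1 mul1r. Qed.

Lemma enormB x y : enorm (x - y) = enorm (y - x).
Proof. by rewrite -enormN opprB. Qed.

(** Both vectors are normalized and [2st <= s^2 + t^2] is applied coordinatewise. *)
Lemma dot_le_enorm x y : \sum_i x ord0 i * y ord0 i <= enorm x * enorm y.
Proof.
have [->|/eqP/enorm_gt0 x0] := eqVneq x 0.
  by rewrite enorm0 mul0r big1// => i _; rewrite mxE mul0r.
have [->|/eqP/enorm_gt0 y0] := eqVneq y 0.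
  by rewrite enorm0 mulr0 big1// => i _; rewrite mxE mulr0.
set A := enorm x; set B := enorm y.
apply: (@le_trans _ _ (\sum_i (A * B / 2 * (A^-1 ^+ 2 * x ord0 i ^+ 2 + B^-1 ^+ 2 * y ord0 i ^+ 2)))).
  apply: ler_sum => i _; rewrite -subr_ge0.
  have -> : A * B / 2 * (A^-1 ^+ 2 * x ord0 i ^+ 2 + B^-1 ^+ 2 * y ord0 i ^+ 2) - x ord0 i * y ord0 i
     = A * B / 2 * (A^-1 * x ord0 i - B^-1 * y ord0 i) ^+ 2.
    by field; rewrite !gt_eqF.
  by rewrite mulr_ge0 ?sqr_ge0// divr_ge0// mulr_ge0// ltW.
rewrite -mulr_sumr big_split/= -!mulr_sumr -!enorm_sqr -/A -/B.
rewrite le_eqVlt; apply/orP; left; apply/eqP; field.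
by rewrite !gt_eqF.
Qed.

Lemma enormD x y : enorm (x + y) <= enorm x + enorm y.
Proof.
rewrite -(@ler_pXn2r _ 2%N) ?nnegrE ?addr_ge0 ?enorm_ge0//.
rewrite sqrrD !enorm_sqr.
have -> : \sum_i (x + y) ord0 i ^+ 2 = \sum_i x ord0 i ^+ 2 +
    (\sum_i x ord0 i * y ord0 i) *+ 2 + \sum_i y ord0 i ^+ 2.
  rewrite -sumrMnl -!big_split/=; apply: eq_bigr => i _.
  by rewrite mxE sqrrD.
by rewrite lerD2r lerD2l lerMn2r dot_le_enorm.
Qed.

Lemma enorm_dist x y z : enorm (x - z) <= enorm (x - y) + enorm (y - z).
Proof. by rewrite -(subrKA y) enormD. Qed.

Lemma coord_le_enorm x i : `|x ord0 i| <= enorm x.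
Proof.
rewrite -(@ler_pXn2r _ 2%N) ?nnegrE ?enorm_ge0//.
rewrite enorm_sqr real_normK ?num_real// (bigD1 i)//= lerDl.
by apply: sumr_ge0 => j _; rewrite sqr_ge0.
Qed.

Lemma enorm_le_sum_norm x : enorm x <= sum_norm x.
Proof.
have S0 : 0 <= sum_norm x by apply: sumr_ge0.
rewrite -(@ler_pXn2r _ 2%N) ?nnegrE ?enorm_ge0//.
rewrite enorm_sqr expr2 {1}/sum_norm mulr_suml; apply: ler_sum => i _.
by rewrite -real_normK ?num_real// expr2 ler_wpM2l// le_sum_norm.
Qed.

Lemma enorm_le_const x t : (forall i, `|x ord0 i| <= t) -> enorm x <= n%:R * t.
Proof.
move=> H; rewrite (le_trans (enorm_le_sum_norm x))// /sum_norm.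
rewrite (le_trans (ler_sum _ (fun i _ => H i)))//.
by rewrite sumr_const card_ord mulr_natl.
Qed.

Lemma cub_dist a l x y : cub a l x -> cub a l y -> enorm (x - y) <= n%:R * l.
Proof.
move=> ax ay; apply: enorm_le_const => i; rewrite !mxE ler_norml.
by have := ax i; have := ay i; lra.
Qed.

Lemma cub_corner a l : 0 <= l -> cub a l a.
Proof. by move=> l0 i; rewrite lexx lerDl. Qed.

Lemma is_cube_cub a l : 0 < l -> is_cube (cub a l).
Proof. by move=> l0; exists a, l. Qed.

Lemma diam_cub_le a l : 0 < l -> diam (cub a l) <= n%:R * l.
Proof.
move=> l0; apply: ge_sup.
  by exists (enorm (a - a)), (a, a) => //=; split; apply: cub_corner; exact: ltW.
by move=> _ [[x y] [/= ax ay] <-]; exact: cub_dist ax ay.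
Qed.

Lemma diam_cub_eq a b l : diam (cub a l) = diam (cub b l).
Proof.
suff H a1 b1 : [set enorm (z.1 - z.2) | z in cub a1 l `*` cub a1 l] `<=`
    [set enorm (z.1 - z.2) | z in cub b1 l `*` cub b1 l].
  by rewrite /diam; congr sup; apply/seteqP; split; exact: H.
move=> _ [[x y] [/= ax ay] <-]; exists (x + (b1 - a1), y + (b1 - a1)); last first.
  by rewrite /= opprD addrACA subrr addr0.
split => i /=; rewrite !mxE; first by have := ax i; lra.
by have := ay i; lra.
Qed.

Lemma le_dist_cub a b l t : 0 < l ->
  (forall x y, cub a l x -> cub b l y -> t <= enorm (x - y)) ->
  t <= dist (cub a l) (cub b l).
Proof.
move=> l0 H; apply: lb_le_inf.
  by exists (enorm (a - b)), (a, b) => //=; split; apply: cub_corner; exact: ltW.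
by move=> _ [[x y] [/= ax ay] <-]; exact: H.
Qed.

End euclidean_norm.

Section good_pair.
Context {R : realType} {n : nat}.
Local Notation V := 'rV[R]_n.
Local Notation mu := (lebesgue_rV n : {measure set 'rV[R]_n -> \bar R}).
Variable K : V -> V -> R[i].

(* [K] is nearly the constant [K0] on [Q' * Q], in the sense that its deviation
   from [K0] has small marginals. *)
Definition good_pair (kappa eps C c1 : R) := forall (a : V) (l : R), 0 < l ->
  exists (a' : V) (K0 : R[i]),
  [/\ (forall x y, cub a l x -> cub a' l y -> kappa * (n%:R * l) <= enorm (x - y)),
      (forall i, `|a' ord0 i - a ord0 i| <= C * l),
      c1 <= normc K0 * l ^+ n,
      cmeasurable_fun setT (fun z : V * V => (rect (cub a l) (cub a' l) z)%:C%C * K z.1 z.2) &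
      (forall x, (nint mu (fun y => kerr K (cub a l) (cub a' l) K0 (x, y)) <=
         (eps * normc K0 * l ^+ n)%:E)%E) /\
      (forall y, (nint mu (fun x => kerr K (cub a l) (cub a' l) K0 (x, y)) <=
         (eps * normc K0 * l ^+ n)%:E)%E)].

Lemma cmeasurable_rect (Q Q' : set V) : measurable Q -> measurable Q' ->
  cmeasurable_fun (Q' `*` Q) (fun z : V * V => K z.1 z.2) ->
  cmeasurable_fun setT (fun z : V * V => (rect Q Q' z)%:C%C * K z.1 z.2).
Proof.
move=> mQ mQ' [m1 m2]; have mQQ : measurable (Q' `*` Q) by exact: measurableX.
have E (f : V * V -> R) z : rect Q Q' z * f z = (f \_ (Q' `*` Q)) z.
  rewrite patchE /rect !indicE in_setX.
  by case: (_ \in Q'); case: (_ \in Q); rewrite /= ?mul1r ?mul0r ?mulr0 ?mul0r.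
split.
  under eq_fun do rewrite Re_realM (E (fun z => complex.Re (K z.1 z.2))).
  exact/(measurable_restrictT _ _).1.
have Im_realM (t : R) (z : R[i]) : complex.Im (t%:C%C * z) = t * complex.Im z.
  by rewrite cImM /= mul0r addr0.
under eq_fun do rewrite Im_realM (E (fun z => complex.Im (K z.1 z.2))).
exact/(measurable_restrictT _ _).1.
Qed.

Lemma kerr_marginals_le (Q Q' : set V) (K0 : R[i]) (e v : R) : measurable Q -> measurable Q' ->
  mu Q = v%:E -> mu Q' = v%:E -> 0 <= e -> 0 < v ->
  cmeasurable_fun setT (fun z : V * V => (rect Q Q' z)%:C%C * K z.1 z.2) ->
  (forall x y, Q' x -> Q y -> normc (K x y - K0) <= e) ->
  (forall x, (nint mu (fun y => kerr K Q Q' K0 (x, y)) <= (e * v)%:E)%E) /\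
  (forall y, (nint mu (fun x => kerr K Q Q' K0 (x, y)) <= (e * v)%:E)%E).
Proof.
move=> mQ mQ' muQ muQ' e0 v0 mK H.
have mk := measurable_kerr K0 mQ mQ' mK.
have le1 x y : kerr K Q Q' K0 (x, y) <= e * \1_Q y.
  rewrite /kerr /rect/= !indicE.
  have [/set_mem xQ|_] := boolP (x \in Q'); last by rewrite !mul0r mulr_ge0.
  have [/set_mem yQ|_] := boolP (y \in Q); last by rewrite !(mulr0, mul0r).
  by rewrite !mul1r mulr1; exact: H.
have le2 x y : kerr K Q Q' K0 (x, y) <= e * \1_Q' x.
  rewrite /kerr /rect/= !indicE.
  have [/set_mem xQ|_] := boolP (x \in Q'); last by rewrite !(mulr0, mul0r).
  have [/set_mem yQ|_] := boolP (y \in Q); last by rewrite !(mulr0, mul0r) mulr_ge0.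
  by rewrite !mul1r mulr1; exact: H.
split=> [x|y].
  rewrite EFinM -muQ -nint_indic// -nintZ//; apply: nint_le.
  - by apply: (measurableT_comp mk); exact: pair1_measurable.
  - by apply: measurable_funM.
  - by move=> y; exact: kerr_ge0.
  - by move=> y; exact: le1.
rewrite EFinM -muQ' -nint_indic// -nintZ//; apply: nint_le.
- by apply: (measurableT_comp mk); exact: pair2_measurable.
- by apply: measurable_funM.
- by move=> x; exact: kerr_ge0.
- by move=> x; exact: le2.
Qed.

End good_pair.

(** * Good pairs for regular kernels *)

Section regular_kernels.
Context {R : realType} {n : nat}.
Local Notation V := 'rV[R]_n.
Local Notation mu := (lebesgue_rV n : {measure set 'rV[R]_n -> \bar R}).

Lemma measurable_sub : measurable_fun setT (fun z : V * V => z.1 - z.2).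
Proof.
apply: measurable_fun_coordP => i.
rewrite (_ : (fun _ => _) = (fun z : V * V => z.1 ord0 i - z.2 ord0 i)).
  apply: measurable_funB.
    exact: (measurableT_comp (measurable_coord i) measurable_fst).
  exact: (measurableT_comp (measurable_coord i) measurable_snd).
by apply/funext => z; rewrite !mxE.
Qed.

Lemma measurable_offdiag : measurable [set z : V * V | z.1 <> z.2].
Proof.
rewrite (_ : [set _ | _] = setT `&` (fun z : V * V => enorm (z.1 - z.2)) @^-1` `]0, +oo[).
  exact: (measurableT_comp measurable_enorm measurable_sub).
apply/seteqP; split => z /=; rewrite in_itv/= andbT.
  by move=> zz; split => //; apply: enorm_gt0 => /eqP; rewrite subr_eq0 => /eqP.
by move=> [_ z0] E; move: z0; rewrite E subrr enorm0 ltxx.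
Qed.

(** Non-degeneracy at the corner [a], at a radius much larger than the cube, provides the corner
    [a'] of the second cube and [K0 = K a' a]. Both cubes are small relative to their distance, so
    regularity makes the kernel nearly constant, even pointwise. *)
Lemma regular_good_pair (K : V -> V -> R[i]) (kappa eps : R) : (0 < n)%N ->
  nondegenerate_regular K -> 0 < kappa -> 0 < eps ->
  exists C c1 : R, [/\ 0 <= C, 0 < c1 & good_pair K kappa eps C c1].
Proof.
move=> n0 [[omega [[modw mK [cK HcK] reg] w0]] [c0 [c00 nondeg]]] kappa0 eps0.
have [w_ge0 w_mono] := modw.
have n1 : 1 <= n%:R :> R by rewrite ler1n.
have n00 : 0 < n%:R :> R by rewrite ltr0n.
have p2 : 0 < 1 + 2 ^+ n :> R by rewrite ltr_wpDl// exprn_gt0.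
(* The kernel is varied in one variable at a time: the first move is made at distance [r0], the
   second at distance at least [r0 / 2], hence [1 + 2 ^+ n]. *)
pose eta := eps / (c0 * (1 + 2 ^+ n)).
have eta0 : 0 < eta by rewrite divr_gt0// mulr_gt0.
have [t0 [t0_gt0 t0_lt1 wt0]] : exists t0, [/\ 0 < t0, t0 < 8^-1 & omega t0 < eta].
  move/cvgrPdist_lt : w0 => /(_ _ eta0) H.
  have : \forall t \near (0 : R)^'+, [/\ 0 < t, t < 8^-1 & omega t < eta].
    near=> t; split.
    - by near: t; exact: nbhs_right_gt.
    - by near: t; apply: nbhs_right_lt; rewrite invr_gt0.
    - have : `|0 - omega t| < eta by near: t.
      by rewrite sub0r normrN; apply: le_lt_trans; exact: ler_norm.
  by move=> /filter_ex.
(* The first summand keeps displacements inside a cube below the fraction [t0] of the distances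
   involved; the second gives the separation by [kappa] times the diameter. *)
pose A := 2 * n%:R / t0 + (4 + kappa) * n%:R + 1.
have A2 : 2 * n%:R / t0 <= A.
  by rewrite /A -addrA lerDl addr_ge0// mulr_ge0// addr_ge0// ltW.
have A4 : (4 + kappa) * n%:R <= A.
  by rewrite /A -[in leRHS]addrA [leRHS]addrCA lerDl addr_ge0// divr_ge0 ?ltW// mulr_gt0.
have A0 : 0 < A by rewrite (lt_le_trans _ A4)// mulr_gt0// addr_gt0.
pose M := Num.max 1 (c0 * cK).
have M1 : 1 <= M by rewrite le_max lexx.
exists (M * A), (c0 * A ^+ n)^-1; split.
- by rewrite mulr_ge0// ltW// (lt_le_trans ltr01).
- by rewrite invr_gt0 mulr_gt0// exprn_gt0.
move=> a l l0; pose rho := A * l.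
have rho0 : 0 < rho by rewrite mulr_gt0.
have [a' [ra' Ka']] := nondeg a rho rho0.
set r0 := enorm (a' - a) in ra'.
have r00 : 0 < r0 by exact: lt_le_trans ra'.
have nl_rho : (4 + kappa) * (n%:R * l) <= r0.
  by rewrite (le_trans _ ra')// mulrA ler_wpM2r// ltW.
have nl0 : 0 < n%:R * l by rewrite mulr_gt0.
have knl0 : 0 < kappa * (n%:R * l) by rewrite mulr_gt0.
have nl4 : 4 * (n%:R * l) + kappa * (n%:R * l) <= r0 by rewrite -mulrDl.
have nlt : 2 * (n%:R * l) <= t0 * r0.
  have A2' : 2 * n%:R <= A * t0 by rewrite -ler_pdivrMr.
  rewrite (le_trans _ (ler_wpM2l (ltW t0_gt0) ra'))// /rho.
  by rewrite mulrA mulrA [t0 * A]mulrC ler_wpM2r// ltW.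
have a'a : a' <> a.
  by move=> E; move: r00; rewrite /r0 E subrr enorm0 ltxx.
exists a', (K a' a).
have far x y : cub a l x -> cub a' l y -> kappa * (n%:R * l) <= enorm (x - y).
  move=> xQ yQ; have h1 := cub_dist xQ (cub_corner a (ltW l0)).
  have h2 := cub_dist yQ (cub_corner a' (ltW l0)).
  have h3 := enorm_dist a' y a; have h4 := enorm_dist y x a.
  by move: h3 h4; rewrite -/r0 (enormB a' y) (enormB y x); lra.
have K0_gt0 : (c0 * rho ^+ n)^-1 <= normc (K a' a) by [].
have K0pos : 0 < normc (K a' a).
  by apply: lt_le_trans K0_gt0; rewrite invr_gt0 mulr_gt0// exprn_gt0.
have mrect : cmeasurable_fun setT (fun z : V * V => (rect (cub a l) (cub a' l) z)%:C%C * K z.1 z.2).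
  apply: cmeasurable_rect; [exact: measurable_cub|exact: measurable_cub|].
  have sub : cub a' l `*` cub a l `<=` [set z : V * V | z.1 <> z.2].
    move=> [x y] [/= xQ' yQ] E; have := far _ _ yQ xQ'.
    by rewrite E subrr enorm0 leNgt knl0.
  case: mK => k1 k2; split.
    exact: (measurable_funS measurable_offdiag sub k1).
  exact: (measurable_funS measurable_offdiag sub k2).
pose e := eps * normc (K a' a).
have He x y : cub a' l x -> cub a l y -> normc (K x y - K a' a) <= e.
  move=> xQ' yQ.
  have h1 : enorm (a' - x) <= n%:R * l by apply: cub_dist xQ'; exact: cub_corner (ltW l0).
  have h2 : enorm (a - y) <= n%:R * l by apply: cub_dist yQ; exact: cub_corner (ltW l0).
  pose r1 := enorm (a - x).
  have r1r0 : 2^-1 * r0 <= r1.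
    by have := enorm_dist a' x a; rewrite -/r0 (enormB x a) -/r1; lra.
  have r10 : 0 < r1 by apply: lt_le_trans r1r0; rewrite mulr_gt0.
  have t0w s : 0 <= s -> s <= t0 -> omega s <= eta.
    by move=> s0 st; rewrite (le_trans (w_mono _ _ s0 st _) (ltW wt0))//; lra.
  have step1 : normc (K a' a - K x a) <= r0 ^- n * eta.
    have := reg a' x a; rewrite -/r0 => H.
    apply: le_trans (le_trans (H _) _).
    - by rewrite lerDl normc_ge0'.
    - by move: h1 nl4; lra.
    - rewrite ler_wpM2l ?invr_ge0 ?exprn_ge0 ?(ltW r00)//.
      apply: t0w; first by rewrite divr_ge0 ?enorm_ge0// ltW.
      by rewrite ler_pdivrMr//; move: h1 nlt; lra.
  have step2 : normc (K x a - K x y) <= r1 ^- n * eta.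
    have := reg a y x; rewrite -/r1 => H.
    apply: le_trans (le_trans (H _) _).
    - by rewrite lerDr normc_ge0'.
    - by move: h2 nl4 r1r0; lra.
    - rewrite ler_wpM2l ?invr_ge0 ?exprn_ge0 ?(ltW r10)//.
      apply: t0w; first by rewrite divr_ge0 ?enorm_ge0// ltW.
      rewrite ler_pdivrMr//; have := ler_wpM2l (ltW t0_gt0) r1r0.
      by rewrite mulrCA; move: h2 nlt; lra.
  have r1r : r1 ^- n <= 2 ^+ n * r0 ^- n.
    rewrite -[X in X * _]invrK -invfM lef_pV2 ?posrE ?mulr_gt0 ?invr_gt0 ?exprn_gt0//.
    by rewrite -exprVn -exprMn lerXn2r ?nnegrE ?(ltW r10)// mulr_ge0// ltW.
  rewrite normc_distC (le_trans (ler_normc_dist _ (K x a) _))//.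
  have r0rho : r0 ^- n <= rho ^- n.
    by rewrite lef_pV2 ?posrE ?exprn_gt0// lerXn2r ?nnegrE// ltW.
  apply: (@le_trans _ _ ((1 + 2 ^+ n) * rho ^- n * eta)).
    rewrite (le_trans (lerD step1 step2))// -mulrDl ler_wpM2r ?(ltW eta0)//.
    by rewrite mulrDl mul1r lerD// (le_trans r1r)// ler_wpM2l//.
  rewrite /eta (_ : _ * _ * _ = eps * (c0 * rho ^+ n)^-1); last first.
    by field; rewrite !gt_eqF// exprn_gt0.
  by rewrite ler_wpM2l// ltW.
have e0 : 0 <= e by rewrite mulr_ge0 ?normc_ge0'// ltW.
have ln0 : 0 < l ^+ n by rewrite exprn_gt0.
have [k1 k2] := kerr_marginals_le (measurable_cub a l) (measurable_cub a' l)
  (mu_cub a (ltW l0)) (mu_cub a' (ltW l0)) e0 ln0 mrect He.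
split => //.
- move=> i; have := coord_le_enorm (a' - a) i; rewrite !mxE -/r0 => h.
  rewrite (le_trans h)// -mulrA -/rho.
  (* Non-degeneracy only bounds the distance of [a'] from below. The upper bound comes from
     comparing the lower bound of [|K a' a|] with the size condition of the kernel. *)
  have rn : (r0 / rho) ^+ n <= M.
    have Kr : normc (K a' a) <= cK * r0 ^- n by exact: HcK.
    have : (c0 * rho ^+ n)^-1 <= cK * r0 ^- n by exact: le_trans K0_gt0 Kr.
    have rhon : 0 < rho ^+ n by rewrite exprn_gt0.
    rewrite ler_pdivlMr ?exprn_gt0// mulrC ler_pdivrMr ?mulr_gt0// => H.
    rewrite expr_div_n ler_pdivrMr// (le_trans H)// mulrA (mulrC cK).
    by rewrite ler_wpM2r ?(ltW rhon)// le_max lexx orbT.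
  rewrite -ler_pdivrMr//; have [r1|r1] := leP (r0 / rho) 1; first exact: le_trans M1.
  by rewrite (le_trans _ rn)// ler_eXnr// ltW.
- rewrite /rho exprMn mulrA -ler_pdivrMr// in K0_gt0 *.
  by rewrite (le_trans _ K0_gt0)// !invfM.
Unshelve. all: by end_near.
Qed.

End regular_kernels.

(** * Good pairs for rough homogeneous kernels *)

Section rough_kernels.
Context {R : realType} {n : nat}.
Hypothesis n0 : (0 < n)%N.
Local Notation V := 'rV[R]_n.
Local Notation mu := (lebesgue_rV n : {measure set 'rV[R]_n -> \bar R}).
Variable Omega : V -> R[i].
Hypothesis homog : forall x (t : R), x <> 0 -> 0 < t -> Omega (t *: x) = Omega x.
Hypothesis Omega_int : in_L1_sphere Omega.

Lemma measurable_usphere : measurable (usphere : set V).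
Proof.
rewrite (_ : usphere = setT `&` enorm @^-1` [set 1]).
  exact: measurable_enorm.
by rewrite setTI.
Qed.

Lemma enorm_normalize (u : V) : u <> 0 -> enorm (normalize u) = 1.
Proof.
move=> u0; have e0 := enorm_gt0 u0.
by rewrite /normalize enormZ gtr0_norm ?invr_gt0// mulVf// gt_eqF.
Qed.

(** Measurability of [Omega] is given on the sphere only; composing this cut-off with [normalize]
    yields a measurable function equal to [Omega] off the origin. *)
Definition sph (x : V) : R[i] := (\1_usphere x : R)%:C%C * Omega x.

Lemma sphE u : u <> 0 -> sph (normalize u) = Omega u.
Proof.
move=> u0; rewrite /sph indicE mem_set ?mul1r; last exact: enorm_normalize.
by apply: homog => //; rewrite invr_gt0 enorm_gt0.
Qed.

Lemma cmeasurable_sph : cmeasurable_fun setT sph.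
Proof.
have E (f : V -> R) x : \1_usphere x * f x = (f \_ usphere) x.
  by rewrite patchE indicE; case: (_ \in usphere); rewrite ?mul1r ?mul0r.
case: Omega_int => -[m1 m2] _; split.
  under eq_fun do rewrite Re_realM (E (fun z => complex.Re (Omega z))).
  by apply/(measurable_restrictT _ _).1 => //; exact: measurable_usphere.
have Im_realM (t : R) (z : R[i]) : complex.Im (t%:C%C * z) = t * complex.Im z.
  by rewrite cImM /= mul0r addr0.
under eq_fun do rewrite Im_realM (E (fun z => complex.Im (Omega z))).
by apply/(measurable_restrictT _ _).1 => //; exact: measurable_usphere.
Qed.

Let mball : measurable (punctured_ball : set V).
Proof. exact: measurable_punctured_ball. Qed.

(* Off the ball the map takes the value 0, which is not on the sphere. *)
Let proj (u : V) : V := if u \in punctured_ball then normalize u else 0.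

Let mproj : measurable_fun setT proj.
Proof.
apply: measurable_fun_if => //.
- apply: (@measurable_fun_bool _ _ _ _ true) => //.
  rewrite setTI (_ : _ @^-1` _ = punctured_ball) ?setTI//.
  by apply/seteqP; split => x /=; [exact: set_mem|exact: mem_set].
- exact: measurable_funS measurable_normalize.
Qed.

(** By definition the sphere measure is [n] times the image of Lebesgue measure on the punctured
    ball under [normalize], so this integral is the L^1 norm of [Omega] divided by [n]. *)
Lemma ball_integral_fin : (nint mu (fun u => \1_punctured_ball u * normc (sph (normalize u)))%R < +oo)%E.
Proof.
pose push : {measure set V -> \bar R} := pushforward mu proj.
pose m1 := push mproj.
have projE : proj @^-1` usphere = punctured_ball.
  apply/seteqP; split => u; rewrite /proj /=.
    case: ifPn => [/set_mem//|_]; rewrite /usphere/= enorm0 => /eqP.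
    by rewrite eq_sym oner_eq0.
  move=> bu; rewrite mem_set//; apply: enorm_normalize => u0.
  by move: bu; rewrite u0 /punctured_ball/= enorm0 ltxx.
have E A : measurable A -> A `<=` usphere ->
    mscale (n%:R%:nng : {nonneg R}) m1 A = @sphere_measure R n A.
  move=> mA AS; transitivity (n%:R%:E * mu (proj @^-1` A))%E => //.
  congr (_ * mu _)%E; apply/seteqP; split => u; rewrite /proj/=.
    case: ifPn => [/set_mem//|_] /AS; rewrite /usphere/= enorm0 => /eqP.
    by rewrite eq_sym oner_eq0.
  by move=> [bu Au]; rewrite mem_set.
have [[w1 w2] ofin] := Omega_int.
have mO : measurable_fun usphere (fun x => (normc (Omega x))%:E).
  by apply/measurable_EFinP; exact: measurable_normc.
move: ofin; rewrite -(eq_measure_integral _ E) ge0_integral_mscale//; first last.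
- by move=> x _; rewrite lee_fin normc_ge0'.
- exact: measurable_usphere.
rewrite ge0_integral_pushforward//; first last.
- by move=> x _; rewrite lee_fin normc_ge0'.
- exact: measurable_usphere.
rewrite projE => H.
have -> : nint mu (fun u => \1_punctured_ball u * normc (sph (normalize u)))%R =
    (\int[mu]_(x in punctured_ball) ((fun x => (normc (Omega x))%:E) \o proj) x)%E.
  rewrite [RHS]integral_mkcond; apply: eq_integral => u _.
  rewrite patchE indicE /= /proj.
  have [/set_mem bu|_] := boolP (u \in punctured_ball); last by rewrite mul0r.
  have u0 : u <> 0 by move=> u0; move: bu; rewrite u0 /punctured_ball/= enorm0 ltxx.
  rewrite /= mul1r sphE// /normalize homog//.
  by rewrite invr_gt0 enorm_gt0.
move: H; rewrite /=; case: (integral _ _ _) => [r| |]//=.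
  by move=> _; rewrite ltry.
by rewrite gt0_muley ?ltxx// lte_fin ltr0n.
Qed.

(** With [rough_side] this is the cube of half-side [1 / (n + 1)] around the origin: its points have
    norm at most [n / (n + 1)], so it lies in the unit ball. *)
Definition rough_corner : V := const_mx (- n.+1%:R^-1).
Definition rough_side : R := 2 * n.+1%:R^-1.
Local Notation L := rough_side.
Local Notation root := (hcub rough_corner rough_side).
Local Notation cell := (cell rough_corner rough_side).

Lemma rough_side_gt0 : 0 < L.
Proof. by rewrite mulr_gt0// invr_gt0 ltr0n. Qed.

Let L0 := rough_side_gt0.

Lemma root_coord (u : V) : root u <-> forall i, - n.+1%:R^-1 <= u ord0 i < n.+1%:R^-1.
Proof.
have E : - n.+1%:R^-1 + rough_side = n.+1%:R^-1 :> R by rewrite /rough_side; ring.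
by split => H i; have := H i; rewrite mxE E.
Qed.

Lemma root_ball (u : V) : root u -> u <> 0 -> punctured_ball u.
Proof.
move=> /root_coord ru u0; rewrite /punctured_ball/= enorm_gt0//=.
have H i : `|u ord0 i| <= n.+1%:R^-1.
  by rewrite ler_norml; have /andP[-> /ltW ->] := ru i.
rewrite (le_trans (enorm_le_const H))// ler_pdivrMr ?ltr0n// mul1r.
by rewrite ler_nat.
Qed.

(** Staying one side length away from the origin makes the homogeneous kernel integrable there, and
    a union of cells is compatible with finer generations. *)
Definition far_cells M : set V := \big[setU/set0]_(j : {ffun 'I_n -> 'I_(2 ^ M)} |
  `[< forall u, cell j u -> L / 2 ^+ M <= enorm u >]) cell j.

Lemma far_cellsP M u : far_cells M u <-> exists2 j : {ffun 'I_n -> 'I_(2 ^ M)},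
  (forall w, cell j w -> L / 2 ^+ M <= enorm w) & cell j u.
Proof.
rewrite /far_cells -bigcup_seq_cond; split.
  by move=> [j /= /andP[_ /asboolP pj] xj]; exists j.
by move=> [j pj xj]; exists j => //=; rewrite mem_index_enum; apply/asboolP.
Qed.

Lemma measurable_far_cells M : measurable (far_cells M).
Proof. by apply: bigsetU_measurable => j _; exact: measurable_cell. Qed.

Lemma far_cells_enorm M u : far_cells M u -> L / 2 ^+ M <= enorm u.
Proof. by move=> /far_cellsP[j H ju]; exact: H. Qed.

Lemma far_cells_neq0 M u : far_cells M u -> u <> 0.
Proof.
move=> /far_cells_enorm + u0; rewrite u0 enorm0 leNgt divr_gt0 ?exprn_gt0//.
Qed.

Lemma far_cells_ex u : root u -> u <> 0 -> exists M, far_cells M u.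
Proof.
move=> ru u0; have e0 := enorm_gt0 u0.
(* With [(n + 1)] sides below [|u|] and the cell having diameter at most [n] sides, one side remains
   between the cell and the origin. *)
have [M LM] := small_cells L (divr_gt0 e0 (ltr0Sn R n)).
exists M; have [j ju] := cell_ex L0 M ru; apply/far_cellsP; exists j => // w jw.
have h : enorm (u - w) <= n%:R * (L / 2 ^+ M).
  exact: cub_dist (hcub_sub ju) (hcub_sub jw).
have := enorm_dist u w 0; rewrite !subr0.
move: LM; rewrite ler_pdivlMr ?ltr0n// -[n.+1%:R]natr1 mulrDr mulr1 [_ * n%:R]mulrC.
by move: h; lra.
Qed.

(** The kernel as a function of the difference of its variables, restricted to the far cells. *)
Definition rough_fun M (u : V) : R[i] :=
  (\1_(far_cells M) u * (enorm u `^ (-1)) ^+ n)%:C%C * sph (normalize u).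

Lemma rough_funE M u : far_cells M u -> rough_fun M u = Omega u / ((enorm u ^+ n)%:C)%C.
Proof.
move=> fu; have u0 := far_cells_neq0 fu.
rewrite /rough_fun sphE// indicE mem_set// mul1r powR_inv1 ?enorm_ge0//.
by rewrite exprVn mulrC fmorphV.
Qed.

Lemma rough_fun0 M u : ~ far_cells M u -> rough_fun M u = 0.
Proof. by move=> nfu; rewrite /rough_fun indicE memNset// mul0r mul0r. Qed.

Lemma cmeasurable_rough_fun M : cmeasurable_fun setT (rough_fun M).
Proof.
apply: cmeasurableM.
  apply: cmeasurable_real; apply: measurable_funM.
    by apply: measurable_indic; exact: measurable_far_cells.
  apply: measurable_funX; apply: (measurableT_comp (measurable_powR _)).
  exact: measurable_enorm.
exact: (cmeasurable_comp cmeasurable_sph measurable_normalize).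
Qed.

Lemma rough_fun_fin M : (nint mu (fun u => \1_root u * normc (rough_fun M u))%R < +oo)%E.
Proof.
have msph : measurable_fun setT (fun u : V => normc (sph (normalize u))).
  apply: measurable_normc.
  exact: (cmeasurable_comp cmeasurable_sph measurable_normalize).
have mb : measurable_fun setT (fun u : V => \1_punctured_ball u * normc (sph (normalize u))).
  by apply: measurable_funM => //; exact: measurable_indic.
pose B := ((L / 2 ^+ M)^-1) ^+ n.
have B0 : 0 <= B by rewrite exprn_ge0// invr_ge0 divr_ge0 ?(ltW L0)// exprn_ge0.
apply: (@le_lt_trans _ _ (B%:E * nint mu (fun u => \1_punctured_ball u * normc (sph (normalize u)))%R)%E).
  rewrite -nintZ//; last by move=> u; rewrite mulr_ge0 ?normc_ge0'.
  apply: nint_le.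
  - apply: measurable_funM; first by apply: measurable_indic; exact: measurable_hcub.
    by apply: measurable_normc; exact: cmeasurable_rough_fun.
  - exact: measurable_funM.
  - by move=> u; rewrite mulr_ge0 ?normc_ge0'.
  - move=> u; have [fu|nfu] := pselect (far_cells M u); last first.
      by rewrite rough_fun0// normc0 mulr0 !mulr_ge0 ?normc_ge0'.
    have ru : root u by move: fu => /far_cellsP[j _ /(cell_root L0)].
    have u0 := far_cells_neq0 fu.
    rewrite !indicE (mem_set ru) (mem_set (root_ball ru u0)) /= !mul1r.
    rewrite /rough_fun normcM normc_real ler_wpM2r ?normc_ge0'// indicE mem_set//= mul1r.
    rewrite ger0_norm ?exprn_ge0 ?powR_ge0// lerXn2r ?nnegrE ?powR_ge0//.
      by rewrite invr_ge0 divr_ge0 ?(ltW L0)// exprn_ge0.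
    rewrite powR_inv1 ?enorm_ge0// lef_pV2 ?posrE ?enorm_gt0//.
      exact: far_cells_enorm.
    by rewrite divr_gt0 ?exprn_gt0.
have := ball_integral_fin.
have : (0 <= nint mu (fun u => \1_punctured_ball u * normc (sph (normalize u)))%R)%E.
  by apply: nint_ge0 => u; rewrite mulr_ge0 ?normc_ge0'.
by case: (nint _ _) => [r| |]//= _ _; rewrite -EFinM ltry.
Qed.

Hypothesis Omega_neq0 : ~ {ae @sphere_measure R n, forall x, usphere x -> Omega x = 0}.

(** Otherwise all these functions vanish almost everywhere on the root. The dilation by
    [t = 1 / (2 (n + 1))] maps the unit ball into the root without changing directions, so the cone
    over the set where [Omega] is nonzero is null, and [Omega] vanishes almost everywhere on the
    sphere. *)
Lemma rough_fun_neq0 : exists M, nint mu (fun u => \1_root u * normc (rough_fun M u))%R != 0%E.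
Proof.
apply: contrapT => /forallNP H.
have {}H M : nint mu (fun u => \1_root u * normc (rough_fun M u))%R = 0%E.
  by apply/eqP/negPn/negP; exact: H.
apply: Omega_neq0.
have m1 M : measurable_fun setT (fun u => \1_root u * normc (rough_fun M u)).
  apply: measurable_funM; first by apply: measurable_indic; exact: measurable_hcub.
  by apply: measurable_normc; exact: cmeasurable_rough_fun.
pose Z M := [set u | 0 < \1_root u * normc (rough_fun M u)].
have mZ M : measurable (Z M).
  rewrite (_ : Z M = setT `&` (fun u => \1_root u * normc (rough_fun M u)) @^-1` `]0, +oo[).
    exact: m1.
  by apply/seteqP; split => u; rewrite /Z /= in_itv/= andbT; [|case].
have Z0 M : mu (Z M) = 0%E.
  have mE : measurable_fun setT (fun u => (\1_root u * normc (rough_fun M u))%:E).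
    exact/measurable_EFinP.
  have /(ae_eq_integral_abs mu measurableT mE) : (\int[mu]_x `|(\1_root x * normc (rough_fun M x))%:E| = 0)%E.
    rewrite -(H M); apply: eq_integral => u _.
    by rewrite gee0_abs// lee_fin mulr_ge0 ?normc_ge0'.
  move=> [A [mA A0 sA]]; apply/eqP; rewrite eq_le measure_ge0 andbT -A0.
  rewrite le_measure ?inE// => u Zu; apply: sA => /= /(_ I)[E].
  by move: Zu; rewrite /Z/= E ltxx.
pose ZZ := \bigcup_M Z M.
have mZZ : measurable ZZ by exact: bigcup_measurable.
have ZZ0 : mu ZZ = 0%E.
  apply/(negligibleP _ mZZ); apply: negligible_bigcup => M.
  by apply/(negligibleP _ (mZ M)); exact: Z0.
have t0 : 0 < (2 * n.+1%:R)^-1 :> R by rewrite invr_gt0 mulr_gt0// ltr0n.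
set t : R := (2 * n.+1%:R)^-1 in t0.
have tn0 : t != 0 by rewrite gt_eqF.
have mN : measurable (affine t 0 @^-1` ZZ).
  by rewrite -[X in measurable X]setTI; apply: measurable_affine.
have N0 : mu (affine t 0 @^-1` ZZ) = 0%E by rewrite mu_affine// ZZ0 mule0.
pose S := [set x : V | 0 < normc (sph x)].
have mS : measurable S.
  rewrite (_ : S = setT `&` (fun x => normc (sph x)) @^-1` `]0, +oo[).
    exact: measurable_normc cmeasurable_sph _ _ _.
  by apply/seteqP; split => u; rewrite /S /= in_itv/= andbT; [|case].
have mSS : measurable (punctured_ball `&` normalize @^-1` S).
  apply: measurableI => //; rewrite -[X in measurable X]setTI.
  exact: measurable_normalize.
exists S; split => //.
- apply/eqP; rewrite mule_eq0; apply/orP; right; rewrite -measure_le0 -N0.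
  rewrite le_measure ?inE// => u [bu Su].
  have u0 : u <> 0 by move=> u0; move: bu; rewrite u0 /punctured_ball/= enorm0 ltxx.
  have bu1 : enorm u <= 1 by case/andP: bu.
  have w0 : t *: u <> 0.
    by move=> /eqP; rewrite scaler_eq0 (negbTE tn0)/= => /eqP.
  have rw : root (t *: u).
    apply/root_coord => i; rewrite mxE.
    have : `|t * u ord0 i| <= t.
      rewrite normrM gtr0_norm// ler_piMr ?(ltW t0)//.
      exact: le_trans (coord_le_enorm u i) bu1.
    have tt : n.+1%:R^-1 = 2 * t :> R by rewrite /t invfM mulrA divff ?mul1r.
    rewrite ler_norml tt; lra.
  have [M fM] := far_cells_ex rw w0.
  exists M => //; rewrite /Z/affine/= addr0 indicE mem_set//= mul1r.
  rewrite rough_funE// homog// -sphE// normcM normcV mulr_gt0//.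
  by rewrite normc_real invr_gt0 normr_gt0 expf_neq0// gt_eqF// enorm_gt0.
- move=> x /= nx; rewrite /S/=; rewrite lt_neqAle normc_ge0' andbT eq_sym.
  apply/eqP => x0; apply: nx => sx.
  by move: x0; rewrite /sph indicE mem_set//= mul1r => /eq0_normc.
Qed.

(* A cell on which the function is nearly constant, relative to its size: if
   there were none, the best constants would give
   [|rough_fun|_1 <= (1 + 1/eps) * cell distance], which tends to 0. *)
Lemma rough_cell (eps : R) (N1 : nat) : 0 < eps -> exists M N (j : {ffun 'I_n -> 'I_(2 ^ N)}) k0,
  [/\ (M + N1 <= N)%N, k0 != 0, cell j `<=` far_cells M &
    (nint mu (fun u => \1_(cell j) u * normc (rough_fun M u - k0))%R <=
      (eps * normc k0 * (L / 2 ^+ N) ^+ n)%:E)%E].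
Proof.
move=> eps0; have [M IM] := rough_fun_neq0.
pose f := rough_fun M; have mf := cmeasurable_rough_fun M.
have ffin := rough_fun_fin M.
set I := nint _ _ in IM ffin.
have I0 : (0 <= I)%E by apply: nint_ge0 => u; rewrite mulr_ge0 ?normc_ge0'.
have Ifin : I \is a fin_num by rewrite ge0_fin_numE.
have {IM}Ipos : 0 < fine I by rewrite fine_gt0// lt0e IM I0/=.
(* With this choice [(1 + eps^-1) * del] is half of [I], which produces the contradiction. *)
pose del := fine I / (2 * (1 + eps^-1)).
have e1 : 0 < 1 + eps^-1 by rewrite ltr_wpDl ?invr_gt0.
have del0 : 0 < del by rewrite divr_gt0// mulr_gt0.
have part (g : R[i] -> R) : (forall z, `|g z| <= normc z) -> measurable_fun setT (fun u => g (f u)) ->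
    cell_limit rough_corner L (fun u => g (f u)).
  move=> gz mg; apply: integrable_cell_limit => //.
  apply: le_lt_trans ffin; apply: nint_le.
  - apply: measurable_funM; first by apply: measurable_indic; exact: measurable_hcub.
    exact: measurableT_comp.
  - apply: measurable_funM; first by apply: measurable_indic; exact: measurable_hcub.
    exact: measurable_normc.
  - by move=> u; rewrite mulr_ge0.
  - by move=> u; rewrite ler_wpM2l.
have [N1' h1] := part (@complex.Re R) (@normRe_le R) mf.1 _ (divr_gt0 del0 (ltr0Sn R 1)).
have [N2' h2] := part (@complex.Im R) (@normIm_le R) mf.2 _ (divr_gt0 del0 (ltr0Sn R 1)).
(* [N1] is the separation demanded by the caller; [N1'] and [N2'] serve the approximations of the
   real and imaginary parts. *)
pose N := (M + N1 + N1' + N2')%N.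
have NN1 : (N1' <= N)%N by rewrite /N addnAC leq_addl.
have NN2 : (N2' <= N)%N by rewrite /N leq_addl.
have NM : (M <= N)%N by rewrite /N -!addnA leq_addr.
have [c1 d1] := h1 N NN1; have [c2 d2] := h2 N NN2.
pose c j := Complex (c1 j) (c2 j).
have mcell k (j : {ffun 'I_n -> 'I_(2 ^ k)}) : measurable (cell j) by exact: measurable_cell.
have mfc k : cmeasurable_fun setT (fun u => f u - k).
  by apply: cmeasurableB => //; exact: cmeasurable_cst.
have mt (j : {ffun 'I_n -> 'I_(2 ^ N)}) k : measurable_fun setT (fun u => \1_(cell j) u * normc (f u - k)).
  by apply: measurable_funM; [exact: measurable_indic|exact: measurable_normc].
have mt0 (j : {ffun 'I_n -> 'I_(2 ^ N)}) : measurable_fun setT (fun u => \1_(cell j) u * normc (f u)).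
  by apply: measurable_funM; [exact: measurable_indic|exact: measurable_normc].
have nt (j : {ffun 'I_n -> 'I_(2 ^ N)}) k u : 0 <= \1_(cell j) u * normc (f u - k).
  by rewrite mulr_ge0 ?normc_ge0'.
have nt0 (j : {ffun 'I_n -> 'I_(2 ^ N)}) u : 0 <= \1_(cell j) u * normc (f u).
  by rewrite mulr_ge0 ?normc_ge0'.
pose e j := nint mu (fun u => \1_(cell j) u * normc (f u - c j))%R.
have e0 j : (0 <= e j)%E by exact: nint_ge0.
have esum : (\sum_j e j < del%:E)%E.
  apply: (@le_lt_trans _ _ (cell_dist rough_corner L (fun u => complex.Re (f u)) c1 +
      cell_dist rough_corner L (fun u => complex.Im (f u)) c2)%E); last first.
    by rewrite [del]splitr EFinD; exact: lteD.
  rewrite -big_split/=; apply: lee_sum => j _.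
  have mr : measurable_fun setT (fun u => \1_(cell j) u * `|complex.Re (f u) - c1 j|).
    apply: measurable_funM; first exact: measurable_indic.
    by apply: measurableT_comp => //; apply: measurable_funB => //; exact: mf.1.
  have mi : measurable_fun setT (fun u => \1_(cell j) u * `|complex.Im (f u) - c2 j|).
    apply: measurable_funM; first exact: measurable_indic.
    by apply: measurableT_comp => //; apply: measurable_funB => //; exact: mf.2.
  rewrite -nintD//; apply: nint_le => //.
    exact: measurable_funD.
  move=> u; rewrite -mulrDr ler_wpM2l// (le_trans (normc_le_ReIm _))//.
  by rewrite cReD cImD cReN cImN.
exists M, N; apply: contrapT => noj.
have bound j : (nint mu (fun u => \1_(cell j) u * normc (f u))%R <= (1 + eps^-1)%:E * e j)%E.
  (* As [M <= N], a cell of generation [N] that is not inside the far cells is disjoint from them,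
     and the function vanishes on it. *)
  have [sub|nsub] := pselect (cell j `<=` far_cells M); last first.
    rewrite (@eq_nint _ _ _ _ _ (fun=> 0)) ?/nint ?integral0; last first.
      move=> u; rewrite indicE; have [/set_mem ju|_] := boolP (u \in cell j); last by rewrite mul0r.
      rewrite /f rough_fun0 ?normc0 ?mulr0// => /far_cellsP[i fi iu]; apply: nsub => w jw.
      by apply/far_cellsP; exists i => //; exact: (cell_nested L0 NM iu ju).
    by rewrite mule_ge0// lee_fin ltW.
  have tri : (nint mu (fun u => \1_(cell j) u * normc (f u))%R <=
      e j + (normc (c j) * (L / 2 ^+ N) ^+ n)%:E)%E.
    rewrite EFinM -(mu_cell rough_corner L0 j) -nint_indic// -nintZ ?normc_ge0'//.
    rewrite -nintD//; first last.
    - by move=> u; rewrite mulr_ge0 ?normc_ge0'.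
    - by apply: measurable_funM.
    apply: nint_le => //.
    - by apply: measurable_funD => //; exact: measurable_funM.
    - move=> u; rewrite [normc (c j) * _]mulrC -mulrDr ler_wpM2l//.
      by rewrite -{1}[f u](subrK (c j)) le_normcD.
  apply: (le_trans tri); rewrite EFinD ge0_muleDl ?lee_fin ?invr_ge0 ?(ltW eps0)// mul1e leeD2l//.
  have [c0|c0] := eqVneq (c j) 0.
    by rewrite c0 normc0 mul0r mule_ge0// lee_fin invr_ge0 ltW.
  have : ~ (e j <= (eps * normc (c j) * (L / 2 ^+ N) ^+ n)%:E)%E.
    move=> H; apply: noj; exists j, (c j); split => //.
    by rewrite /N -!addnA leq_add2l leq_addr.
  move=> /negP; rewrite -ltNge => /ltW H.
  rewrite -lee_pdivrMl ?invr_gt0// invrK -EFinM.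
  by rewrite mulrA.
have : (I <= (1 + eps^-1)%:E * del%:E)%E.
  apply: (@le_trans _ _ ((1 + eps^-1)%:E * \sum_j e j)%E); last first.
    by rewrite lee_wpmul2l ?lee_fin ?(ltW e1)// ltW.
  rewrite ge0_sume_distrr//.
  have -> : I = (\sum_(j : {ffun 'I_n -> 'I_(2 ^ N)}) nint mu (fun u => \1_(cell j) u * normc (f u))%R)%E.
    rewrite -nint_sum//; apply: eq_nint => u.
    by rewrite -mulr_suml sum_cell.
  by apply: lee_sum => j _; exact: bound.
rewrite -(fineK Ifin) -EFinM lee_fin /del.
have -> : (1 + eps^-1) * (fine I / (2 * (1 + eps^-1))) = fine I / 2.
  by move: e1; generalize (1 + eps^-1) => e' e'0; field; rewrite gt_eqF.
by move: Ipos; lra.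
Qed.

End rough_kernels.

Section rough_good_pair.
Context {R : realType} {n : nat}.
Local Notation V := 'rV[R]_n.
Local Notation mu := (lebesgue_rV n : {measure set 'rV[R]_n -> \bar R}).

(** One good cell is found near the origin; homogeneity of degree [-n] rescales it to every size.
    Translates of a function of [y - x] have the same integral in either variable, so closeness in
    the mean on the cell bounds both marginals. *)
Lemma rough_good_pair (K : V -> V -> R[i]) (kappa eps : R) : (0 < n)%N ->
  nondegenerate_rough K -> 0 < kappa -> 0 < eps ->
  exists C c1 : R, [/\ 0 <= C, 0 < c1 & good_pair K kappa eps C c1].
Proof.
move=> n0 [ Omega [homog Oint O0 HK]] kappa0 eps0.
(* The good cell will be at least [2 ^+ N1] of its own sides away from the origin, which becomes the
   separation of the cubes. *)
have [N1 HN1] : exists N1, kappa * n%:R <= 2 ^+ N1 :> R.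
  exists (Num.truncn (kappa * n%:R)).+1.
  rewrite (le_trans (ltW (truncnS_gt _)))// -natrX ler_nat ltnW//.
  exact: ltn_expl.
(* The rescaled cell has side [3 * l], so its volume exceeds that of the cubes by [3 ^+ n]. *)
have eps'0 : 0 < eps / 3 ^+ n by rewrite divr_gt0// exprn_gt0.
have [M [N [j [k0 [MN k00 sub Hj]]]]] := rough_cell n0 homog Oint O0 N1 eps'0.
set L := rough_side in sub Hj.
have L0 : 0 < L := rough_side_gt0.
set ell := L / 2 ^+ N in Hj.
have ell0 : 0 < ell by rewrite divr_gt0// exprn_gt0.
set P := cell _ _ _ in sub Hj.
have [p PE] : exists p, P = hcub p ell by exists (cell_corner rough_corner L j).
have ellE : ell = L / 2 ^+ N by [].
move: ell ellE ell0 Hj PE => ell ellE ell0 Hj PE.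
pose f := rough_fun Omega M.
have mf : cmeasurable_fun setT f := cmeasurable_rough_fun Oint M.
have nk0 : 0 < normc k0.
  by rewrite lt_neqAle normc_ge0' andbT eq_sym; apply: contra k00 => /eqP/eq0_normc ->.
exists (3 * enorm p / ell + 2), (normc k0 * (ell / 3) ^+ n); split.
- by rewrite addr_ge0// divr_ge0 ?(ltW ell0)// mulr_ge0// enorm_ge0.
- by rewrite mulr_gt0// exprn_gt0// divr_gt0.
move=> a l l0.
pose t := 3 * l / ell; have t0 : 0 < t by rewrite divr_gt0// mulr_gt0.
have tn0 : 0 < t ^+ n by rewrite exprn_gt0.
have tell : t * ell = 3 * l by rewrite /t divfK// gt_eqF.
(* Differences of points of the two cubes then have coordinates between [l / 2] and [5 l / 2] above
   those of [t *: p], inside the rescaled half-open cell of side [3 * l]. *)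
pose a' : V := a + t *: p + const_mx (3 / 2 * l).
pose K0 : R[i] := (t ^- n)%:C%C * k0.
exists a', K0.
have inP x y : cub a l x -> cub a' l y -> P (t^-1 *: (y - x)).
  move=> xQ yQ; rewrite PE => i; have := xQ i; have := yQ i; rewrite !mxE => h1 h2.
  rewrite ler_pdivlMl// ltr_pdivrMl// mulrDr tell.
  by move: h1 h2; set tp := t * p ord0 i; lra.
have KE x y : cub a l x -> cub a' l y -> K y x = (t ^- n)%:C%C * f (t^-1 *: (y - x)).
  move=> xQ yQ; have fw := sub _ (inP x y xQ yQ).
  have w0 := far_cells_neq0 fw.
  have yx0 : y - x <> 0 by move=> E; apply: w0; rewrite E scaler0.
  have yx : y <> x by move=> E; apply: yx0; rewrite E subrr.
  rewrite HK// /f rough_funE// homog ?invr_gt0// enormZ gtr0_norm ?invr_gt0//.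
  have -> : ((t^-1 * enorm (y - x)) ^+ n)%:C%C =
      (t ^- n)%:C%C * (enorm (y - x) ^+ n)%:C%C by rewrite exprMn exprVn -rmorphM.
  have tC0 : (t ^- n)%:C%C != 0 :> R[i].
    by rewrite eq_complex /= eqxx andbT invr_eq0 gt_eqF.
  by rewrite invfM mulrCA mulVKf// mulrC.
have far x y : cub a l x -> cub a' l y -> kappa * (n%:R * l) <= enorm (x - y).
  move=> xQ yQ; have /far_cells_enorm := sub _ (inP x y xQ yQ).
  rewrite enormZ gtr0_norm ?invr_gt0// ler_pdivlMl// enormB; apply: le_trans.
  rewrite -/L; have -> : t * (L / 2 ^+ M) = 3 * l * 2 ^+ (N - M).
    rewrite /t ellE; have NE : 2 ^+ N = 2 ^+ M * 2 ^+ (N - M) :> R.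
      by rewrite -exprD subnKC// (leq_trans _ MN)// leq_addr.
    by rewrite NE; field; rewrite !gt_eqF ?exprn_gt0.
  rewrite mulrA (le_trans (ler_wpM2r (ltW l0) HN1))// mulrC -mulrA.
  rewrite [leRHS]mulrC -mulrA ler_pM2l// (@le_trans _ _ (2 ^+ (N - M)))//.
    by rewrite ler_weXn2l ?ler1n// leq_subRL ?MN// (leq_trans _ MN)// leq_addr.
  by rewrite ler_peMr ?exprn_ge0// ler1n.
pose g u := \1_P u * normc (f u - k0).
have mP : measurable P by exact: measurable_hcub.
have mg : measurable_fun setT g.
  apply: measurable_funM; first exact: measurable_indic.
  by apply: measurable_normc; apply: cmeasurableB => //; exact: cmeasurable_cst.
have g0 u : 0 <= g u by rewrite mulr_ge0 ?normc_ge0'.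
have mrect : cmeasurable_fun setT (fun z : V * V => (rect (cub a l) (cub a' l) z)%:C%C * K z.1 z.2).
  rewrite (_ : (fun _ => _) = (fun z : V * V =>
      (rect (cub a l) (cub a' l) z * t ^- n)%:C%C * f (affine t^-1 0 (z.1 - z.2)))).
    apply: cmeasurableM.
      apply: cmeasurable_real; apply: measurable_funM => //.
      by apply: measurable_rect; exact: measurable_cub.
    apply: (cmeasurable_comp mf).
    exact: (measurableT_comp (measurable_affine _ _) measurable_sub).
  apply/funext => -[y x]; rewrite /rect/affine/= addr0 !indicE.
  have [/set_mem yQ|_] := boolP (y \in cub a' l); last by rewrite !mul0r.
  have [/set_mem xQ|_] := boolP (x \in cub a l); last by rewrite mulr0 !mul0r.
  by rewrite KE// /= !mul1r.
have kg y x : kerr K (cub a l) (cub a' l) K0 (y, x) <= t ^- n * g (t^-1 *: (y - x)).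
  have r0 : 0 <= t ^- n * g (t^-1 *: (y - x)) by rewrite mulr_ge0// invr_ge0 ltW.
  rewrite /kerr /rect/= !indicE.
  have [/set_mem yQ|_] := boolP (y \in cub a' l); last by rewrite !mul0r.
  have [/set_mem xQ|_] := boolP (x \in cub a l); last by rewrite mulr0 !mul0r.
  rewrite KE// /K0 -mulrBr normcM normc_real ger0_norm ?invr_ge0 ?(ltW tn0)//.
  by rewrite /g indicE mem_set ?mul1r//; exact: inP.
have mk := measurable_kerr K0 (measurable_cub a l) (measurable_cub a' l) mrect.
have bd (s : R) (v : V) : `|s| = t^-1 ->
    (nint mu (fun x => t ^- n * g (s *: x + v))%R <= (eps * normc K0 * l ^+ n)%:E)%E.
  move=> st; have s0 : s != 0 by rewrite -normr_eq0 st invr_eq0 gt_eqF.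
  have mgs : measurable_fun setT (fun x : V => g (s *: x + v)).
    exact: (measurableT_comp mg (measurable_affine s v)).
  have tnV : 0 <= t ^- n by rewrite invr_ge0 ltW.
  rewrite (nintZ mu mgs (fun x => g0 (s *: x + v)) tnV) (nint_affine v s0 mg g0).
  rewrite st exprVn invrK muleA -EFinM.
  rewrite mulVf ?gt_eqF// mul1e (le_trans Hj)// lee_fin.
  rewrite /K0 normcM normc_real ger0_norm ?invr_ge0 ?(ltW tn0)//.
  rewrite (_ : eps / 3 ^+ n * _ * _ = eps * (t ^- n * normc k0) * l ^+ n)//.
  rewrite /t !exprMn exprVn; field.
  by rewrite !gt_eqF ?exprn_gt0.
split => //.
- move=> i; rewrite !mxE.
  rewrite (_ : _ - _ = t * p ord0 i + 3 / 2 * l); last by ring.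
  rewrite (le_trans (ler_normD _ _))// [leRHS]mulrDl; apply: lerD.
    rewrite normrM gtr0_norm// (le_trans (ler_wpM2l (ltW t0) (coord_le_enorm p i)))//.
    by rewrite /t le_eqVlt; apply/orP; left; apply/eqP; ring.
  by rewrite gtr0_norm ?mulr_gt0// ler_wpM2r// ?(ltW l0)//; lra.
- rewrite /K0 normcM normc_real ger0_norm ?invr_ge0 ?(ltW tn0)//.
  rewrite /t !exprMn !exprVn le_eqVlt; apply/orP; left; apply/eqP; field.
  by rewrite !gt_eqF ?exprn_gt0.
- split=> [y|x].
    apply: le_trans (bd (- t^-1) (t^-1 *: y) _); last by rewrite normrN gtr0_norm// invr_gt0.
    apply: nint_le.
    + by apply: (measurableT_comp mk); exact: pair1_measurable.
    + apply: measurable_funM; first exact: measurable_cst.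
      exact: (measurableT_comp mg (measurable_affine (- t^-1) (t^-1 *: y))).
    + by move=> x; exact: kerr_ge0.
    + move=> x; have -> : - t^-1 *: x + t^-1 *: y = t^-1 *: (y - x).
        by rewrite scalerBr scaleNr addrC.
      exact: kg.
  apply: le_trans (bd t^-1 (- (t^-1 *: x)) _); last by rewrite gtr0_norm// invr_gt0.
  apply: nint_le.
  + by apply: (measurableT_comp mk); exact: pair2_measurable.
  + apply: measurable_funM; first exact: measurable_cst.
    exact: (measurableT_comp mg (measurable_affine t^-1 (- (t^-1 *: x)))).
  + by move=> y; exact: kerr_ge0.
  + move=> y; have -> : t^-1 *: y + - (t^-1 *: x) = t^-1 *: (y - x).
      by rewrite scalerBr.
    exact: kg.
Qed.

Lemma nondegenerate_good_pair (K : V -> V -> R[i]) (kappa eps : R) : (0 < n)%N ->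
  nondegenerate_cz_kernel K -> 0 < kappa -> 0 < eps ->
  exists C c1 : R, [/\ 0 <= C, 0 < c1 & good_pair K kappa eps C c1].
Proof.
by move=> n0 [HK|HK]; [exact: regular_good_pair|exact: rough_good_pair].
Qed.

End rough_good_pair.

(** * The oscillation estimate *)

Lemma Linfty_on_le (R : realType) (n : nat) (A : set 'rV[R]_n) (f : 'rV[R]_n -> R[i]) (beta : R) :
  cmeasurable_fun setT f -> 0 <= beta -> (forall x, normc (f x) <= beta * \1_A x) ->
  in_Linfty_on A f /\ (cLnorm +oo f <= beta%:E)%E.
Proof.
move=> mf beta0 fA.
have le : (cLnorm +oo f <= beta%:E)%E.
  rewrite /cLnorm unlock /=; case: ifP => _; last by rewrite lee_fin.
  apply/ess_supP; apply: nearW => x /=; rewrite lee_fin ger0_norm ?normc_ge0'//.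
  by rewrite (le_trans (fA x))// ler_piMr.
split=> //; split; first by split=> //; exact: le_lt_trans le (ltry _).
apply: nearW => x; have := fA x; rewrite indicE; case: (x \in A) => /=.
  by rewrite mul1r.
rewrite mulr0 => fx; rewrite (_ : f x = 0) ?mulr0//; apply: eq0_normc; apply/eqP.
by rewrite eq_le fx normc_ge0'.
Qed.

Lemma le_poweR (R : realType) (x y : \bar R) (e : R) :
  0 <= e -> (0 <= x)%E -> (x <= y)%E -> (x `^ e <= y `^ e)%E.
Proof.
move=> e0 x0 xy; apply: gt0_ler_poweR => //; rewrite in_itv/= leey andbT//.
exact: le_trans xy.
Qed.

Lemma Lnorm_step_le d (T : measurableType d) (R : realType) (mu : {measure set T -> \bar R})
    (I : finType) (A : I -> set T) (g : I -> \bar R) (beta : I -> R) (p : R) :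
  (forall i, measurable (A i)) -> 0 < p ->
  (forall i, 0 <= g i)%E -> (forall i, g i <= (beta i)%:E)%E ->
  (Lnorm mu p%:E (fun x => \sum_i g i * (\1_(A i) x)%:E) <=
    (nint mu (fun x => step_fun A beta x `^ p)%R) `^ p^-1)%E.
Proof.
move=> mA p0 g0 gb.
have beta0 i : 0 <= beta i by rewrite -lee_fin (le_trans (g0 i)).
have gE i : g i = (fine (g i))%:E.
  by rewrite fineK// ge0_fin_numE// (le_lt_trans (gb i)) ?ltry.
have gf0 i : 0 <= fine (g i) by rewrite fine_ge0.
have -> : (fun x => \sum_i g i * (\1_(A i) x)%:E)%E =
    (fun x => (step_fun A (fun i => fine (g i)) x)%:E).
  by apply/funext => x; rewrite /step_fun -sumEFin; apply: eq_bigr => i _; rewrite gE EFinM.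
rewrite unlock /Lnorm.
have mp (h : T -> R) : measurable_fun setT h -> measurable_fun setT (fun x => h x `^ p).
  by move=> mh; exact: (measurableT_comp (measurable_powR p)).
have E : (\int[mu]_x (`|(step_fun A (fun i => fine (g i)) x)%:E| `^ p) =
    nint mu (fun x => step_fun A (fun i => fine (g i)) x `^ p)%R)%E.
  by apply: eq_integral => x _; rewrite /= ger0_norm// step_fun_ge0.
have V0 : 0 <= p^-1 by rewrite invr_ge0 ltW.
rewrite E; apply: (le_poweR V0); first by apply: nint_ge0 => x; exact: powR_ge0.
apply: nint_le.
- by apply: mp; exact: measurable_step_fun.
- by apply: mp; exact: measurable_step_fun.
- by move=> x; exact: powR_ge0.
- move=> x; apply: ge0_ler_powR; rewrite ?nnegrE ?step_fun_ge0 ?(ltW p0)//.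
  by apply: ler_sum => i _; rewrite ler_wpM2r// -lee_fin -gE.
Qed.

Section commutator_oscillation.
Context {R : realType} {n : nat}.
Local Notation V := 'rV[R]_n.
Local Notation mu := (lebesgue_rV n : {measure set 'rV[R]_n -> \bar R}).
Local Notation Re := complex.Re.
Variable K : V -> V -> R[i].

Lemma compact_cub (a : V) (l : R) : compact (cub a l).
Proof.
rewrite (_ : cub a l = [set x : V | forall i, `[a ord0 i, a ord0 i + l]%classic (x ord0 i)]).
  by apply: (@rV_compact _ n (fun i => `[a ord0 i, a ord0 i + l]%classic)) => i; exact: segment_compact.
by apply/seteqP; split => x /= H i; have := H i; rewrite /= in_itv.
Qed.

Lemma cnint_cub_lty (b : V -> R[i]) (a : V) (l : R) : in_L1loc b -> (cnint mu (cub a l) b < +oo)%E.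
Proof. by move=> [mb lb]; rewrite cnintE; apply: lb; exact: compact_cub. Qed.

Lemma cnint_subset (A B : set V) (b : V -> R[i]) : measurable A -> measurable B -> A `<=` B ->
  cmeasurable_fun setT b -> (cnint mu A b <= cnint mu B b)%E.
Proof.
move=> mA mB AB mb; apply: nint_le.
- by apply: measurable_funM => //; exact: measurable_normc.
- by apply: measurable_funM => //; exact: measurable_normc.
- by move=> x; rewrite mulr_ge0 ?normc_ge0'.
- move=> x; rewrite ler_wpM2r ?normc_ge0'// !indicE.
  case: (boolP (x \in A)) => [/set_mem/AB/mem_set ->//|_]; by rewrite ?ler01.
Qed.

(** The last clause records homogeneity in the weights because it relies on integrability of the
    kernel on the pair, which is no longer visible afterwards. *)
Definition test_pair (kappa C : R) (b : V -> R[i]) (a : V) (l : R) (a' : V)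
    (phi psi : V -> R[i]) :=
  [/\ (forall x y, cub a l x -> cub a' l y -> kappa * (n%:R * l) <= enorm (x - y)),
      (forall i, `|a' ord0 i - a ord0 i| <= C * l),
      cmeasurable_fun setT phi /\ cmeasurable_fun setT psi,
      (forall y, normc (phi y) <= \1_(cub a l) y) /\
      (forall x, normc (psi x) <= \1_(cub a' l) x) &
      forall s t : R, Re (commutator_form b K (fun y => s%:C%C * phi y) (fun x => t%:C%C * psi x)) =
        s * t * Re (commutator_form b K phi psi)].

Definition mean_osc (b : V -> R[i]) (a : V) (l : R) : R :=
  fine (cnint mu (hcub a l) (fun x => b x - cavg mu (hcub a l) (l ^+ n) b)).

Lemma cnint_hcub_lty (b : V -> R[i]) (a : V) (l : R) : in_L1loc b -> (cnint mu (hcub a l) b < +oo)%E.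
Proof.
move=> lb; apply: le_lt_trans (cnint_cub_lty a l lb).
apply: cnint_subset; [exact: measurable_hcub|exact: measurable_cub|exact: hcub_sub|exact: lb.1].
Qed.

Lemma osc_arith (m c1 k X Y u w : R) : m * c1 <= m * k -> m * k <= 2 * X * k ->
  k * u <= k * (2 * Y) -> k * w <= k * (2 * X) -> 0 <= k * Y -> 0 <= k * X ->
  c1 / 4 * m <= k * X - 8^-1 * k * (u + X) + (k * Y - 8^-1 * k * (Y + w)).
Proof. lra. Qed.

(** Let [X] be the oscillation on [Q] around the mean over [Q'], and [Y] the reverse. The errors of
    the two forms involve [X], [Y] and the oscillations of each cube around its own mean, which are
    at most [2 Y] and [2 X]. With tolerance 1/8 the sum of the forms keeps [5/8] of [k * (X + Y)],
    and [mean_osc] is at most [2 X]. *)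
Lemma good_pair_osc (kappa C c1 : R) (b : V -> R[i]) (a : V) (l : R) :
  good_pair K kappa 8^-1 C c1 -> in_L1loc b -> 0 < l ->
  exists a' phi1 psi1 phi2 psi2,
  [/\ test_pair kappa C b a l a' phi1 psi1, test_pair kappa C b a l a' phi2 psi2 &
      c1 / 4 * mean_osc b a l <=
        Re (commutator_form b K phi1 psi1) + Re (commutator_form b K phi2 psi2)].
Proof.
move=> GP lb l0; have mb := lb.1.
have [a' [K0 [far near c1k mK [ker1 ker2]]]] := GP a l l0.
set Q := cub a l in far mK ker1 ker2; set Q' := cub a' l in far mK ker1 ker2.
pose v := l ^+ n; pose k := normc K0 * v.
have v0 : 0 < v by rewrite exprn_gt0.
have mQ : measurable Q by exact: measurable_cub.
have mQ' : measurable Q' by exact: measurable_cub.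
have mh : measurable (hcub a l) by exact: measurable_hcub.
have muQ : mu Q = v%:E by rewrite mu_cub// ltW.
have muQ' : mu Q' = v%:E by rewrite mu_cub// ltW.
have muh : mu (hcub a l) = v%:E by rewrite mu_hcub.
have bQ : (cnint mu Q b < +oo)%E by exact: cnint_cub_lty.
have bQ' : (cnint mu Q' b < +oo)%E by exact: cnint_cub_lty.
have bh : (cnint mu (hcub a l) b < +oo)%E by exact: cnint_hcub_lty.
have k0 : 0 <= k by rewrite mulr_ge0 ?normc_ge0' ?(ltW v0).
pose delta := 8^-1 * normc K0 * v.
have delta0 : 0 <= delta by rewrite !mulr_ge0 ?normc_ge0' ?(ltW v0) ?invr_ge0.
pose cA := cavg mu Q' v b; pose cB := cavg mu Q v b.
pose phi1 := fun y => - test_sgn K0 b Q cA y.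
pose psi1 := fun x : V => (\1_Q' x : R)%:C%C.
pose phi2 := fun y : V => (\1_Q y : R)%:C%C.
pose psi2 := test_sgn K0 b Q' cB.
have mphi1 : cmeasurable_fun setT phi1 by apply: cmeasurableN; exact: cmeasurable_test_sgn.
have mpsi1 : cmeasurable_fun setT psi1 by exact: cmeasurable_cindic.
have mphi2 : cmeasurable_fun setT phi2 by exact: cmeasurable_cindic.
have mpsi2 : cmeasurable_fun setT psi2 by exact: cmeasurable_test_sgn.
have phi1Q y : normc (phi1 y) <= \1_Q y by rewrite normcN normc_test_sgn_le.
have psi1Q y : normc (psi1 y) <= \1_Q' y by exact: normc_indic_le.
have phi2Q y : normc (phi2 y) <= \1_Q y by exact: normc_indic_le.
have psi2Q y : normc (psi2 y) <= \1_Q' y by exact: normc_test_sgn_le.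
have FA := form_first_osc mQ mQ' muQ muQ' v0 delta0 mK ker1 ker2 mb bQ bQ'.
have FB := form_second_osc mQ mQ' muQ muQ' v0 delta0 mK ker1 ker2 mb bQ bQ'.
exists a', phi1, psi1, phi2, psi2; split.
- split=> // s t; apply: (Re_commutator_formZ mQ mQ' muQ muQ' v0 delta0 mK ker1 ker2) => //.
- split=> // s t; apply: (Re_commutator_formZ mQ mQ' muQ muQ' v0 delta0 mK ker1 ker2) => //.
rewrite -/cA -/phi1 -/psi1 in FA; rewrite -/cB -/phi2 -/psi2 in FB.
pose X := osc_over b Q cA; pose Y := osc_over b Q' cB.
have E1 c := osc_overE mQ muQ mb bQ c.
have E2 c := osc_overE' mQ' muQ' mb bQ' c.
have Y2 : osc_over b Q' cA <= 2 * Y.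
  have := cavg_osc_le mQ' muQ' v0 cB mb bQ'; rewrite -/cA !E2 -EFinM lee_fin; exact.
have X2 : osc_over b Q cB <= 2 * X.
  have := cavg_osc_le mQ muQ v0 cA mb bQ; rewrite -/cB !E1 -EFinM lee_fin; exact.
have osc0 A (c : R[i]) : 0 <= osc_over b A c by rewrite fine_ge0// cnint_ge0.
have XH : mean_osc b a l <= 2 * X.
  have := cavg_osc_le mh muh v0 cA mb bh.
  have fin (c : R[i]) : cnint mu (hcub a l) (fun x => b x - c) \is a fin_num.
    by rewrite ge0_fin_numE ?cnint_ge0// (cnintB_lty mh muh).
  rewrite /mean_osc -/v -(fineK (fin _)) => /le_trans H.
  rewrite -lee_fin; apply: H; rewrite EFinM lee_wpmul2l// -E1.
  apply: cnint_subset => //; first exact: hcub_sub.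
  by apply: cmeasurableB => //; exact: cmeasurable_cst.
rewrite -/X in FA; rewrite -/Y in FB.
have X0 : 0 <= X by exact: osc0.
have Y0 : 0 <= Y by exact: osc0.
apply: le_trans (lerD FA FB).
have -> : delta = 8^-1 * k by rewrite /delta /k mulrA.
rewrite -/k.
have m0 : 0 <= mean_osc b a l by rewrite fine_ge0// cnint_ge0.
have s1 : mean_osc b a l * c1 <= mean_osc b a l * k by rewrite ler_wpM2l.
have s2 : mean_osc b a l * k <= 2 * X * k by rewrite ler_wpM2r.
have s3 : k * osc_over b Q' cA <= k * (2 * Y) by exact: (ler_wpM2l k0 Y2).
have s4 : k * osc_over b Q cB <= k * (2 * X) by exact: (ler_wpM2l k0 X2).
have s5 : 0 <= k * Y by exact: (mulr_ge0 k0 Y0).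
have s6 : 0 <= k * X by exact: (mulr_ge0 k0 X0).
move: s1 s2 s3 s4 s5 s6.
exact: osc_arith.
Qed.

End commutator_oscillation.

Section sparse_sum.
Context {R : realType} {n : nat}.
Local Notation V := 'rV[R]_n.
Local Notation mu := (lebesgue_rV n : {measure set 'rV[R]_n -> \bar R}).
Local Notation Re := complex.Re.
Variable K : V -> V -> R[i].

Definition form_bound (p q kappa : R) (b : V -> R[i]) (Theta : R) :=
  forall (N : nat) (Q Q' : 'I_N -> set V) (f g : 'I_N -> V -> R[i]),
      (0 < N)%N ->
      (forall i, is_cube (Q i) /\ is_cube (Q' i)) ->
      (forall i, diam (Q i) = diam (Q' i)) ->
      (forall i, kappa * diam (Q i) <= dist (Q i) (Q' i)) ->
      (forall i, in_Linfty_on (Q i) (f i)) ->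
      (forall i, in_Linfty_on (Q' i) (g i)) ->
      ((\sum_(i < N) normc (commutator_form b K (f i) (g i)))%:E <=
        Theta%:E *
        Lnorm (lebesgue_rV n) p%:E
          (fun x => \sum_(i < N) cLnorm +oo (f i) * (\1_(Q i) x)%:E) *
        Lnorm (lebesgue_rV n) (q / (q - 1))%:E
          (fun x => \sum_(i < N) cLnorm +oo (g i) * (\1_(Q' i) x)%:E))%E.

Lemma nint_step_fun_subset (J : finType) (A B : J -> set V) (beta : J -> R) (s : R) :
  (forall j, measurable (A j)) -> (forall j, measurable (B j)) -> (forall j, A j `<=` B j) ->
  (forall j, 0 <= beta j) -> 0 <= s ->
  (nint mu (fun x => step_fun A beta x `^ s)%R <= nint mu (fun x => step_fun B beta x `^ s)%R)%E.
Proof.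
move=> mA mB AB b0 s0; apply: nint_le.
- apply: (measurableT_comp (measurable_powR s)); exact: measurable_step_fun.
- apply: (measurableT_comp (measurable_powR s)); exact: measurable_step_fun.
- by move=> x; exact: powR_ge0.
- move=> x; apply: ge0_ler_powR; rewrite ?nnegrE ?step_fun_ge0//.
  apply: ler_sum => j _; rewrite ler_wpM2l// !indicE.
  by case: (boolP (x \in A j)) => [/set_mem/AB/mem_set ->|_] /=.
Qed.

(** The first argument is the ratio of volumes of the common enlargement and the cube, the second
    the covering constant of cubes. *)
Definition near_cst (C s : R) := dilation_cst ((2 * (C + 1) + 1) ^+ n) (3 ^+ n) s.

(* Both cubes of each pair lie in a fixed multiple of the corresponding half-open cube. *)
Lemma Lnorm_near_le (J : finType) (a c : J -> V) (l beta : J -> R) (C s U : R)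
    (g : J -> \bar R) :
  0 <= C -> 1 < s -> (forall j, 0 < l j) -> (forall j, 0 <= beta j) ->
  (forall j i, `|c j ord0 i - a j ord0 i| <= C * l j) ->
  (forall j, 0 <= g j)%E -> (forall j, g j <= (beta j)%:E)%E ->
  (nint mu (fun x => step_fun (fun j => hcub (a j) (l j)) beta x `^ s)%R <= U%:E)%E ->
  (Lnorm mu s%:E (fun x => \sum_j g j * (\1_(cub (c j) (l j)) x)%:E) <=
    (near_cst C s `^ s^-1 * U `^ s^-1)%:E)%E.
Proof.
move=> C0 s1 l0 b0 ca g0 gb HU.
have s0 : 0 < s by exact: lt_trans s1.
have U0 : 0 <= U.
  by rewrite -lee_fin (le_trans _ HU)// nint_ge0// => x; exact: powR_ge0.
apply: le_trans (Lnorm_step_le _ _ s0 g0 gb) _.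
  by move=> j; exact: measurable_cub.
pose M : R := 2 * (C + 1) + 1.
have M0 : 0 < M by rewrite /M; lra.
pose a1 j := a j - const_mx ((C + 1) * l j).
have Pcub (c1 : V) j : (forall i, `|c1 ord0 i - a j ord0 i| <= C * l j) ->
    cub c1 (l j) `<=` cub (a1 j) (M * l j).
  move=> c1a x H i; rewrite /a1 /M !mxE; have := H i; have := c1a i; have := l0 j.
  by rewrite ler_norml; nra.
have nc0 : 0 <= near_cst C s by exact: dilation_cst_ge0.
have key : (nint mu (fun x => step_fun (fun j => cub (c j) (l j)) beta x `^ s)%R <=
    (near_cst C s * U)%:E)%E.
  apply: (@le_trans _ _ (nint mu (fun x => step_fun (fun j => cub (a1 j) (M * l j)) beta x `^ s)%R)).
    apply: nint_step_fun_subset => //; [by move=> j; exact: measurable_cub|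
      by move=> j; exact: measurable_cub|by move=> j; exact: Pcub|exact: ltW].
  rewrite EFinM; apply: le_trans (lee_wpmul2l _ HU); last by rewrite lee_fin.
  apply: (@dilation _ _ _ mu J _ _ (fun j => (M * l j) ^+ n) (fun j => l j ^+ n)) => //.
  - by move=> j; exact: measurable_cub.
  - by move=> j; exact: measurable_hcub.
  - by move=> j; rewrite mu_cub// mulr_ge0 ?ltW.
  - by move=> j; rewrite mu_hcub.
  - by move=> j; rewrite exprn_gt0// mulr_gt0.
  - by rewrite exprn_ge0// -/M ltW.
  - by apply: vitali_cubes => j; rewrite mulr_gt0.
  - move=> j x /hcub_sub; apply: Pcub => i.
    by rewrite subrr normr0 mulr_ge0// ltW.
  - by move=> j; rewrite exprMn.
have -> : (near_cst C s `^ s^-1 * U `^ s^-1)%:E = ((near_cst C s * U)%:E `^ s^-1)%E.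
  by rewrite poweR_EFin powRM.
have V0 : 0 <= s^-1 by rewrite invr_ge0 ltW.
by apply: (le_poweR V0 _ key); apply: nint_ge0 => x; exact: powR_ge0.
Qed.

(** The hypothesis is applied to [tau ^ (r/p)] times [phi] and [tau ^ (r/s)] times [psi]; the
    weights multiply to [tau ^ (r-1)] because [r - 1 = r/p + r/s]. *)
Lemma test_pair_sum (p q kappa C Theta : R) (b : V -> R[i]) (J : finType) (a a' : J -> V)
    (l tau : J -> R) (phi psi : J -> V -> R[i]) (U W : R)
    (s := q / (q - 1)) (r := p * q / (p - q)) :
  1 < q -> q < p -> 0 <= kappa -> 0 <= C -> 0 <= Theta -> form_bound p q kappa b Theta ->
  (forall j, 0 < l j) -> (forall j, 0 <= tau j) ->
  (forall j, test_pair K kappa C b (a j) (l j) (a' j) (phi j) (psi j)) ->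
  (nint mu (fun x => step_fun (fun j => hcub (a j) (l j)) (fun j => tau j `^ (r / p)) x `^ p)%R
    <= U%:E)%E ->
  (nint mu (fun x => step_fun (fun j => hcub (a j) (l j)) (fun j => tau j `^ (r / s)) x `^ s)%R
    <= W%:E)%E ->
  \sum_j tau j `^ (r - 1) * Re (commutator_form b K (phi j) (psi j)) <=
    near_cst C p `^ p^-1 * near_cst C s `^ s^-1 * Theta * U `^ p^-1 * W `^ s^-1.
Proof.
move=> q1 qp k0 C0 T0 FB l0 tau0 TP HU HW.
have p1 : 1 < p by exact: lt_trans qp.
have p0 : 0 < p by exact: lt_trans p1.
have s1 : 1 < s by rewrite /s ltr_pdivlMr ?mul1r; lra.
have s0 : 0 < s by exact: lt_trans s1.
have r1 : 1 < r by rewrite /r ltr_pdivlMr ?subr_gt0// mul1r; nra.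
have rps : r - 1 = r / p + r / s.
  by rewrite /r /s; field; rewrite !gt_eqF ?subr_gt0//; lra.
(* The hypothesis speaks of nonempty families only. *)
have [J0|J0] := posnP #|J|.
  rewrite big1; first by rewrite !mulr_ge0 ?powR_ge0.
  by move=> j _; have := fintype0 j; rewrite J0.
pose beta j := tau j `^ (r / p); pose gam j := tau j `^ (r / s).
pose F j y := (beta j)%:C%C * phi j y; pose G j x := (gam j)%:C%C * psi j x.
have beta0 j : 0 <= beta j by exact: powR_ge0.
have gam0 j : 0 <= gam j by exact: powR_ge0.
have F1 j : in_Linfty_on (cub (a j) (l j)) (F j) /\ (cLnorm +oo (F j) <= (beta j)%:E)%E.
  have [_ _ [mf _] [fQ _] _] := TP j.
  apply: Linfty_on_le => //; first by apply: cmeasurableM => //; exact: cmeasurable_cst.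
  by move=> x; rewrite normcM normc_real ger0_norm// ler_wpM2l.
have G1 j : in_Linfty_on (cub (a' j) (l j)) (G j) /\ (cLnorm +oo (G j) <= (gam j)%:E)%E.
  have [_ _ [_ mf] [_ fQ] _] := TP j.
  apply: Linfty_on_le => //; first by apply: cmeasurableM => //; exact: cmeasurable_cst.
  by move=> x; rewrite normcM normc_real ger0_norm// ler_wpM2l.
have := FB #|J| (fun i => cub (a (enum_val i)) (l (enum_val i)))
  (fun i => cub (a' (enum_val i)) (l (enum_val i))) (fun i => F (enum_val i)) (fun i => G (enum_val i)) J0.
have -> : (fun x : V => \sum_(i < #|J|) cLnorm +oo (F (enum_val i)) *
    (\1_(cub (a (enum_val i)) (l (enum_val i))) x)%:E)%E =
    (fun x => \sum_j cLnorm +oo (F j) * (\1_(cub (a j) (l j)) x)%:E)%E.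
  apply/funext => x; rewrite -(big_enum_val (fun j => cLnorm +oo (F j) * (\1_(cub (a j) (l j)) x)%:E)%E).
  by apply: eq_bigl.
have -> : (fun x : V => \sum_(i < #|J|) cLnorm +oo (G (enum_val i)) *
    (\1_(cub (a' (enum_val i)) (l (enum_val i))) x)%:E)%E =
    (fun x => \sum_j cLnorm +oo (G j) * (\1_(cub (a' j) (l j)) x)%:E)%E.
  apply/funext => x; rewrite -(big_enum_val (fun j => cLnorm +oo (G j) * (\1_(cub (a' j) (l j)) x)%:E)%E).
  by apply: eq_bigl.
have -> : \sum_(i < #|J|) normc (commutator_form b K (F (enum_val i)) (G (enum_val i))) =
    \sum_j normc (commutator_form b K (F j) (G j)).
  rewrite -(big_enum_val (fun j => normc (commutator_form b K (F j) (G j)))).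
  by apply: eq_bigl.
move=> H.
have {}H : ((\sum_j normc (commutator_form b K (F j) (G j)))%:E <=
    Theta%:E * (near_cst C p `^ p^-1 * U `^ p^-1)%:E * (near_cst C s `^ s^-1 * W `^ s^-1)%:E)%E.
  apply: le_trans (H _ _ _ _ _) _.
  - by move=> i; split; exact: is_cube_cub.
  - by move=> i; exact: diam_cub_eq.
  - move=> i; apply: le_dist_cub => // x y Qx Qy.
    have [far _ _ _ _] := TP (enum_val i).
    by rewrite (le_trans _ (far x y Qx Qy))// ler_wpM2l// diam_cub_le.
  - by move=> i; exact: (F1 _).1.
  - by move=> i; exact: (G1 _).1.
  have n1 := @Lnorm_near_le J a a l beta C p U (fun j => cLnorm +oo (F j)) C0 p1 l0 beta0.
  have n2 := @Lnorm_near_le J a a' l gam C s W (fun j => cLnorm +oo (G j)) C0 s1 l0 gam0.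
  apply: lee_pmul.
  - by rewrite mule_ge0// ?lee_fin// Lnorm_ge0.
  - exact: Lnorm_ge0.
  - apply: lee_wpmul2l; first by rewrite lee_fin.
    apply: n1 => //; [|by move=> j; exact: Lnorm_ge0|by move=> j; exact: (F1 j).2].
    by move=> j i; rewrite subrr normr0 mulr_ge0// ltW.
  - apply: n2 => //; [|by move=> j; exact: Lnorm_ge0|by move=> j; exact: (G1 j).2].
    by move=> j i; have [_ + _ _ _] := TP j; exact.
apply: (@le_trans _ _ (\sum_j normc (commutator_form b K (F j) (G j)))).
  apply: ler_sum => j _; apply: le_trans (normRe_le _); apply: le_trans (ler_norm _).
  have [_ _ _ _ TZ] := TP j.
  have E : tau j `^ (r - 1) = beta j * gam j.
    by rewrite rps powRD// -rps gt_eqF// subr_gt0.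
  by rewrite E le_eqVlt; apply/orP; left; apply/eqP; rewrite -TZ.
have E (t x y u w : R) : t * (x * u) * (y * w) = x * y * t * u * w by ring.
by rewrite -lee_fin; apply: (le_trans H); rewrite -!EFinM E.
Qed.

End sparse_sum.

Section oscillation_sum.
Context {R : realType} {n : nat}.
Local Notation V := 'rV[R]_n.
Local Notation mu := (lebesgue_rV n : {measure set 'rV[R]_n -> \bar R}).
Variable K : V -> V -> R[i].

Definition osc_sum_cst (C c1 p s : R) :=
  8 / c1 * (near_cst (n := n) C p `^ p^-1 * near_cst (n := n) C s `^ s^-1).

(** In the constant, [4 / c1] comes from [good_pair_osc] and a further 2 from testing with two
    families. *)
Lemma mean_osc_sum (p q kappa C c1 Theta : R) (b : V -> R[i]) (J : finType) (a : J -> V)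
    (l tau : J -> R) (U W : R) (s := q / (q - 1)) (r := p * q / (p - q)) :
  1 < q -> q < p -> 0 <= kappa -> 0 <= C -> 0 < c1 -> 0 <= Theta ->
  good_pair K kappa 8^-1 C c1 -> in_L1loc b -> form_bound K p q kappa b Theta ->
  (forall j, 0 < l j) -> (forall j, 0 <= tau j) ->
  (nint mu (fun x => step_fun (fun j => hcub (a j) (l j)) (fun j => tau j `^ (r / p)) x `^ p)%R
    <= U%:E)%E ->
  (nint mu (fun x => step_fun (fun j => hcub (a j) (l j)) (fun j => tau j `^ (r / s)) x `^ s)%R
    <= W%:E)%E ->
  \sum_j tau j `^ (r - 1) * mean_osc b (a j) (l j) <=
    osc_sum_cst C c1 p s * Theta * U `^ p^-1 * W `^ s^-1.
Proof.
move=> q1 qp k0 C0 c10 T0 GP lb FB l0 tau0 HU HW.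
have := fun j => good_pair_osc (a j) GP lb (l0 j).
move=> /choice[a'] /choice[phi1] /choice[psi1] /choice[phi2] /choice[psi2] H.
have S1 := test_pair_sum q1 qp k0 C0 T0 FB l0 tau0 (fun j => let: And3 h _ _ := H j in h) HU HW.
have S2 := test_pair_sum q1 qp k0 C0 T0 FB l0 tau0 (fun j => let: And3 _ h _ := H j in h) HU HW.
have E (x y t u w : R) : 8 / c1 * (x * y) * t * u * w =
    4 / c1 * (x * y * t * u * w + x * y * t * u * w).
  by field; rewrite gt_eqF.
rewrite /osc_sum_cst E; apply: le_trans (ler_wpM2l _ (lerD S1 S2)); last first.
  by rewrite divr_ge0// ltW.
rewrite -big_split/= mulr_sumr; apply: ler_sum => j _.
have [_ _ /(ler_wpM2l (powR_ge0 (tau j) (r - 1))) Hj] := H j.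
have c40 : 0 <= 4 / c1 by rewrite divr_ge0// ltW.
have := ler_wpM2l c40 Hj; rewrite [leLHS](_ : _ = tau j `^ (r - 1) * mean_osc b (a j) (l j)).
  by rewrite -mulrDr.
by field; rewrite gt_eqF.
Qed.

End oscillation_sum.

(** * From oscillation sums to the dyadic bound *)

Section dyadic_average.
Context {R : realType} {n : nat}.
Local Notation V := 'rV[R]_n.
Local Notation mu := (lebesgue_rV n : {measure set 'rV[R]_n -> \bar R}).
Variables (a : V) (L : R) (N : nat).
Hypothesis L0 : 0 < L.

Definition dyadic_index := {k : 'I_N.+1 & {ffun 'I_n -> 'I_(2 ^ k)}}.

Definition dyadic_gen (i : dyadic_index) : nat := tag i.

Definition dyadic_side (i : dyadic_index) : R := L / 2 ^+ dyadic_gen i.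

Definition dyadic_cell (i : dyadic_index) : set V := cell a L (tagged i).

Lemma one_gt0 : (0 < 2 ^ (ord0 : 'I_N.+1))%N. Proof. by rewrite expn_gt0. Qed.

Definition dyadic_root : dyadic_index :=
  Tagged (fun k : 'I_N.+1 => {ffun 'I_n -> 'I_(2 ^ k)}) [ffun=> Ordinal one_gt0].

Lemma dyadic_side_gt0 i : 0 < dyadic_side i.
Proof. by rewrite divr_gt0// exprn_gt0. Qed.

Lemma dyadic_root_unique i : dyadic_gen i = 0%N -> i = dyadic_root.
Proof.
case: i => -[k kN] j; rewrite /dyadic_gen /= => k0; subst k.
move: j; rewrite (bool_irrelevance kN (ltn0Sn N)) => j.
congr existT; apply/ffunP => i; rewrite ffunE; apply/val_inj => /=.
by case: (j i) => -[].
Qed.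

Lemma dyadic_cell_root : dyadic_cell dyadic_root = hcub a L.
Proof.
rewrite /dyadic_cell /cell /= expr0 divr1; congr hcub; apply/rowP => i.
by rewrite !mxE ffunE /= mulr0 mul0r addr0.
Qed.

Lemma dyadic_nested i j x : dyadic_cell i x -> dyadic_cell j x ->
  (dyadic_gen i <= dyadic_gen j)%N -> dyadic_cell j `<=` dyadic_cell i.
Proof. by move=> xi xj ij; exact: (cell_nested L0 ij xi xj). Qed.

Lemma dyadic_same_gen i j x : dyadic_cell i x -> dyadic_cell j x ->
  dyadic_gen i = dyadic_gen j -> i = j.
Proof.
case: i j => [[k kN] i] [[k' kN'] j]; rewrite /dyadic_gen /dyadic_cell /= => xi xj kk'.
subst k'; move: j xj; rewrite (bool_irrelevance kN' kN) => j xj.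
by congr existT; exact: (cell_inj L0 xi xj).
Qed.

Lemma dyadic_parent i : (0 < dyadic_gen i)%N -> exists j,
  [/\ (dyadic_gen j < dyadic_gen i)%N, dyadic_cell i `<=` dyadic_cell j &
      dyadic_side j ^+ n <= 2 ^+ n * dyadic_side i ^+ n].
Proof.
case: i => -[[//|k] kN] i _; have kN' : (k < N.+1)%N by exact: ltnW.
have xi : cell a L i (cell_corner a L i).
  by move=> h; rewrite lexx ltrDl divr_gt0// exprn_gt0.
have [j xj] := cell_ex L0 k (cell_root L0 xi).
exists (Tagged (fun k : 'I_N.+1 => {ffun 'I_n -> 'I_(2 ^ k)}) (i := Ordinal kN') j).
split=> //; first exact: (cell_nested L0 (leqnSn k) xj xi).
rewrite /dyadic_side /dyadic_gen /= -exprMn exprS.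
by rewrite (_ : 2 * (L / (2 * 2 ^+ k)) = L / 2 ^+ k)//; field; rewrite expf_neq0.
Qed.

Lemma dyadic_sub_root i : dyadic_cell i `<=` dyadic_cell dyadic_root.
Proof. by rewrite dyadic_cell_root; exact: cell_root. Qed.

Variables (b : V -> R[i]) (p s r Bd : R).
Hypotheses (lb : in_L1loc b) (p0 : 0 < p) (s0 : 0 < s) (r1 : 1 < r) (Bd0 : 0 <= Bd).
Hypothesis psr : p^-1 + s^-1 = 1 - r^-1.
Hypothesis osc_bound : forall (J : finType) (a : J -> V) (l tau : J -> R) (U W : R),
  (forall j, 0 < l j) -> (forall j, 0 <= tau j) ->
  (nint mu (fun x => step_fun (fun j => hcub (a j) (l j)) (fun j => tau j `^ (r / p)) x `^ p)%R
    <= U%:E)%E ->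
  (nint mu (fun x => step_fun (fun j => hcub (a j) (l j)) (fun j => tau j `^ (r / s)) x `^ s)%R
    <= W%:E)%E ->
  \sum_j tau j `^ (r - 1) * mean_osc b (a j) (l j) <= Bd * U `^ p^-1 * W `^ s^-1.

Definition root_avg : R[i] := cavg mu (hcub a L) (L ^+ n) b.

Definition cell_avg (j : {ffun 'I_n -> 'I_(2 ^ N)}) : R :=
  fine (cnint mu (cell a L j) (fun x => b x - root_avg)) / (L / 2 ^+ N) ^+ n.

(** The laminar estimate is applied with [D = 2 ^+ n]; the averages over the finest cells are then
    dominated by the maximal function over all generations up to [N]. *)
Lemma dyadic_maximal :
  (nint mu (fun x => step_fun (cell a L (k := N)) cell_avg x `^ r)%R <=
    ((laminar_cst (2 ^+ n) p s r * Bd) `^ r)%:E)%E.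
Proof.
have r0 : 0 < r by exact: lt_trans r1.
have mb := lb.1.
pose vol (i : dyadic_index) := dyadic_side i ^+ n.
have vol0 i : 0 < vol i by rewrite exprn_gt0// dyadic_side_gt0.
have mQ (i : dyadic_index) : measurable (dyadic_cell i) by exact: measurable_cell.
have muQ (i : dyadic_index) : mu (dyadic_cell i) = (vol i)%:E by exact: mu_cell.
have bQ (i : dyadic_index) : (cnint mu (dyadic_cell i) b < +oo)%E by exact: cnint_hcub_lty.
pose avg i := cavg mu (dyadic_cell i) (vol i) b.
pose osc i x := normc (b x - avg i).
have avg_root : avg dyadic_root = root_avg.
  by rewrite /avg dyadic_cell_root /vol /dyadic_side /dyadic_gen /= expr0 divr1.
pose A i := fine (cnint mu (dyadic_cell i) (fun x => b x - root_avg)) / vol i.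
have AE i : cnint mu (dyadic_cell i) (fun x => b x - root_avg) = (A i * vol i)%:E.
  rewrite /A divfK ?gt_eqF// fineK// ge0_fin_numE ?cnint_ge0//.
  exact: (cnintB_lty (mQ i) (muQ i)).
have A0 i : 0 <= A i by rewrite divr_ge0 ?(ltW (vol0 i))// fine_ge0// cnint_ge0.
have mosc i : measurable_fun setT (osc i).
  by apply: measurable_normc; apply: cmeasurableB => //; exact: cmeasurable_cst.
have core := @laminar_core _ _ _ mu _ dyadic_cell vol dyadic_gen dyadic_root (2 ^+ n)
  mQ muQ vol0.
apply: le_trans (core _ _ _ _ _ _ _ osc A (fun i => mean_osc b (cell_corner a L (tagged i)) (dyadic_side i))
  mosc _ A0 _ _ _ p s r Bd p0 s0 r1 Bd0 psr _).
- apply: nint_le.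
  + apply: (measurableT_comp (measurable_powR r)); apply: measurable_step_fun => j.
    exact: measurable_cell.
  + apply: (measurableT_comp (measurable_powR r)); exact: measurable_max_fun.
  + by move=> x; exact: powR_ge0.
  + move=> x; apply: ge0_ler_powR; rewrite ?nnegrE ?(ltW r0) ?max_fun_ge0//.
      apply: step_fun_ge0 => j; exact: (A0 (Tagged (fun k : 'I_N.+1 => {ffun 'I_n -> 'I_(2 ^ k)}) (i := ord_max) j)).
    have [xr|xr] := pselect (hcub a L x); last first.
      rewrite (_ : step_fun _ _ x = 0) ?max_fun_ge0// /step_fun big1// => j _.
      by rewrite indicE memNset ?mulr0// => /(cell_root L0).
    have [j xj] := cell_ex L0 N xr.
    rewrite /step_fun (bigD1 j)//= big1 ?addr0; last first.
      move=> i ij; rewrite indicE memNset ?mulr0// => xi.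
      by move/eqP: ij; apply; exact: (cell_inj L0 xi xj).
    rewrite indicE mem_set// mulr1.
    pose i1 : dyadic_index := Tagged (fun k : 'I_N.+1 => {ffun 'I_n -> 'I_(2 ^ k)}) (i := ord_max) j.
    exact: (@max_fun_ge _ _ _ _ dyadic_cell A i1 x xj).
- by rewrite exprn_ege1// ler1n.
- by [].
- exact: dyadic_root_unique.
- exact: dyadic_sub_root.
- exact: dyadic_nested.
- exact: dyadic_same_gen.
- exact: dyadic_parent.
- by move=> i x; exact: normc_ge0'.
- move=> i; rewrite /mean_osc fineK// ge0_fin_numE ?cnint_ge0//.
  exact: (cnintB_lty (mQ i) (muQ i)).
- by move=> i; rewrite -AE /osc avg_root.
- move=> i x xi; rewrite /osc avg_root (le_trans (ler_normc_dist _ (avg i) _))// lerD2l.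
  rewrite -(ler_pM2l (vol0 i)) [leRHS]mulrC -lee_fin -AE.
  exact: (cavg_dist_le (mQ i) (muQ i)).
- move=> J k tau U W tau0 U0 W0 HU HW.
  exact: (osc_bound (a := fun j => cell_corner a L (tagged (k j))) (fun j => dyadic_side_gt0 (k j)) tau0 HU HW).
Qed.

End dyadic_average.

(** Fatou's lemma: a uniform bound on the integrals survives pointwise convergence without
    domination. *)
Lemma nint_pointwise_limit d (T : measurableType d) (R : realType)
    (mu : {measure set T -> \bar R}) (f : nat -> T -> R) (g : T -> R) (B : R) :
  (forall m, measurable_fun setT (f m)) -> (forall m x, 0 <= f m x) ->
  (forall x, f ^~ x @ \oo --> g x) -> (forall m, nint mu (f m) <= B%:E)%E ->
  (nint mu g <= B%:E)%E.
Proof.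
move=> mf f0 fg fB.
have := @fatou _ T R mu setT measurableT (fun m x => (f m x)%:E)
  (fun m => proj2 (measurable_EFinP _ _) (mf m)) (fun m x _ => f0 m x).
rewrite (_ : (\int[mu]_x limn_einf ((fun m x => (f m x)%:E)^~ x))%E = nint mu g); last first.
  apply: eq_integral => x _.
  have H : (fun m => (f m x)%:E) @ \oo --> (g x)%:E by apply: cvg_EFin; [exact: nearW|exact: fg].
  by rewrite is_cvg_limn_einfE; [exact/cvg_lim|apply/cvg_ex; exists (g x)%:E].
move=> /le_trans; apply; rewrite limn_einf_lim; apply: lime_le; first exact: is_cvg_einfs.
apply: nearW => m; apply: le_trans (fB m); apply: ereal_inf_lbound.
by exists m => //=.
Qed.

(* Young's inequality for [E] and [min h M `^ (r - 1)]. After truncation the error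
   is linear in [h - E], so convergence of averages in L^1 is enough to pass to
   the limit. *)
Lemma powR_min_le (R : realType) (r M E h : R) : 1 < r -> 0 <= M -> 0 <= E -> 0 <= h ->
  Num.min h M `^ r <= E `^ r + r * M `^ (r - 1) * `|h - E|.
Proof.
move=> r1 M0 E0 h0; have r0 : 0 < r by exact: lt_trans r1.
set m := Num.min h M; have m0 : 0 <= m by rewrite le_min h0.
have rm : 0 < r - 1 by rewrite subr_gt0.
pose r' := r / (r - 1); have r'0 : 0 < r' by rewrite divr_gt0.
have mr : m `^ r = m * m `^ (r - 1).
  rewrite -{2}(powRr1 m0) -powRD; first by rewrite addrC subrK.
  by rewrite addrC subrK gt_eqF.
have mh : m <= h by rewrite ge_min lexx.
have mM : m `^ (r - 1) <= M `^ (r - 1).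
  by apply: ge0_ler_powR; rewrite ?nnegrE ?(ltW rm)// ge_min lexx orbT.
have Y : E * m `^ (r - 1) <= E `^ r / r + m `^ r * (1 - r^-1).
  have := @conjugate_powR _ E (m `^ (r - 1)) r r' E0 (powR_ge0 _ _) r0 r'0.
  rewrite -powRrM /r' (_ : (r - 1) * (r / (r - 1)) = r); last by field; rewrite gt_eqF.
  rewrite (_ : (r / (r - 1))^-1 = 1 - r^-1); last by field; rewrite !gt_eqF.
  by apply; rewrite addrC subrK.
have hE : h <= E + `|h - E| by rewrite -lerBlDl ler_norm.
have s1 : m * m `^ (r - 1) <= (E + `|h - E|) * m `^ (r - 1).
  by rewrite ler_wpM2r ?powR_ge0// (le_trans mh).
have s2 : `|h - E| * m `^ (r - 1) <= `|h - E| * M `^ (r - 1) by rewrite ler_wpM2l.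
have : m `^ r / r <= E `^ r / r + `|h - E| * M `^ (r - 1).
  have : m `^ r <= E `^ r / r + m `^ r * (1 - r^-1) + `|h - E| * M `^ (r - 1).
    by rewrite {1}mr (le_trans s1)// mulrDl lerD.
  by rewrite mulrBr mulr1; lra.
rewrite -(ler_pM2l r0) mulrDr !(mulrCA r _ r^-1) divff ?gt_eqF// !mulr1.
by rewrite (_ : r * M `^ (r - 1) * `|h - E| = r * (`|h - E| * M `^ (r - 1)))// -mulrA [M `^ _ * _]mulrC.
Qed.

(** * Passage to the limit in the generations *)

Section dyadic_limit.
Context {R : realType} {n : nat}.
Local Notation V := 'rV[R]_n.
Local Notation mu := (lebesgue_rV n : {measure set 'rV[R]_n -> \bar R}).
Variables (a : V) (L : R) (b : V -> R[i]) (r B : R).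
Hypotheses (L0 : 0 < L) (lb : in_L1loc b) (r1 : 1 < r).
Local Notation c0 := (root_avg a L b).
Hypothesis cell_bound : forall N,
  (nint mu (fun x => step_fun (cell a L (k := N)) (cell_avg a L b (N := N)) x `^ r)%R <= B%:E)%E.

Let h x := normc (b x - c0).

Let mh : measurable_fun setT h.
Proof.
by apply: measurable_normc; apply: cmeasurableB; [exact: lb.1|exact: cmeasurable_cst].
Qed.

Let h0 x : 0 <= h x. Proof. exact: normc_ge0'. Qed.

Let hfin : (nint mu (fun x => \1_(hcub a L) x * `|h x|)%R < +oo)%E.
Proof.
under eq_nint do rewrite ger0_norm//.
apply: (cnintB_lty (measurable_hcub a L) (mu_hcub a L0)); first exact: lb.1.
exact: cnint_hcub_lty.
Qed.

(** Approximation by some constants on the cells thus becomes approximation by the averages, up to a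
    factor 2; [h] is viewed as complex-valued in order to use [cavg_osc_le]. *)
Lemma cell_avg_dist N (j : {ffun 'I_n -> 'I_(2 ^ N)}) (c : R) :
  (nint mu (fun x => \1_(cell a L j) x * `|h x - cell_avg a L b j|)%R <=
    2%:E * nint mu (fun x => \1_(cell a L j) x * `|h x - c|)%R)%E.
Proof.
pose v := (L / 2 ^+ N) ^+ n.
have v0 : 0 < v by rewrite exprn_gt0// divr_gt0// exprn_gt0.
have mQ := measurable_cell a L j; have muQ : mu (cell a L j) = v%:E by exact: mu_cell.
pose hc x := (h x)%:C%C.
have mhc : cmeasurable_fun setT hc by exact: cmeasurable_real.
have E (A : set V) (c' : R) : cnint mu A (fun x => hc x - c'%:C%C) = nint mu (fun x => \1_A x * `|h x - c'|)%R.
  by apply: eq_nint => x; rewrite -rmorphB normc_real.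
have hcfin : (cnint mu (cell a L j) hc < +oo)%E.
  have -> : cnint mu (cell a L j) hc = cnint mu (cell a L j) (fun x => b x - c0).
    by apply: eq_nint => x; rewrite normc_real ger0_norm.
  apply: (cnintB_lty mQ muQ); first exact: lb.1.
  exact: cnint_hcub_lty.
have := cavg_osc_le mQ muQ v0 (c%:C)%C mhc hcfin.
have -> : cavg mu (cell a L j) v hc = (cell_avg a L b j)%:C%C.
  rewrite /cavg /cell_avg -/v mulrC rmorphM/=; congr (_ * _).
  rewrite /cint_over /= Rintegral_cst// mul0r; congr Complex.
  by rewrite cnintE.
by rewrite !E.
Qed.

Lemma root_osc_le : (nint mu (fun x => \1_(hcub a L) x * h x `^ r)%R <= B%:E)%E.
Proof.
have r0 : 0 < r by exact: lt_trans r1.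
have mroot : measurable_fun setT (\1_(hcub a L) : V -> R).
  by apply: measurable_indic; exact: measurable_hcub.
have mpow (g : V -> R) : measurable_fun setT g -> measurable_fun setT (fun x => g x `^ r).
  by move=> mg; exact: (measurableT_comp (measurable_powR r)).
have mmin m : measurable_fun setT (fun x => \1_(hcub a L) x * Num.min (h x) m%:R `^ r).
  apply: measurable_funM => //; apply: mpow; exact: measurable_minr.
apply: (nint_pointwise_limit (f := fun m x => \1_(hcub a L) x * Num.min (h x) m%:R `^ r)) => //.
- by move=> m x; rewrite mulr_ge0// powR_ge0.
- move=> x; apply: cvg_near_cst; exists (Num.truncn (h x)).+1 => // m /= hm.
  rewrite min_l// ltW// (lt_le_trans (truncnS_gt _))// ler_nat//.
move=> m; apply/lee_addgt0Pr => e e0.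
pose k := r * m%:R `^ (r - 1).
have k0 : 0 <= k by rewrite mulr_ge0 ?powR_ge0// ltW.
(* The averages are at distance at most twice this, and [k] times that distance is at most [e]. *)
have e1 : 0 < e / (2 * k + 1) by rewrite divr_gt0// ltr_wpDl// mulr_ge0.
have [N0 /(_ N0 (leqnn _)) [c cN]] := integrable_cell_limit L0 mh hfin e1.
pose A := @cell_avg _ _ a L N0 b; pose E := step_fun (cell a L (k := N0)) A.
have A0 j : 0 <= A j.
  by rewrite /A /cell_avg divr_ge0 ?fine_ge0 ?cnint_ge0// exprn_ge0// ltW// divr_gt0// exprn_gt0.
have E0 x : 0 <= E x by exact: step_fun_ge0.
have mE : measurable_fun setT E by apply: measurable_step_fun => j; exact: measurable_cell.
have mcell j (g : V -> R) : measurable_fun setT g -> measurable_fun setT (fun x => \1_(cell a L (k := N0) j) x * g x).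
  by move=> mg; apply: measurable_funM => //; apply: measurable_indic; exact: measurable_cell.
have dist : (nint mu (fun x => \1_(hcub a L) x * `|h x - E x|)%R <= (2 * (e / (2 * k + 1)))%:E)%E.
  rewrite EFinM; apply: (@le_trans _ _ (2%:E * cell_dist a L h c)%E); last first.
    by rewrite lee_wpmul2l// ltW.
  rewrite (_ : nint _ _ = \sum_j nint mu (fun x => \1_(cell a L (k := N0) j) x * `|h x - A j|)%R)%E.
    rewrite /cell_dist ge0_sume_distrr; last first.
      by move=> j _; apply: nint_ge0 => x; rewrite mulr_ge0.
    by apply: lee_sum => j _; exact: cell_avg_dist.
  rewrite -nint_sum; last 2 first.
  - move=> j; apply: mcell; apply: measurableT_comp => //; exact: measurable_funB.
  - by move=> j x; rewrite mulr_ge0.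
  apply: eq_nint => x; rewrite -(sum_cell a L0 N0) mulr_suml; apply: eq_bigr => j _.
  rewrite indicE; case: (boolP (x \in cell a L j)) => [/set_mem xj|_]; last by rewrite !mul0r.
  rewrite !mul1r /E /step_fun (bigD1 j)//= big1 ?addr0; last first.
    move=> i ij; rewrite indicE memNset ?mulr0// => xi.
    by move/eqP: ij; apply; exact: (cell_inj L0 xi xj).
  by rewrite indicE mem_set// mulr1.
apply: (@le_trans _ _ (nint mu (fun x => E x `^ r + k * (\1_(hcub a L) x * `|h x - E x|))%R)).
  apply: nint_le => //.
  - apply: measurable_funD; first exact: mpow.
    apply: measurable_funM => //; apply: measurable_funM => //.
    by apply: measurableT_comp => //; exact: measurable_funB.
  - by move=> x; rewrite mulr_ge0// powR_ge0.
  - move=> x; rewrite indicE; case: (x \in hcub a L) => /=; last first.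
      by rewrite !mul0r mulr0 addr0 powR_ge0.
    by rewrite !mul1r; apply: powR_min_le.
have md : measurable_fun setT (fun x => \1_(hcub a L) x * `|h x - E x|).
  apply: measurable_funM => //; apply: measurableT_comp => //; exact: measurable_funB.
rewrite nintD; first last.
- by move=> x; rewrite mulr_ge0// mulr_ge0.
- exact: measurable_funM.
- by move=> x; exact: powR_ge0.
- exact: mpow.
apply: leeD; first exact: cell_bound.
rewrite nintZ//.
have k0' : (0 <= k%:E)%E by rewrite lee_fin.
apply: le_trans (lee_wpmul2l k0' dist) _.
have q0 : 0 < 2 * k + 1 by rewrite ltr_wpDl// mulr_ge0.
rewrite -EFinM lee_fin; clearbody k.
rewrite (_ : k * (2 * (e / (2 * k + 1))) = e * (2 * k) / (2 * k + 1)); last first.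
  by field; rewrite gt_eqF.
by rewrite ler_pdivrMr// ler_wpM2l ?(ltW e0)// lerDl.
Qed.

End dyadic_limit.

(** * Mean values over growing cubes *)

(** The limit 0 is treated apart because the real power is defined through the logarithm. *)
Lemma cvg_powR (R : realType) (r : R) (u : nat -> R) (l : R) : 0 < r -> (forall m, 0 <= u m) ->
  u @ \oo --> l -> (fun m => u m `^ r) @ \oo --> l `^ r.
Proof.
move=> r0 u0 ul; have l0 : 0 <= l.
  have ucvg : cvgn u by apply/cvg_ex; exists l.
  by rewrite -(cvg_lim _ ul)//; apply: limr_ge => //; exact: nearW.
move: l0; rewrite le_eqVlt => /predU1P[l0|l0]; last first.
  have E : (fun m => expR (r * ln (u m))) @ \oo --> l `^ r.
    rewrite /powR gt_eqF//; apply: continuous_cvg; first exact: continuous_expR.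
    apply: cvgMr; apply: continuous_cvg => //; exact: continuous_ln.
  apply: cvg_trans E; apply: near_eq_cvg.
  near=> m; have um : 0 < u m by near: m; exact: (cvgr_gt l ul _ l0).
  by rewrite /powR gt_eqF.
rewrite -l0 powR0 ?gt_eqF//; rewrite -l0 in ul.
apply/cvgrPdist_lt => e e0.
near=> m; have um : u m < e `^ r^-1.
  by near: m; exact: (cvgr_lt 0 ul _ (powR_gt0 r^-1 e0)).
rewrite sub0r normrN ger0_norm ?powR_ge0//.
have -> : e = (e `^ r^-1) `^ r by rewrite -powRrM mulVf ?gt_eqF// powRr1// ltW.
by apply: gt0_ltr_powR; rewrite ?nnegrE ?powR_ge0.
Unshelve. all: by end_near. Qed.

Lemma geometric_cauchy (R : realType) (u : nat -> R) (C rho : R) : 0 <= C -> 0 <= rho < 1 ->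
  (forall m, `|u m.+1 - u m| <= C * rho ^+ m) -> cvgn u.
Proof.
move=> C0 /andP[rho0 rho1] H.
have E : u = (fun m => u 0%N + series (telescope u) m).
  by apply/funext => m; exact: eq_sum_telescope.
rewrite E; apply: is_cvgD; first exact: is_cvg_cst.
apply: normed_cvg; apply: (@series_le_cvg _ _ (geometric C rho)).
- by move=> m /=.
- by move=> m; rewrite /= mulr_ge0// exprn_ge0.
- by move=> m; exact: H.
- by apply: is_cvg_geometric_series; rewrite ger0_norm.
Qed.

Section global_mean.
Context {R : realType} {n : nat}.
Local Notation V := 'rV[R]_n.
Local Notation mu := (lebesgue_rV n : {measure set 'rV[R]_n -> \bar R}).
Variables (b : V -> R[i]) (r B : R).
Hypotheses (n0 : (0 < n)%N) (lb : in_L1loc b) (r1 : 1 < r) (B0 : 0 <= B).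
Hypothesis root_bound : forall (a : V) (L : R), 0 < L ->
  (nint mu (fun x => \1_(hcub a L) x * normc (b x - root_avg a L b) `^ r)%R <= B%:E)%E.

Let r0 : 0 < r. Proof. exact: lt_trans r1. Qed.

Let mdist c : measurable_fun setT (fun x => normc (b x - c)).
Proof.
by apply: measurable_normc; apply: cmeasurableB; [exact: lb.1|exact: cmeasurable_cst].
Qed.

(** Here [lambda] is the volume [v] of the small cube to the power [-1/r]. Pointwise
    [h <= lambda * v * h ^ r + lambda], by cases on [h <= lambda]; integrating over the small cube
    and dividing by [v] bounds the jump of the means without Hölder's inequality. *)
Lemma root_avg_step (a a' : V) (L L' lambda : R) : 0 < L -> 0 < L' -> 0 < lambda ->
  hcub a L `<=` hcub a' L' -> lambda `^ r * L ^+ n = 1 ->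
  normc (root_avg a L b - root_avg a' L' b) <= lambda * (B + 1).
Proof.
move=> L0 L'0 lam0 sub lamE; set c := root_avg a' L' b.
pose v := L ^+ n; have v0 : 0 < v by rewrite exprn_gt0.
have mQ := measurable_hcub a L; have muQ : mu (hcub a L) = v%:E by exact: mu_hcub.
have mQ' := measurable_hcub a' L'.
pose h x := normc (b x - c).
have h0 x : 0 <= h x by exact: normc_ge0'.
have mhr : measurable_fun setT (fun x => h x `^ r).
  by apply: (measurableT_comp (measurable_powR r)); exact: mdist.
have k0 : 0 <= lambda * v by rewrite mulr_ge0// ltW.
have pw x : h x <= lambda * v * h x `^ r + lambda.
  have [hl|/ltW lh] := leP (h x) lambda.
    by rewrite (le_trans hl)// lerDr mulr_ge0// powR_ge0.
  rewrite ler_wpDr ?(ltW lam0)//.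
  have hE : h x `^ r = h x * h x `^ (r - 1).
    rewrite -{2}(powRr1 (h0 x)) -powRD; first by rewrite addrC subrK.
    by rewrite addrC subrK gt_eqF.
  have lE : lambda `^ r = lambda * lambda `^ (r - 1).
    rewrite -{2}(powRr1 (ltW lam0)) -powRD; first by rewrite addrC subrK.
    by rewrite addrC subrK gt_eqF.
  have hl : lambda `^ (r - 1) <= h x `^ (r - 1).
    by apply: ge0_ler_powR; rewrite ?nnegrE ?subr_ge0// ltW.
  rewrite hE mulrCA ler_peMr// -[leLHS]lamE lE -/v [leRHS]mulrAC ler_wpM2r ?(ltW v0)//.
  by rewrite ler_wpM2l// ltW.
have := cavg_dist_le mQ muQ v0 c lb.1 (cnint_hcub_lty a L lb).
move=> /le_trans H; rewrite -(ler_pM2l v0) -lee_fin; apply: H.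
apply: (@le_trans _ _ (nint mu (fun x => lambda * v * (\1_(hcub a' L') x * h x `^ r) +
    lambda * \1_(hcub a L) x)%R)).
  apply: nint_le.
  - by apply: measurable_funM => //; exact: mdist.
  - apply: measurable_funD; last by apply: measurable_funM.
    by apply: measurable_funM => //; apply: measurable_funM.
  - by move=> x; rewrite mulr_ge0 ?normc_ge0'.
  - move=> x; rewrite [in leLHS]indicE; case: (boolP (x \in hcub a L)) => [/set_mem xQ|_].
      rewrite mul1r !indicE (mem_set xQ) (mem_set (sub _ xQ)) mul1r mulr1; exact: pw.
    by rewrite mul0r addr_ge0// !mulr_ge0 ?powR_ge0// ltW.
rewrite nintD; first last.
- by move=> x; rewrite mulr_ge0// ltW.
- by apply: measurable_funM.
- by move=> x; rewrite !mulr_ge0 ?powR_ge0// ltW.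
- by apply: measurable_funM => //; apply: measurable_funM.
rewrite nintZ//; last 2 first.
- by apply: measurable_funM.
- by move=> x; rewrite mulr_ge0// powR_ge0.
rewrite nintZ ?(ltW lam0)// nint_indic// muQ.
have k0' : (0 <= (lambda * v)%:E)%E by rewrite lee_fin.
apply: le_trans (leeD (lee_wpmul2l k0' (root_bound a' L'0)) (lexx _)) _.
by rewrite -!EFinM -EFinD lee_fin le_eqVlt; apply/orP; left; apply/eqP; ring.
Qed.

Let corner (m : nat) : V := const_mx (- 2 ^+ m).
Let side (m : nat) : R := 2 ^+ m.+1.
Let mean m := root_avg (corner m) (side m) b.
(** Doubling the side multiplies the volume to the power [-1/r] by this ratio, which is less than 1
    as [n > 0]; so the means form a Cauchy sequence. *)
Let rho : R := 2 `^ (- (n%:R / r)).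

Let side0 m : 0 < side m. Proof. by rewrite exprn_gt0. Qed.

Let rho01 : 0 <= rho < 1.
Proof.
rewrite powR_ge0 /rho /powR gt_eqF//= expR_lt1 mulNr oppr_lt0 mulr_gt0//.
  by rewrite divr_gt0// ltr0n.
by rewrite ln_gt0// ltr1n.
Qed.

Lemma mean_step m : normc (mean m - mean m.+1) <= rho * (B + 1) * rho ^+ m.
Proof.
rewrite mulrAC -exprS; apply: root_avg_step => //.
- by rewrite exprn_gt0// powR_gt0.
- move=> x H i; have := H i; rewrite !mxE /side !exprS.
  have : 0 < 2 ^+ m :> R by rewrite exprn_gt0.
  lra.
have -> : rho ^+ m.+1 = 2 `^ (- (n%:R / r) * m.+1%:R).
  by rewrite powRrM powR_mulrn// powR_ge0.
have -> : side m ^+ n = 2 `^ (m.+1%:R * n%:R).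
  by rewrite /side -exprM -powR_mulrn// natrM.
rewrite -powRrM -powRD; last by rewrite pnatr_eq0 implybT.
by rewrite (_ : _ + _ = 0) ?powRr0//; field; exact: lt0r_neq0.
Qed.

(** Each point is eventually inside the growing cubes and the means converge to [c], so the bounded
    integrals over the cubes pass to the limit by Fatou's lemma. *)
Lemma global_mean_osc : exists c : R[i], (nint mu (fun x => normc (b x - c) `^ r)%R <= B%:E)%E.
Proof.
have C0 : 0 <= rho * (B + 1) by rewrite mulr_ge0 ?powR_ge0// addr_ge0.
have cR : cvgn (fun m => complex.Re (mean m)).
  apply: (geometric_cauchy C0 rho01) => m.
  by rewrite (le_trans _ (mean_step m))// distrC (le_trans _ (normRe_le _)).
have cI : cvgn (fun m => complex.Im (mean m)).
  apply: (geometric_cauchy C0 rho01) => m.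
  by rewrite (le_trans _ (mean_step m))// distrC (le_trans _ (normIm_le _)).
pose c := Complex (limn (fun m => complex.Re (mean m))) (limn (fun m => complex.Im (mean m))).
exists c.
apply: (nint_pointwise_limit
  (f := fun m x => \1_(hcub (corner m) (side m)) x * normc (b x - mean m) `^ r)).
- move=> m; apply: measurable_funM; first by apply: measurable_indic; exact: measurable_hcub.
  by apply: (measurableT_comp (measurable_powR r)); exact: mdist.
- by move=> m x; rewrite mulr_ge0// powR_ge0.
- move=> x; have E : (fun m => normc (b x - mean m) `^ r) @ \oo --> normc (b x - c) `^ r.
    apply: cvg_powR => //; first by move=> m; exact: normc_ge0'.
    rewrite normcE2; under eq_fun do rewrite normcE2.
    apply: continuous_cvg; first exact: sqrt_continuous.
    by rewrite !cReD !cImD !cReN !cImN; under eq_fun do rewrite cReD cImD cReN cImN !expr2;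
      rewrite !expr2; apply: cvgD; apply: cvgM; apply: cvgB => //; exact: cvg_cst.
  apply: cvg_trans E; apply: near_eq_cvg.
  exists (Num.truncn (sum_norm x)).+1 => // m /= hm.
  rewrite indicE mem_set ?mul1r// => i; rewrite mxE /side exprS.
  have xm : `|x ord0 i| < 2 ^+ m.
    rewrite (le_lt_trans (le_sum_norm x i))// (lt_le_trans (truncnS_gt _))//.
    by rewrite (le_trans (_ : _ <= m%:R)) ?ler_nat// -natrX ler_nat ltnW// ltn_expl.
  by move: xm; rewrite ltr_norml; lra.
- by move=> m; exact: root_bound.
Qed.

End global_mean.

(** * Conclusion *)

Lemma laminar_cst_ge0 (R : realType) (D p s r : R) : 1 <= D -> 0 < p -> 0 < s -> 0 < r ->
  0 <= laminar_cst D p s r.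
Proof.
move=> D1 p0 s0 r0; have a1 : 1 < 2 * D by lra.
have a0 : 0 < 2 * D by exact: lt_trans a1.
have g1 : 0 < geom_cst (2 * D) (r / p) by rewrite geom_cst_gt0// divr_gt0.
have g2 : 0 < geom_cst (2 * D) (r / s) by rewrite geom_cst_gt0// divr_gt0.
rewrite !mulr_ge0 ?powR_ge0 ?(ltW a0) ?(ltW g1) ?(ltW g2)//.
  by lra.
by rewrite addr_ge0// mulr_ge0// powR_ge0.
Qed.

Lemma osc_sum_cst_ge0 (R : realType) (n : nat) (C c1 p s : R) : 0 < c1 ->
  0 <= osc_sum_cst (n := n) C c1 p s.
Proof. by move=> c10; rewrite !mulr_ge0 ?powR_ge0 ?invr_ge0// ltW. Qed.

Unset Implicit Arguments.

Theorem theorem2p5p1 (R : realType) (d : nat) (K : 'rV[R]_d -> 'rV[R]_d -> R[i])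
    (p q kappa : R) :
  (0 < d)%N ->
  nondegenerate_cz_kernel K ->
  1 < q -> q < p -> 0 < kappa ->
  exists C : R, 0 <= C /\
    forall (b : 'rV[R]_d -> R[i]) (Theta : R),
    in_L1loc b -> 0 <= Theta ->
    (forall (N : nat) (Q Q' : 'I_N -> set 'rV[R]_d)
        (f g : 'I_N -> 'rV[R]_d -> R[i]),
      (0 < N)%N ->
      (forall i, is_cube (Q i) /\ is_cube (Q' i)) ->
      (forall i, diam (Q i) = diam (Q' i)) ->
      (forall i, kappa * diam (Q i) <= dist (Q i) (Q' i)) ->
      (forall i, in_Linfty_on (Q i) (f i)) ->
      (forall i, in_Linfty_on (Q' i) (g i)) ->
      ((\sum_(i < N) normc (commutator_form b K (f i) (g i)))%:E <=
        Theta%:E *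
        Lnorm (lebesgue_rV d) p%:E
          (fun x => \sum_(i < N) cLnorm +oo (f i) * (\1_(Q i) x)%:E) *
        Lnorm (lebesgue_rV d) (q / (q - 1))%:E
          (fun x => \sum_(i < N) cLnorm +oo (g i) * (\1_(Q' i) x)%:E))%E) ->
    let r := p * q / (p - q) in
    exists (a : 'rV[R]_d -> R[i]) (c : R[i]),
      [/\ in_Lp r%:E a,
          (cLnorm r%:E a <= (C * Theta)%:E)%E &
          {ae lebesgue_rV d, forall x, b x = a x + c}].
Proof.
move=> d0 HK q1 qp k0.
pose s := q / (q - 1); pose r := p * q / (p - q).
have p0 : 0 < p by lra.
have q0 : 0 < q by lra.
have pq : 0 < p - q by rewrite subr_gt0.
have s0 : 0 < s by rewrite divr_gt0// subr_gt0.
have r1 : 1 < r by rewrite /r ltr_pdivlMr// mul1r; nra.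
have r0 : 0 < r by exact: lt_trans r1.
have psr : p^-1 + s^-1 = 1 - r^-1.
  by rewrite /s /r; field; rewrite !gt_eqF// subr_gt0.
(* This is the tolerance that [good_pair_osc] absorbs. The constants of the good pair are fixed
   before [b] and [Theta] appear. *)
have eps0 : 0 < 8^-1 :> R by rewrite invr_gt0.
have [C0 [c1 [C00 c10 GP]]] := nondegenerate_good_pair d0 HK k0 eps0.
have lam0 : 0 <= laminar_cst (2 ^+ d) p s r.
  by apply: laminar_cst_ge0 => //; rewrite exprn_ege1// ler1n.
have osc0 : 0 <= osc_sum_cst (n := d) C0 c1 p s by exact: osc_sum_cst_ge0.
exists (laminar_cst (2 ^+ d) p s r * osc_sum_cst (n := d) C0 c1 p s); split.
  exact: mulr_ge0.
move=> b Theta lb T0 FB r'.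
pose B := (laminar_cst (2 ^+ d) p s r * (osc_sum_cst (n := d) C0 c1 p s * Theta)).
have B0 : 0 <= B by exact: (mulr_ge0 lam0 (mulr_ge0 osc0 T0)).
have osc_bound := mean_osc_sum q1 qp (ltW k0) C00 c10 T0 GP lb FB.
have [c Hc] : exists c : R[i],
    (nint (lebesgue_rV d) (fun x => normc (b x - c) `^ r)%R <= (B `^ r)%:E)%E.
  apply: global_mean_osc => //; first exact: powR_ge0.
  move=> a L L0; apply: root_osc_le => // N.
  by apply: dyadic_maximal => //; exact: mulr_ge0.
have le : (cLnorm r%:E (fun x => (b x - c)%R) <= B%:E)%E.
  rewrite /cLnorm unlock /=.
  have -> : B%:E = ((B `^ r)%:E `^ r^-1)%E.
    by rewrite poweR_EFin -powRrM mulfV ?gt_eqF// powRr1.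
  have E : (\int[lebesgue_rV d]_x ((`|normc (b x - c)|)%:E `^ r) =
      nint (lebesgue_rV d) (fun x => normc (b x - c) `^ r)%R)%E.
    by apply: eq_integral => x _; rewrite ger0_norm ?normc_ge0'.
  have V0 : 0 <= r^-1 by rewrite invr_ge0 ltW.
  by rewrite E; apply: (le_poweR V0 _ Hc); apply: nint_ge0 => x; exact: powR_ge0.
exists (fun x => b x - c), c; split.
- split; first by apply: cmeasurableB; [exact: lb.1|exact: cmeasurable_cst].
  exact: le_lt_trans le (ltry _).
- by rewrite -mulrA.
- by apply: nearW => x; rewrite subrK.
Qed.
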